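(* Let $T$ be an $n$-dimensional algebraic torus over $\mathbb{C}$ and let $\mathcal{A}=\{\mathcal{K}_1,\dots,\mathcal{K}_m\}$ be a toric arrangement in $T$. Choose a basis of $X^*(T)$ and let $T\subset(\mathbb{P}^1)^n$ be the corresponding $T$-embedding. Then there is a fan $\Delta(\mathcal{A})$ in $V=\hom_{\mathbb{Z}}(X^*(T),\mathbb{R})$ such that: 1) the $T$-embedding $K_{\Delta(\mathcal{A})}$ is smooth and it is obtained from $(\mathbb{P}^1)^n$ by a sequence of blowups along closures of $T$-orbits of codimension $2$; 2) every $\mathcal{A}$-layer has property $(E)$ with respect to $\Delta(\mathcal{A})$.
   Context: $X^*(T)$ is the character lattice of $T$, $X_*(T)=\hom_{\mathbb{Z}}(X^*(T),\mathbb{Z})$, $V=X_*(T)\otimes_{\mathbb{Z}}\mathbb{R}$; for $\chi\in X^*(T)$ the corresponding character $T\to\mathbb{C}^*$ is denoted $x_\chi$. A basis of $X^*(T)$ identifies $T$ with $(\mathbb{C}^* )^n$, which is embedded in $(\mathbb{P}^1)^n$ in the standard way; the fan of $(\mathbb{P}^1)^n$ is the decomposition of $V\cong\mathbb{R}^n$ into quadrants (orthants) and their faces. $K_\Delta$ denotes the toric variety ($T$-embedding) of a fan $\Delta$ in $V$. Layer: given a split direct summand $\Gamma\subset X^*(T)$ and a homomorphism $\phi:\Gamma\to\mathbb{C}^*$, the layer is $\mathcal{K}_{\Gamma,\phi}=\{t\in T\mid x_\chi(t)=\phi(\chi)\ \forall\chi\in\Gamma\}$. A toric arrangement is a finite set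 of layers. An $\mathcal{A}$-layer is a connected component of an intersection of some of the $\mathcal{K}_i$ (it is itself a layer). Property $(E)$: for linearly independent $e^1,\dots,e^h\in V$, $C(e^1,\dots,e^h)$ denotes the cone of their nonnegative combinations; a subspace $U\subset V^*$ has property $(E)$ with respect to it if $U$ has a basis $u_1,\dots,u_r$ with $\langle u_i,e^j\rangle\ge0$ for all $i,j$. A layer $\mathcal{K}_{\Gamma,\phi}$ has property $(E)$ with respect to a (smooth, hence simplicial) fan if $\Gamma\otimes_{\mathbb{Z}}\mathbb{R}\subset V^*$ has property $(E)$ with respect to every cone of the fan. *)

(* Defs.v *)
From HB Require Import structures.
From mathcomp Require Import all_boot all_order all_algebra.
From mathcomp Require Import complex.
From mathcomp Require Import all_classical all_reals all_analysis.

Set Implicit Arguments.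
Unset Strict Implicit.
Unset Printing Implicit Defensive.

Import Order.TTheory GRing.Theory Num.Theory.

Local Open Scope classical_set_scope.
Local Open Scope ring_scope.

(* Classical (pre)varieties over a field are treated as spaces with functions:
   a topological space with a sheaf of k-valued functions whose nonvanishing
   sections are locally invertible.  Only the values of [f] on [U] matter in
   [reg U f] (see [reg_ext]), and [reg U] is only meaningful for open [U]. *)

Record fspace (k : fieldType) := FSpace {
  fs_pt :> topologicalType;
  reg : set fs_pt -> (fs_pt -> k) -> Prop;
  reg_ext : forall U f g, reg U f -> (forall x, U x -> f x = g x) -> reg U g;
  reg_restr : forall U V f, open U -> open V -> V `<=` U -> reg U f -> reg V f;
  reg_local : forall U f, open U ->
    (forall x, U x -> exists V, [/\ open V, V x, V `<=` U & reg V f]) ->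
    reg U f;
  reg_cst : forall U a, open U -> reg U (fun=> a);
  reg_add : forall U f g, open U -> reg U f -> reg U g ->
    reg U (fun x => f x + g x);
  reg_mul : forall U f g, open U -> reg U f -> reg U g ->
    reg U (fun x => f x * g x);
  reg_open : forall U f, open U -> reg U f -> open [set x | U x /\ f x != 0];
  reg_inv : forall U f, open U -> reg U f -> (forall x, U x -> f x != 0) ->
    reg U (fun x => (f x)^-1)
}.

Section SpacesWithFunctions.
Variable k : fieldType.
Implicit Types W X Y : fspace k.

Definition fmorphism X Y (f : X -> Y) : Prop :=
  continuous f /\
  forall U s, open U -> reg U s -> reg (f @^-1` U) (fun x => s (f x)).

(* The local ring at [x] is a regular local ring with a system of [d]
   parameters: its maximal ideal is generated by [d] germs.  This is
   smoothness of X at [x] when X has dimension [d]. *)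
Definition smooth_at (d : nat) X (x : X) : Prop :=
  exists (U : set X) (u : 'I_d -> X -> k),
    [/\ open U, U x, forall i, reg U (u i), forall i, u i x = 0 &
      forall (W : set X) (g : X -> k), open W -> W x -> reg W g -> g x = 0 ->
        exists (W' : set X) (a : 'I_d -> X -> k),
          [/\ open W', W' x, W' `<=` U `&` W, forall i, reg W' (a i) &
            forall y, W' y -> g y = \sum_(i < d) a i y * u i y]].

Definition smooth (d : nat) X : Prop := forall x : X, smooth_at d x.

Definition vanishing X (Z U : set X) (s : X -> k) : Prop :=
  reg U s /\ forall x, U x -> Z x -> s x = 0.

(* The germ of [g] at [w] belongs to the ideal generated in the local ring of
   W at [w] by the pullback along [f] of the ideal sheaf of Z. *)
Definition in_inverse_image_ideal W X (f : W -> X) (Z : set X) (w : W)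
    (g : W -> k) : Prop :=
  exists (V : set W) (U : set X) (r : nat)
         (a : 'I_r -> W -> k) (s : 'I_r -> X -> k),
    [/\ [/\ open V, V w, open U & V `<=` f @^-1` U],
        forall i, reg V (a i), forall i, vanishing Z U (s i) &
        forall v, V v -> g v = \sum_(i < r) a i v * s i (f v)].

Definition in_principal_ideal W (h : W -> k) (w : W) (g : W -> k) : Prop :=
  exists (V : set W) (a : W -> k),
    [/\ open V, V w, reg V a & forall v, V v -> g v = a v * h v].

Definition nonzerodivisor W (V : set W) (h : W -> k) : Prop :=
  forall V' a, open V' -> V' `<=` V -> reg V' a ->
    (forall v, V' v -> a v * h v = 0) -> forall v, V' v -> a v = 0.

(* The inverse image ideal sheaf of Z under [f] is invertible, i.e. the
   inverse image of Z is an effective Cartier divisor. *)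
Definition inverse_image_invertible W X (f : W -> X) (Z : set X) : Prop :=
  forall w : W, exists (V : set W) (h : W -> k),
    [/\ open V, V w, reg V h, nonzerodivisor V h &
      forall v, V v -> forall V' g, open V' -> V' v -> reg V' g ->
        (in_inverse_image_ideal f Z v g <-> in_principal_ideal h v g)].

(* Blowup of Z (with its reduced structure), by its universal property. *)
Definition is_blowup X' X (p : X' -> X) (Z : set X) : Prop :=
  [/\ fmorphism p, inverse_image_invertible p Z &
    forall W (f : W -> X), fmorphism f -> inverse_image_invertible f Z ->
      exists! g : W -> X', fmorphism g /\ (forall w, p (g w) = f w)].

End SpacesWithFunctions.

(* Gluing of affine charts: a chart [dom i] has as coordinate ring the algebra
   of functions generated by [gen i].  A set is open when its trace on each
   chart is Zariski open, and a function is regular when on each chart it is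
   locally a fraction of elements of the coordinate ring. *)

Record atlas (k : fieldType) := Atlas {
  at_pt : Type;
  at_idx : Type;
  dom : at_idx -> set at_pt;
  gen : at_idx -> set (at_pt -> k)
}.

Section Gluing.
Variables (k : fieldType) (A : atlas k).

Inductive coord_ring (i : at_idx A) : (at_pt A -> k) -> Prop :=
| cr_gen f : gen i f -> coord_ring i f
| cr_cst a : coord_ring i (fun=> a)
| cr_add f g : coord_ring i f -> coord_ring i g ->
    coord_ring i (fun x => f x + g x)
| cr_mul f g : coord_ring i f -> coord_ring i g ->
    coord_ring i (fun x => f x * g x).

Definition glued : Type := at_pt A.

Definition glued_open (U : set glued) : Prop :=
  forall i x, dom i x -> U x -> exists f, [/\ coord_ring i f, f x != 0 &
    forall y, dom i y -> f y != 0 -> U y].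

Definition glued_reg (U : set glued) (h : glued -> k) : Prop :=
  forall i x, dom i x -> U x -> exists f g,
    [/\ coord_ring i f, coord_ring i g, g x != 0 &
      forall y, dom i y -> U y -> g y != 0 -> h y = f y / g y].

Lemma glued_openT : glued_open setT.
Proof.
by move=> i x _ _; exists (fun=> 1); split; [exact: cr_cst|exact: oner_neq0|].
Qed.

Lemma glued_openI : setI_closed glued_open.
Proof.
move=> U V oU oV i x dx [Ux Vx].
have [f [cf fx fU]] := oU i x dx Ux; have [g [cg gx gV]] := oV i x dx Vx.
exists (fun y => f y * g y); split; [exact: cr_mul|exact: mulf_neq0|].
by move=> y dy; rewrite mulf_eq0 negb_or => /andP[fy gy];
  split; [exact: fU|exact: gV].
Qed.

Lemma glued_open_bigU (I : Type) (F : I -> set glued) :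
  (forall i, glued_open (F i)) -> glued_open (\bigcup_i F i).
Proof.
move=> oF i x dx [j _ Fjx]; have [f [cf fx fF]] := oF j i x dx Fjx.
by exists f; split=> // y dy fy; exists j => //; exact: fF.
Qed.

HB.instance Definition _ := gen_eqMixin glued.
HB.instance Definition _ := gen_choiceMixin glued.
HB.instance Definition _ :=
  isOpenTopological.Build glued glued_openT glued_openI glued_open_bigU.

Lemma glued_openE (U : set glued) : open U = glued_open U.
Proof. by []. Qed.

Lemma glued_reg_ext (U : set glued) f g : glued_reg U f ->
  (forall x, U x -> f x = g x) -> glued_reg U g.
Proof.
move=> rf fg i x dx Ux; have [a [b [ca cb bx abE]]] := rf i x dx Ux.
by exists a, b; split=> // y dy Uy byN0; rewrite -fg // abE.
Qed.

Lemma glued_reg_restr (U V : set glued) f : open U -> open V ->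
  V `<=` U -> glued_reg U f -> glued_reg V f.
Proof.
move=> _ _ VU rf i x dx Vx; have [a [b [ca cb bx abE]]] := rf i x dx (VU _ Vx).
by exists a, b; split=> // y dy Vy; apply: abE => //; exact: VU.
Qed.

Lemma glued_reg_local (U : set glued) f : open U ->
  (forall x, U x -> exists V, [/\ open V, V x, V `<=` U & glued_reg V f]) ->
  glued_reg U f.
Proof.
move=> _ H i x dx Ux; have [V [oV Vx VU rf]] := H x Ux.
have [a [b [ca cb bx abE]]] := rf i x dx Vx.
rewrite glued_openE in oV; have [c [cc cx cV]] := oV i x dx Vx.
exists (fun y => a y * c y), (fun y => b y * c y).
split; [exact: cr_mul|exact: cr_mul|exact: mulf_neq0|].
move=> y dy Uy; rewrite mulf_eq0 negb_or => /andP[byN0 cy].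
by rewrite abE //; [rewrite -mulf_div divff // mulr1|exact: cV].
Qed.

Lemma glued_reg_cst (U : set glued) a : open U -> glued_reg U (fun=> a).
Proof.
move=> _ i x _ _; exists (fun=> a), (fun=> 1).
split; [exact: cr_cst|exact: cr_cst|exact: oner_neq0|].
by move=> y _ _ _; rewrite divr1.
Qed.

Lemma glued_reg_add (U : set glued) f g : open U ->
  glued_reg U f -> glued_reg U g -> glued_reg U (fun x => f x + g x).
Proof.
move=> _ rf rg i x dx Ux; have [a [b [ca cb bx abE]]] := rf i x dx Ux.
have [c [d [cc cd dx' cdE]]] := rg i x dx Ux.
exists (fun y => a y * d y + c y * b y), (fun y => b y * d y).
split; [by apply: cr_add; apply: cr_mul|exact: cr_mul|exact: mulf_neq0|].
move=> y dy Uy; rewrite mulf_eq0 negb_or => /andP[bN0 dN0].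
by rewrite abE // cdE // addf_div.
Qed.

Lemma glued_reg_mul (U : set glued) f g : open U ->
  glued_reg U f -> glued_reg U g -> glued_reg U (fun x => f x * g x).
Proof.
move=> _ rf rg i x dx Ux; have [a [b [ca cb bx abE]]] := rf i x dx Ux.
have [c [d [cc cd dx' cdE]]] := rg i x dx Ux.
exists (fun y => a y * c y), (fun y => b y * d y).
split; [exact: cr_mul|exact: cr_mul|exact: mulf_neq0|].
move=> y dy Uy; rewrite mulf_eq0 negb_or => /andP[bN0 dN0].
by rewrite abE // cdE // mulf_div.
Qed.

Lemma glued_reg_open (U : set glued) f : open U ->
  glued_reg U f -> open [set x | U x /\ f x != 0].
Proof.
rewrite !glued_openE => oU rf i x dx [Ux fx].
have [a [b [ca cb bx abE]]] := rf i x dx Ux.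
have [c [cc cx cU]] := oU i x dx Ux.
exists (fun y => a y * b y * c y); split; first by do 2?apply: cr_mul.
  rewrite !mulf_neq0 //; apply: contra_neq fx => a0.
  by rewrite abE // a0 mul0r.
move=> y dy; rewrite !mulf_eq0 !negb_or => /andP[/andP[aN0 bN0] cN0].
have Uy := cU y dy cN0; split=> //.
by rewrite abE // mulf_neq0 // invr_neq0.
Qed.

Lemma glued_reg_inv (U : set glued) f : open U -> glued_reg U f ->
  (forall x, U x -> f x != 0) -> glued_reg U (fun x => (f x)^-1).
Proof.
move=> _ rf fN0 i x dx Ux; have [a [b [ca cb bx abE]]] := rf i x dx Ux.
have ax : a x != 0.
  by apply: contra_neq (fN0 x Ux) => a0; rewrite abE // a0 mul0r.
exists (fun y => b y * b y), (fun y => a y * b y).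
split; [exact: cr_mul|exact: cr_mul|exact: mulf_neq0|].
move=> y dy Uy; rewrite mulf_eq0 negb_or => /andP[aN0 bN0].
by rewrite abE // invf_div -mulf_div divff // mulr1.
Qed.

Definition glued_space : fspace k :=
  FSpace glued_reg_ext glued_reg_restr glued_reg_local glued_reg_cst
    glued_reg_add glued_reg_mul glued_reg_open glued_reg_inv.

Lemma glued_morphism (f : glued_space -> glued_space) :
  (forall i x, dom i x -> dom i (f x)) ->
  (forall i g, gen i g -> coord_ring i (g \o f)) -> fmorphism f.
Proof.
move=> fdom fgen.
have fcr i g : coord_ring i g -> coord_ring i (g \o f).
  elim=> [h /fgen//|a|g1 g2 _ h1 _ h2|g1 g2 _ h1 _ h2].
  - exact: cr_cst.
  - exact: (cr_add h1 h2).
  - exact: (cr_mul h1 h2).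
split.
  apply/continuousP => U; rewrite /= !glued_openE => oU i x dx Ux.
  have [g [cg gx gU]] := oU i (f x) (fdom _ _ dx) Ux.
  exists (g \o f); split=> //; first exact: fcr.
  by move=> y dy gy; apply: gU => //; exact: fdom.
move=> U s oU rs i x dx Ux.
have [a [b [ca cb bx abE]]] := rs i (f x) (fdom _ _ dx) Ux.
exists (a \o f), (b \o f); split=> //; [exact: fcr|exact: fcr|].
by move=> y dy Uy bN0; apply: abE => //; exact: fdom.
Qed.

End Gluing.

(* The torus T = (k^* )^n; its character lattice is Z^n = 'rV[int]_n. *)

Section Torus.
Variables (k : fieldType) (n : nat).

Record torus := Torus {
  tcoord :> 'I_n -> k;
  tcoord_neq0 : forall i, tcoord i != 0
}.

Definition tone : torus := Torus (fun=> oner_neq0 k).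

Definition tmul (s t : torus) : torus :=
  Torus (fun i => mulf_neq0 (tcoord_neq0 s i) (tcoord_neq0 t i)).

Definition tchar (chi : 'rV[int]_n) (t : torus) : k :=
  \prod_(i < n) t i ^ chi 0 i.

Lemma tchar1 chi : tchar chi tone = 1.
Proof. by rewrite /tchar big1 // => i _; rewrite exp1rz. Qed.

Lemma tcharM chi s t : tchar chi (tmul s t) = tchar chi s * tchar chi t.
Proof. by rewrite /tchar -big_split; apply: eq_bigr => i _; rewrite /= expfzMl. Qed.

Lemma tchar_neq0 chi t : tchar chi t != 0.
Proof. by apply/prodf_neq0 => i _; rewrite expfz_neq0 ?tcoord_neq0. Qed.

Lemma tchar0 t : tchar 0 t = 1.
Proof. by rewrite /tchar big1 // => i _; rewrite mxE expr0z. Qed.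

Lemma tcharD chi psi t : tchar (chi + psi) t = tchar chi t * tchar psi t.
Proof.
rewrite /tchar -big_split; apply: eq_bigr => i _ /=.
by rewrite mxE expfzDr ?tcoord_neq0.
Qed.

Definition torus_atlas : atlas k :=
  {| at_pt := torus; at_idx := unit;
     dom := fun _ => setT; gen := fun _ => range tchar |}.

Definition torus_space : fspace k := glued_space torus_atlas.

Record tspace := TSpace {
  ts_space :> fspace k;
  act : torus -> ts_space -> ts_space;
  act1 : forall x, act tone x = x;
  actM : forall s t x, act (tmul s t) x = act s (act t x);
  act_morphism : forall t, fmorphism (act t)
}.

Definition equivariant (X Y : tspace) (f : X -> Y) : Prop :=
  forall t x, f (act t x) = act t (f x).

Definition tspace_iso (X Y : tspace) : Prop :=
  exists (f : X -> Y) (g : Y -> X),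
    [/\ fmorphism f, fmorphism g, cancel f g, cancel g f & equivariant f].

Definition torbit (X : tspace) (x : X) : set X := range (fun t => act t x).

Definition stabilizer (X : tspace) (x : X) : set torus :=
  [set t | act t x = x].

(* Characters of T trivial on the stabilizer, i.e. the character lattice of
   the torus T / Stab(x), to which the orbit of x is isomorphic. *)
Definition orbit_lattice (X : tspace) (x : X) : set 'rV[int]_n :=
  [set chi | forall t, stabilizer x t -> tchar chi t = 1].

End Torus.

Arguments tone {k n}.

(* (P^1)^n with P^1 = k + {oo}, [None] being oo.  On the chart indexed by S
   the i-th coordinate is 1/z_i if i is in S, and z_i otherwise.  T acts
   through the identification with (k^* )^n given by the characters which are
   the rows of B. *)

Section P1n.
Variables (k : fieldType) (n : nat) (B : 'M[int]_n).

Definition p1_coord (b : bool) (p : option k) : k :=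
  if p is Some a then (if b then a^-1 else a) else 0.

Definition p1n_atlas : atlas k :=
  {| at_pt := 'I_n -> option k; at_idx := {set 'I_n};
     dom := fun S => [set z | forall i,
              if i \in S then z i <> Some 0 else z i <> None];
     gen := fun S =>
              range (fun i (z : 'I_n -> option k) => p1_coord (i \in S) (z i)) |}.

Definition p1n_act (t : torus k n) (z : glued_space p1n_atlas) :
    glued_space p1n_atlas :=
  fun i => omap ( *%R (tchar (row i B) t)) (z i).

Lemma p1n_act1 z : p1n_act tone z = z.
Proof.
by apply/funext => i; rewrite /p1n_act tchar1; case: (z i) => //= a; rewrite mul1r.
Qed.

Lemma p1n_actM s t z : p1n_act (tmul s t) z = p1n_act s (p1n_act t z).
Proof.
by apply/funext => i; rewrite /p1n_act tcharM; case: (z i) => //= a; rewrite mulrA.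
Qed.

Lemma p1n_act_morphism t : fmorphism (p1n_act t).
Proof.
apply: glued_morphism => [S z dz i|S g [i _ <-]].
  have := dz i; rewrite /p1n_act; case: (i \in S); case: (z i) => //= a a0 [].
  by move/eqP; rewrite mulf_eq0 (negPf (tchar_neq0 _ _)) /= => /eqP a0'; apply: a0; rewrite a0'.
pose c := p1_coord (i \in S) (Some (tchar (row i B) t)).
suff -> : (fun z => p1_coord (i \in S) (z i)) \o p1n_act t =
          fun z => c * p1_coord (i \in S) (z i).
  by apply: cr_mul; [exact: cr_cst|apply: cr_gen; exists i].
apply/funext => z; rewrite /= /p1n_act /c.
by case: (z i) => [a|] /=; rewrite ?mulr0 //; case: ifP => //; rewrite invfM.
Qed.

Definition P1n : tspace k n := TSpace p1n_act1 p1n_actM p1n_act_morphism.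

End P1n.

Section Toric.
Variables (R : realType) (n : nat).

Local Notation C := R[i].
Local Notation M := 'rV[int]_n.  (* X^*(T) *)
Local Notation V := 'rV[R]_n.    (* X_*(T) (x) R, and also its dual *)

Definition real_of (chi : M) : V := map_mx intr chi.

Definition pairing (u v : V) : R := \sum_(i < n) u 0 i * v 0 i.

Definition cone (h : nat) (e : 'I_h -> V) : set V :=
  [set v | exists2 a : 'I_h -> R,
     (forall j, 0 <= a j) & v = \sum_(j < h) a j *: e j].

Definition rational_polyhedral (s : set V) : Prop :=
  exists (h : nat) (e : 'I_h -> M), s = cone (fun j => real_of (e j)).

Definition strongly_convex (s : set V) : Prop :=
  forall v, s v -> s (- v) -> v = 0.

Definition face (f s : set V) : Prop :=
  exists2 u : V, (forall v, s v -> 0 <= pairing u v) &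
    f = [set v | s v /\ pairing u v = 0].

Definition is_fan (D : set (set V)) : Prop :=
  [/\ finite_set D, D !=set0,
      forall s, D s -> rational_polyhedral s /\ strongly_convex s,
      forall s f, D s -> face f s -> D f &
      forall s s', D s -> D s' -> face (s `&` s') s /\ face (s `&` s') s'].

Definition dual_monoid (s : set V) : set M :=
  [set chi | forall v, s v -> 0 <= pairing (real_of chi) v].

Definition orthogonal_lattice (s : set V) : set M :=
  [set chi | forall v, s v -> pairing (real_of chi) v = 0].

(* Points of the toric variety of D.  The affine toric variety U_s of a cone s is the set of
   monoid homomorphisms from [dual_monoid s] to (C, * ), and each point
   of the glued variety is recorded in its smallest chart [kcone], that is, the one for which the
   homomorphism is nonzero exactly on the characters orthogonal to the cone
   (so that the points with a given [kcone] form one T-orbit).  The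
   homomorphism is extended by 0 outside of the dual monoid; the restriction
   to a larger chart U_t then is the restriction to [dual_monoid t]. *)
Record kpoint (D : set (set V)) := KPoint {
  kcone : set V;
  kval : M -> C;
  kcone_in : D kcone;
  kval0 : kval 0 = 1;
  kvalD : forall chi psi, dual_monoid kcone chi -> dual_monoid kcone psi ->
    kval (chi + psi) = kval chi * kval psi;
  kval_neq0 : forall chi, kval chi != 0 <-> orthogonal_lattice kcone chi
}.

Lemma kpoint_eq D (p q : kpoint D) :
  kcone p = kcone q -> kval p = kval q -> p = q.
Proof.
case: p q => [s f ? ? ? ?] [s' f' ? ? ? ?] /= ss ff; subst s' f'.
by congr KPoint; exact: Prop_irrelevance.
Qed.

(* In a fan, the faces of a cone t are the cones of the fan contained in t,
   so that the chart U_t consists of the points with [kcone] inside t. *)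
Definition toric_atlas (D : set (set V)) : atlas C :=
  {| at_pt := kpoint D; at_idx := {t : set V | D t};
     dom := fun t => [set p | kcone p `<=` sval t];
     gen := fun t => (fun chi (p : kpoint D) => kval p chi)
                       @` dual_monoid (sval t) |}.

Section Action.
Variables (D : set (set V)) (t : torus C n) (p : kpoint D).

Definition kact_val (chi : M) : C := tchar chi t * kval p chi.

Lemma kact_val0 : kact_val 0 = 1.
Proof. by rewrite /kact_val tchar0 kval0 mulr1. Qed.

Lemma kact_valD chi psi :
  dual_monoid (kcone p) chi -> dual_monoid (kcone p) psi ->
  kact_val (chi + psi) = kact_val chi * kact_val psi.
Proof. by move=> h h'; rewrite /kact_val tcharD kvalD // mulrACA. Qed.

Lemma kact_val_neq0 chi :
  kact_val chi != 0 <-> orthogonal_lattice (kcone p) chi.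
Proof. by rewrite -kval_neq0 /kact_val mulf_eq0 (negPf (tchar_neq0 _ _)). Qed.

Definition kact : glued_space (toric_atlas D) :=
  KPoint (kcone_in p) kact_val0 kact_valD kact_val_neq0.

End Action.

Lemma kact1 D (p : glued_space (toric_atlas D)) : kact tone p = p.
Proof.
apply: kpoint_eq => //; apply/funext => chi /=.
by rewrite /kact_val tchar1 mul1r.
Qed.

Lemma kactM D s t (p : glued_space (toric_atlas D)) :
  kact (tmul s t) p = kact s (kact t p).
Proof.
apply: kpoint_eq => //; apply/funext => chi /=.
by rewrite /kact_val /= /kact_val tcharM mulrA.
Qed.

Lemma kact_morphism D t :
  fmorphism (kact t : glued_space (toric_atlas D) -> glued_space (toric_atlas D)).
Proof.
apply: glued_morphism => [//|s g [chi chis <-]].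
suff -> : (fun p : kpoint D => kval p chi) \o kact t =
          fun p => tchar chi t * kval p chi by apply: cr_mul;
  [exact: cr_cst|apply: cr_gen; exists chi].
by apply/funext.
Qed.

Definition toric_variety (D : set (set V)) : tspace C n :=
  TSpace (@kact1 D) (@kactM D) (@kact_morphism D).

(* The real span of a set of characters; for a subgroup G this is the image
   of G (x) R in V^*. *)
Definition real_span (G : set M) : set V :=
  [set v | exists2 s : seq (R * M), (forall q, q \in s -> G q.2) &
     v = \sum_(q <- s) q.1 *: real_of q.2].

Definition is_basis (U : set V) (r : nat) (u : r.-tuple V) : Prop :=
  free u /\ U = [set v | v \in <<u>>%VS].

(* T-embeddings have dimension n, so that codimension c means that the
   lattice of the orbit has rank n - c. *)
Definition orbit_codim (X : tspace C n) (x : X) (c : nat) : Prop :=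
  exists (r : nat) (u : r.-tuple V),
    is_basis (real_span (orbit_lattice x)) u /\ (r + c = n)%N.

(* X is obtained from Y by a sequence of blowups along closures of T-orbits of
   codimension 2.  Requiring the blowup maps to be equivariant fixes the
   T-action on each blowup, by the universal property. *)
Inductive orbit_blowups (Y : tspace C n) : tspace C n -> Prop :=
| orbit_blowups_nil X : tspace_iso X Y -> orbit_blowups Y X
| orbit_blowups_step (X X' : tspace C n) (p : X' -> X) (x : X) :
    orbit_blowups Y X -> orbit_codim x 2 -> equivariant p ->
    is_blowup p (closure (torbit x)) -> orbit_blowups Y X'.

Definition subgroup (G : set M) : Prop :=
  G 0 /\ forall chi psi, G chi -> G psi -> G (chi - psi).

Definition split_summand (G : set M) : Prop :=
  subgroup G /\ exists G' : set M,
    [/\ subgroup G',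
        forall chi, exists a b, [/\ G a, G' b & chi = a + b] &
        forall chi, G chi -> G' chi -> chi = 0].

(* Only the restriction of [lphi] to [lgroup] matters. *)
Record layer := Layer {
  lgroup : set M;
  lphi : M -> C;
  lgroup_split : split_summand lgroup;
  lphi_neq0 : forall chi, lgroup chi -> lphi chi != 0;
  lphiD : forall chi psi, lgroup chi -> lgroup psi ->
    lphi (chi + psi) = lphi chi * lphi psi
}.

Definition layer_set (K : layer) : set (torus_space C n) :=
  [set t | forall chi, lgroup K chi -> tchar chi t = lphi K chi].

Definition arrangement_layer (m : nat) (A : 'I_m -> layer)
    (L : set (torus_space C n)) : Prop :=
  exists (I : set 'I_m) (t : torus_space C n),
    let Z := \bigcap_(i in I) layer_set (A i) in
    Z t /\ L = connected_component Z t.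

Definition propertyE (U : set V) (h : nat) (e : 'I_h -> V) : Prop :=
  exists (r : nat) (u : r.-tuple V), is_basis U u /\
    forall i j, 0 <= pairing (tnth u i) (e j).

Definition layer_propertyE (L : set (torus_space C n)) (D : set (set V)) :
    Prop :=
  exists2 K : layer, L = layer_set K &
    forall s, D s -> exists (h : nat) (e : h.-tuple V),
      [/\ free e, s = cone (tnth e) &
          propertyE (real_span (lgroup K)) (tnth e)].

End Toric.

(* Main.v *)
(* Start from the fan of (P^1)^n and let chi be a character.  Call a 2-dimensional
   cone spanned by rays rho, sigma bad when chi(rho) > 0 > chi(sigma), of size
   chi(rho) - chi(sigma).  Subdividing a bad cone of maximal size by the ray
   rho + sigma removes it and creates only bad cones of strictly smaller size, so
   finitely many such subdivisions make chi of constant sign on every cone, and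
   this persists under further subdivision.  Doing this for all members of an
   integral basis of the lattice of every A-layer gives property (E): on each cone
   change the signs of the basis vectors.

   Geometrically, subdividing along rho, sigma is the blowup of the orbit closure
   Z given by x_i = x_j = 0 in each chart C^n containing both rays.  If f : W -> X
   makes the ideal of Z principal, with generator h, then x_i o f = a1 h,
   x_j o f = a2 h and b1 a1 + b2 a2 = 1, so locally x_j/x_i or x_i/x_j is regular
   on W and f lifts to the corresponding chart of the subdivision; lifts are
   unique because h is a nonzerodivisor.

   An A-layer through t is the coset through t of a subtorus: the functions
   q^m - q(t)^m vanish on the intersection of the layers, and the first factor of
   (q - q(t)) (q^(m-1) + ... + q(t)^(m-1)) cuts out a clopen subset; it is
   connected because any two of its points lie on an open subset of a line. *)

From HB Require Import structures.
Require Import Defs.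
From mathcomp Require Import all_boot all_order all_algebra.
From mathcomp Require Import complex.
From mathcomp Require Import all_classical all_reals all_analysis.
From mathcomp Require Import ring zify.

Set Implicit Arguments.
Unset Strict Implicit.
Unset Printing Implicit Defensive.

Import Order.TTheory GRing.Theory Num.Theory.

Local Open Scope classical_set_scope.
Local Open Scope ring_scope.

(** * Morphisms of spaces with functions *)

Section FSpaces.
Variable k : fieldType.
Implicit Types W X Y : fspace k.

(** A fan is handled as a list [S] of unimodular integer matrices, the rows of each spanning a
    maximal cone, so that every cone is a face [fcone E J]. Intersections are governed by one
    condition, [compat]: a vector lying in two maximal cones has the same coefficient on every ray
    in both expansions. It passes to a subdivision because the new coefficients are a function of
    the old ones, and it yields the fan axioms and the characters separating charts. On the chart of
    [E] the variety is affine n-space with the characters dual to the rows as coordinates, and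
    density statements are tested along polynomial curves, where finiteness of roots suffices. The
    source [W] of the universal property is an arbitrary space with functions, without any such
    structure, so lifts into it are built and compared only through the local generator [h]. There
    are infinitely many possible base points of an A-layer; finiteness comes from attaching the
    lattice to the set of intersected layers rather than to the component. *)

Lemma open_local W (U : set W) :
  (forall x, U x -> exists V, [/\ open V, V x & V `<=` U]) -> open U.
Proof.
move=> h; have -> : U = interior U.
  apply/seteqP; split; last exact: interior_subset.
  move=> x /h[V [oV Vx VU]]; rewrite /interior; apply: filterS VU _.
  exact: open_nbhs_nbhs.
exact: open_interior.
Qed.

Lemma reg_prod W (U : set W) (r : nat) (F : 'I_r -> W -> k) : open U ->
  (forall i, reg U (F i)) -> reg U (fun x => \prod_(i < r) F i x).
Proof.
move=> oU; elim: r F => [|r IH] F rF.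
  by apply: (reg_ext (reg_cst 1 oU)) => x _; rewrite big_ord0.
apply: (@reg_ext _ _ U (fun x => (\prod_(i < r) F (widen_ord (leqnSn r) i) x) * F
  ord_max x)).
  by apply: reg_mul => //; apply: IH.
by move=> x _; rewrite big_ord_recr.
Qed.

Lemma reg_exp W (U : set W) f m : open U -> reg U f -> reg U (fun x => f x ^+ m).
Proof.
move=> oU rf; elim: m => [|m IH].
  by apply: (reg_ext (reg_cst 1 oU)) => x _; rewrite expr0.
by apply: (reg_ext (reg_mul oU rf IH)) => x _; rewrite exprS.
Qed.

Lemma reg_sub W (U : set W) f g : open U -> reg U f -> reg U g ->
  reg U (fun x => f x - g x).
Proof.
move=> oU rf rg; apply: (reg_ext (reg_add oU rf (reg_mul oU (reg_cst (-1) oU) rg))).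
by move=> x _; rewrite mulN1r.
Qed.

Lemma reg_div W (U : set W) f g : open U -> reg U f -> reg U g ->
  (forall x, U x -> g x != 0) -> reg U (fun x => f x / g x).
Proof. by move=> oU rf rg g0; apply: reg_mul => //; apply: reg_inv. Qed.

(** A pointwise form of being a morphism, so that maps known only near a point can be checked there
    and then glued. *)
Definition mor_at W X (f : W -> X) (w : W) : Prop :=
  forall (U : set X) s, open U -> U (f w) -> reg U s ->
    exists V, [/\ open V, V w, V `<=` f @^-1` U & reg V (s \o f)].

Lemma fmorphismP W X (f : W -> X) : fmorphism f <-> forall w, mor_at f w.
Proof.
split=> [[fc fr] w U s oU Ufw rs|h].
  exists (f @^-1` U); split => //; first by have /continuousP := fc; apply.
  exact: fr.
have fc : continuous f.
  apply/continuousP => U oU; apply: (@open_local W) => w Ufw.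
  (* The zero section is regular on every open set, so applying [h] to it extracts continuity
     alone. *)
  have [V [oV Vw VU _]] := h w U _ oU Ufw (reg_cst 0 oU).
  by exists V.
split=> // U s oU rs; apply: reg_local; first by have /continuousP := fc; apply.
by move=> w Ufw; have [V [oV Vw VU rV]] := h w U s oU Ufw rs; exists V.
Qed.

Lemma mor_at_ext W X (f g : W -> X) (V : set W) w : open V -> V w ->
  (forall v, V v -> f v = g v) -> mor_at f w -> mor_at g w.
Proof.
move=> oV Vw fg mf U s oU Ugw rs; rewrite -fg // in Ugw.
have [V' [oV' V'w V'U rV']] := mf U s oU Ugw rs.
exists (V `&` V'); split; [exact: openI|by []| |].
- by move=> x [Vx V'x]; rewrite /= -fg //; exact: V'U.
- apply: (@reg_ext _ _ (V `&` V') (s \o f)); last by move=> x [Vx _] /=; rewrite fg.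
  by apply: reg_restr rV' => //; exact: openI.
Qed.

Section Target.
Variable A : atlas k.

Lemma coord_ring_reg W (f : W -> glued_space A) (V : set W) i :
  open V -> (forall g, gen i g -> reg V (g \o f)) ->
  forall g, coord_ring i g -> reg V (g \o f).
Proof.
move=> oV hg g; elim=> {g} [g|a|g1 g2 _ h1 _ h2|g1 g2 _ h1 _ h2].
- exact: hg.
- exact: reg_cst.
- exact: reg_add.
- exact: reg_mul.
Qed.

(** A single chart containing the image suffices: there a regular function is locally a fraction of
    elements of the coordinate ring, and these pull back to regular functions because the generators
    do. *)
Lemma mor_at_chart W (f : W -> glued_space A) (V : set W) i :
  open V -> V `<=` f @^-1` (dom i) -> (forall g, gen i g -> reg V (g \o f)) ->
  forall v, V v -> mor_at f v.
Proof.
move=> oV Vd hg v Vv U s oU Ufv rs.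
have cr := coord_ring_reg oV hg.
have [a [b [ca cb bx abE]]] := rs i (f v) (Vd _ Vv) Ufv.
rewrite glued_openE in oU; have [c [cc cx cU]] := oU i (f v) (Vd _ Vv) Ufv.
have rbc : reg V (fun x => b (f x) * c (f x)).
  by apply: reg_mul => //; apply: (cr _ _).
have oV' := reg_open oV rbc.
exists [set x | V x /\ b (f x) * c (f x) != 0]; split=> //.
- by split=> //; rewrite mulf_neq0.
- move=> x [Vx]; rewrite mulf_eq0 negb_or => /andP[_ cfx].
  by apply: cU => //; apply: Vd.
apply: (@reg_ext _ _ _ (fun x => a (f x) / b (f x))).
  apply: reg_div => //.
  - by apply: reg_restr (cr _ ca) => //; move=> x [].
  - by apply: reg_restr (cr _ cb) => //; move=> x [].
  - by move=> x [_]; rewrite mulf_eq0 negb_or => /andP[].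
move=> x [Vx]; rewrite mulf_eq0 negb_or => /andP[bfx cfx].
by rewrite /= abE //; [exact: Vd|apply: cU => //; exact: Vd].
Qed.

(* A common denominator [b] can be chosen whose nonvanishing locus in the
   chart lies inside [U]. *)
Lemma glued_reg_frac (U : set (glued_space A)) s i x :
  open U -> reg U s -> dom i x -> U x ->
  exists a b, [/\ coord_ring i a, coord_ring i b, b x != 0 &
    forall y, dom i y -> b y != 0 -> U y /\ s y = a y / b y].
Proof.
move=> oU rs dx Ux.
have [a [b [ca cb bx abE]]] := rs i x dx Ux.
rewrite glued_openE in oU; have [c [cc cx cU]] := oU i x dx Ux.
exists (fun y => a y * c y), (fun y => b y * c y).
split; [exact: cr_mul|exact: cr_mul|exact: mulf_neq0|].
move=> y dy; rewrite mulf_eq0 negb_or => /andP[byN0 cy].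
have Uy := cU y dy cy; split=> //.
by rewrite abE // -mulf_div divff // mulr1.
Qed.

End Target.
End FSpaces.

Section CoordRing.
Variables (k : fieldType) (A : atlas k) (i : at_idx A).
Local Notation cr := (@coord_ring k A i).

Lemma coord_ring_prod (I : Type) (r : seq I) (P : pred I) (F : I -> at_pt A -> k) :
  (forall j, cr (F j)) -> cr (fun x => \prod_(j <- r | P j) F j x).
Proof.
move=> h; elim: r => [|j r IH].
  suff -> : (fun x => \prod_(j <- [::] | P j) F j x) = (fun=> 1) by exact: cr_cst.
  by apply/funext => x; rewrite big_nil.
suff -> : (fun x => \prod_(l <- j :: r | P l) F l x) =
  (if P j then fun x => F j x * \prod_(l <- r | P l) F l x else fun x => \prod_(l <- r
    | P l) F l x).
  by case: ifP => // _; exact: cr_mul.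
by apply/funext => x; rewrite big_cons; case: ifP.
Qed.

Lemma coord_ring_sum (I : Type) (r : seq I) (F : I -> at_pt A -> k) :
  (forall j, cr (F j)) -> cr (fun x => \sum_(j <- r) F j x).
Proof.
move=> h; elim: r => [|j r IH].
  suff -> : (fun x => \sum_(j <- [::]) F j x) = (fun=> 0) by exact: cr_cst.
  by apply/funext => x; rewrite big_nil.
suff -> : (fun x => \sum_(l <- j :: r) F l x) = (fun x => F j x + \sum_(l <- r) F l x).
  exact: cr_add.
by apply/funext => x; rewrite big_cons.
Qed.

Lemma coord_ring_exp f m : cr f -> cr (fun x => f x ^+ m).
Proof.
move=> h; elim: m => [|m IH].
  by suff -> : (fun x => f x ^+ 0) = (fun=> 1); [exact: cr_cst|apply/funext].
suff -> : (fun x => f x ^+ m.+1) = (fun x => f x * f x ^+ m) by exact: cr_mul.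
by apply/funext => x; rewrite exprS.
Qed.

End CoordRing.

(** * Simplicial cones on lattice bases *)

Section Lattice.
Variable n : nat.
Local Notation M := 'rV[int]_n.
Implicit Types (E : 'M[int]_n) (chi psi e : M).

Definition ip chi e : int := \sum_(i < n) chi 0 i * e 0 i.

(* The rows of [E] are a basis of the lattice, [dualv E j] is the dual basis. *)
Definition dualv E (j : 'I_n) : M := (col j (invmx E))^T.

Lemma ipDl chi psi e : ip (chi + psi) e = ip chi e + ip psi e.
Proof. by rewrite -big_split; apply: eq_bigr => i _; rewrite mxE mulrDl. Qed.

Lemma ipDr chi e f : ip chi (e + f) = ip chi e + ip chi f.
Proof. by rewrite -big_split; apply: eq_bigr => i _; rewrite mxE mulrDr. Qed.

Lemma ipZl a chi e : ip (a *: chi) e = a * ip chi e.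
Proof. by rewrite mulr_sumr; apply: eq_bigr => i _; rewrite mxE mulrA. Qed.

Lemma ipZr a chi e : ip chi (a *: e) = a * ip chi e.
Proof. by rewrite mulr_sumr; apply: eq_bigr => i _; rewrite mxE mulrCA. Qed.

Lemma ipNl chi e : ip (- chi) e = - ip chi e.
Proof. by rewrite -scaleN1r ipZl mulN1r. Qed.

Lemma ipBl chi psi e : ip (chi - psi) e = ip chi e - ip psi e.
Proof. by rewrite ipDl ipNl. Qed.

Lemma ip0l e : ip 0 e = 0.
Proof. by rewrite /ip big1 // => i _; rewrite mxE mul0r. Qed.

Lemma ip_suml (I : finType) (P : pred I) (F : I -> M) e :
  ip (\sum_(i | P i) F i) e = \sum_(i | P i) ip (F i) e.
Proof. by elim/big_rec2: _ => [|i x y _ <-]; rewrite ?ip0l ?ipDl. Qed.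

Lemma ip_dual E i j : E \in unitmx -> ip (dualv E j) (row i E) = (i == j)%:R.
Proof.
move=> uE; have /matrixP/(_ i j) := mulmxV uE; rewrite !mxE => <-.
by apply: eq_bigr => l _; rewrite !mxE mulrC.
Qed.

Lemma chi_decomp E chi : E \in unitmx ->
  chi = \sum_j ip chi (row j E) *: dualv E j.
Proof.
move=> uE; have uT : E^T \in unitmx by rewrite unitmx_tr.
have -> : \sum_j ip chi (row j E) *: dualv E j = chi *m E^T *m (invmx E)^T.
  rewrite [RHS]mulmx_sum_row; apply: eq_bigr => j _; congr (_ *: _).
    by rewrite mxE; apply: eq_bigr => i _; rewrite !mxE.
  by rewrite /dualv tr_col.
by rewrite trmx_inv -mulmxA mulmxV // mulmx1.
Qed.

Lemma row_inj E i j : E \in unitmx -> row i E = row j E -> i = j.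
Proof.
move=> uE eij; apply/eqP; move: (ip_dual i j uE).
by rewrite eij ip_dual // eqxx; case: (i == j).
Qed.

Lemma unitmx_dual E (chi : 'I_n -> M) :
  (forall i j, ip (chi j) (row i E) = (i == j)%:R) ->
  E \in unitmx /\ forall j, dualv E j = chi j.
Proof.
move=> h; pose Q : 'M[int]_n := \matrix_(l, j) chi j 0 l.
have EQ : E *m Q = 1%:M.
  apply/matrixP => i j; rewrite mxE [RHS]mxE -[RHS]h.
  by apply: eq_bigr => l _; rewrite !mxE mulrC.
have uE : E \in unitmx by have [] := mulmx1_unit EQ.
split=> // j; apply/rowP => l; rewrite !mxE.
by rewrite -[invmx E]mulmx1 -EQ mulKmx // mxE.
Qed.

(** Ray [i] is replaced by the sum of the rays [i] and [j]. This is one of the two halves into which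
    the sum cuts the cone; the other is [subm E j i]. *)
Definition subm E (i j : 'I_n) : 'M[int]_n :=
  \matrix_(k, l) (E k l + (if k == i then E j l else 0)).

Lemma row_subm E i j k :
  row k (subm E i j) = if k == i then row i E + row j E else row k E.
Proof. by apply/rowP => l; case: eqP => [->|]; rewrite !mxE ?eqxx // => /eqP/negPf->;
  rewrite addr0. Qed.

(** In chart coordinates this is the substitution of z_j / z_i for z_j, characteristic of a
    blowup. *)
Lemma subm_dual E i j : E \in unitmx -> i != j -> subm E i j \in unitmx /\
  forall k, dualv (subm E i j) k =
    if k == j then dualv E j - dualv E i else dualv E k.
Proof.
move=> uE ij; apply: unitmx_dual => k l; rewrite row_subm.
case: (eqVneq k i) => [->|ki]; case: (eqVneq l j) => [->|lj];
  rewrite ?ipBl ?ipDr ?ip_dual // ?eqxx ?(negPf ij) ?[j == i]eq_sym ?(negPf ij) ?[j ==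
    l]eq_sym ?(negPf lj) ?(negPf ki) ?subr0 ?addr0 ?subrr //=.
Qed.
End Lattice.

Section Pairing.
Variables (R : realType) (n : nat).
Local Notation M := 'rV[int]_n.
Local Notation V := 'rV[R]_n.
Local Notation real_of := (real_of R).
Implicit Types (E : 'M[int]_n) (chi psi e : M) (u v : V) (J K : {set 'I_n}).

Lemma pairingDr u v w : pairing u (v + w) = pairing u v + pairing u w :> R.
Proof. by rewrite -big_split; apply: eq_bigr => i _; rewrite mxE mulrDr. Qed.

Lemma pairingDl u v w : pairing (u + v) w = pairing u w + pairing v w :> R.
Proof. by rewrite -big_split; apply: eq_bigr => i _; rewrite mxE mulrDl. Qed.

Lemma pairingZr a u v : pairing u (a *: v) = a * pairing u v.
Proof. by rewrite mulr_sumr; apply: eq_bigr => i _; rewrite mxE mulrCA. Qed.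

Lemma pairingZl a u v : pairing (a *: u) v = a * pairing u v.
Proof. by rewrite mulr_sumr; apply: eq_bigr => i _; rewrite mxE mulrA. Qed.

Lemma pairing0r u : pairing u 0 = 0.
Proof. by rewrite /pairing big1 // => i _; rewrite mxE mulr0. Qed.

Lemma pairing0l u : pairing 0 u = 0.
Proof. by rewrite /pairing big1 // => i _; rewrite mxE mul0r. Qed.

Lemma pairing_sumr u (I : finType) (P : pred I) (F : I -> V) :
  pairing u (\sum_(i | P i) F i) = \sum_(i | P i) pairing u (F i).
Proof. by elim/big_rec2: _ => [|i x y _ <-]; rewrite ?pairing0r ?pairingDr. Qed.

Lemma pairing_suml v (I : finType) (P : pred I) (F : I -> V) :
  pairing (\sum_(i | P i) F i) v = \sum_(i | P i) pairing (F i) v.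
Proof. by elim/big_rec2: _ => [|i x y _ <-]; rewrite ?pairing0l ?pairingDl. Qed.

Lemma pairing_real chi e : pairing (real_of chi) (real_of e) = (ip chi e)%:~R.
Proof. by rewrite /ip rmorph_sum; apply: eq_bigr => i _; rewrite !mxE rmorphM. Qed.

Lemma real_ofD chi psi : real_of (chi + psi) = real_of chi + real_of psi.
Proof. by apply/rowP => i; rewrite !mxE rmorphD. Qed.

Lemma real_ofZ a chi : real_of (a *: chi) = a%:~R *: real_of chi.
Proof. by apply/rowP => i; rewrite !mxE rmorphM. Qed.

Lemma real_of0 : real_of (0 : M) = 0.
Proof. by apply/rowP => i; rewrite !mxE. Qed.

Lemma real_ofN chi : real_of (- chi) = - real_of chi.
Proof. by apply/rowP => i; rewrite !mxE rmorphN. Qed.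

Lemma real_ofB chi psi : real_of (chi - psi) = real_of chi - real_of psi.
Proof. by rewrite real_ofD real_ofN. Qed.

Lemma real_of_sum (I : finType) (P : pred I) (F : I -> M) :
  real_of (\sum_(i | P i) F i) = \sum_(i | P i) real_of (F i).
Proof.
by elim/big_rec2: _ => [|i x y _ <-]; rewrite ?real_of0 ?real_ofD.
Qed.

Definition crd E v (j : 'I_n) : R := pairing (real_of (dualv E j)) v.

Lemma crd_row E i j : E \in unitmx ->
  crd E (real_of (row i E)) j = (i == j)%:R.
Proof. by move=> uE; rewrite /crd pairing_real ip_dual //; case: eqP. Qed.

Lemma crd_decomp E v : E \in unitmx ->
  v = \sum_j crd E v j *: real_of (row j E).
Proof.
move=> uE.
have -> : \sum_j crd E v j *: real_of (row j E)
    = v *m map_mx intr (invmx E) *m map_mx intr E.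
  rewrite [RHS]mulmx_sum_row; apply: eq_bigr => j _; congr (_ *: _).
    by rewrite mxE; apply: eq_bigr => i _; rewrite !mxE mulrC.
  by rewrite /Defs.real_of map_row.
by rewrite -mulmxA -map_mxM mulVmx // map_mx1 mulmx1.
Qed.

Lemma crd_eq E v w : E \in unitmx -> (forall j, crd E v j = crd E w j) -> v = w.
Proof.
move=> uE h; rewrite (crd_decomp v uE) (crd_decomp w uE).
by apply: eq_bigr => j _; rewrite h.
Qed.

Lemma pairing_crd E u v : E \in unitmx ->
  pairing u v = \sum_j crd E v j * pairing u (real_of (row j E)).
Proof.
move=> uE; rewrite {1}(crd_decomp v uE) pairing_sumr.
by apply: eq_bigr => j _; rewrite pairingZr.
Qed.

Lemma crdZ E a v j : crd E (a *: v) j = a * crd E v j.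
Proof. exact: pairingZr. Qed.
Lemma crd_sum E (I : finType) (P : pred I) (F : I -> V) j :
  crd E (\sum_(i | P i) F i) j = \sum_(i | P i) crd E (F i) j.
Proof. exact: pairing_sumr. Qed.

(** The cone spanned by the rows in [J], encoded by the signs of coordinates so that membership is
    decided coordinate by coordinate; [fcone_cone] recovers the generators. *)
Definition fcone E (J : {set 'I_n}) : set V :=
  [set v | forall j, 0 <= crd E v j /\ (j \notin J -> crd E v j = 0)].

Lemma fconeT E v : fcone E [set: 'I_n]%SET v <-> forall j, 0 <= crd E v j.
Proof. by split=> h j; [have [] := h j|split=> //; rewrite inE]. Qed.

Lemma fcone_sub E (J J' : {set 'I_n}) :
  J \subset J' -> fcone E J `<=` fcone E J'.
Proof.
move=> /fintype.subsetP JJ v h j; have [h1 h2] := h j; split=> // jJ.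
by apply: h2; apply: contra jJ; exact: JJ.
Qed.

Lemma fcone_row E J j : E \in unitmx -> j \in J -> fcone E J (real_of (row j E)).
Proof.
move=> uE jJ k; rewrite crd_row //; split; first by rewrite ler0n.
by case: eqP => // <-; rewrite jJ.
Qed.

Lemma fcone_comb E J (I : finType) (P : pred I) (F : I -> V) (a : I -> R) :
  (forall i, P i -> 0 <= a i) -> (forall i, P i -> a i != 0 -> fcone E J (F i)) ->
  fcone E J (\sum_(i | P i) a i *: F i).
Proof.
move=> a0 h j; rewrite crd_sum.
have h' i : P i -> 0 <= a i * crd E (F i) j /\ (j \notin J -> a i * crd E (F i) j = 0).
  move=> Pi; have [->|ai] := eqVneq (a i) 0; first by rewrite mul0r.
  have [h1 h2] := h _ Pi ai j; split; first by rewrite mulr_ge0 ?a0.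
  by move=> /h2 ->; rewrite mulr0.
split; first by apply: sumr_ge0 => i /h'[? _]; rewrite crdZ.
by move=> jJ; rewrite big1 // => i /h'[_ h2]; rewrite crdZ h2.
Qed.

Lemma fcone_subP E J E' J' : E \in unitmx ->
  (forall j, j \in J -> fcone E' J' (real_of (row j E))) -> fcone E J `<=` fcone E' J'.
Proof.
move=> uE h v vJ; rewrite (crd_decomp v uE); apply: fcone_comb => j _;
  first by have [] := vJ j.
by move=> cj; apply: h; apply: contraNT cj => /(vJ j).2 ->.
Qed.

Lemma dual_fcone E J chi : E \in unitmx ->
  dual_monoid (fcone E J) chi <-> forall j, j \in J -> 0 <= ip chi (row j E).
Proof.
move=> uE; split=> [h j jJ|h v vJ].
  by have := h _ (fcone_row uE jJ); rewrite pairing_real ler0z.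
rewrite (pairing_crd _ _ uE); apply: sumr_ge0 => j _; have [h1 h2] := vJ j.
have [jJ|/h2 ->] := boolP (j \in J); last by rewrite mul0r.
by rewrite mulr_ge0 // pairing_real ler0z h.
Qed.

Lemma orth_fcone E J chi : E \in unitmx ->
  orthogonal_lattice (fcone E J) chi <-> forall j, j \in J -> ip chi (row j E) = 0.
Proof.
move=> uE; split=> [h j jJ|h v vJ].
  by have /eqP := h _ (fcone_row uE jJ); rewrite pairing_real intr_eq0 => /eqP.
rewrite (pairing_crd _ _ uE) big1 // => j _; have [h1 h2] := vJ j.
have [jJ|/h2 ->] := boolP (j \in J); last by rewrite mul0r.
by rewrite pairing_real h // mulr0.
Qed.

(* [cf E v m] is the coefficient of the ray [m] in the expansion of [v] on the
   rows of [E]; two cones are compatible when these agree on their intersection. *)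
Definition cf E v (m : M) : R := \sum_j (row j E == m)%:R * crd E v j.

Lemma cf_row E v j : E \in unitmx -> cf E v (row j E) = crd E v j.
Proof.
move=> uE; rewrite /cf (bigD1 j) //= eqxx mul1r big1 ?addr0 // => i ij.
by case: eqP => [/(row_inj uE) eij|]; [rewrite eij eqxx in ij|rewrite mul0r].
Qed.

Lemma cf_neq0 E v m : E \in unitmx -> cf E v m != 0 ->
  exists j, row j E = m /\ crd E v j != 0.
Proof.
move=> uE; have [[j <-]|h] := pselect (exists j, row j E = m).
  by rewrite cf_row // => cj; exists j.
rewrite /cf big1 ?eqxx // => j _; case: eqP => [e|]; last by rewrite mul0r.
by case: h; exists j.
Qed.

Lemma cf_notin E v m : (forall j, row j E != m) -> cf E v m = 0.
Proof. by move=> h; rewrite /cf big1 // => j _; rewrite (negPf (h j)) mul0r. Qed.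

Definition compat E E' := forall v, fcone E [set: 'I_n]%SET v ->
  fcone E' [set: 'I_n]%SET v -> cf E v = cf E' v.

(** Unimodularity makes the charts affine spaces; compatibility makes the cones meet along common
    faces, see [fconeI]. *)
Definition valid (S : seq 'M[int]_n) :=
  (forall E, E \in S -> E \in unitmx) /\
  (forall E E', E \in S -> E' \in S -> compat E E').

Definition fan (S : seq 'M[int]_n) : set (set V) :=
  [set s | exists2 E, E \in S & exists J, s = fcone E J].

Definition common E J E' (J' : {set 'I_n}) : {set 'I_n} :=
  [set j in J | [exists j', (j' \in J') && (row j' E' == row j E)]].

(** A vector in both cones has equal coefficients in the two expansions, so only rays common to both
    can carry a nonzero one. *)
Lemma fconeI S E E' J J' : valid S -> E \in S -> E' \in S ->
  fcone E J `&` fcone E' J' = fcone E (common E J E' J').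
Proof.
move=> [uS cS] ES ES'; have uE := uS _ ES; have uE' := uS _ ES'.
apply/seteqP; split=> [v [vJ vJ'] j|].
  split; first by have [] := vJ j.
  rewrite inE negb_and => h; apply/eqP; apply: contraT => cj.
  have jJ : j \in J by apply: contraNT cj => /(vJ j).2 ->.
  rewrite jJ /= in h; case/negP: h.
  have ce := cS _ _ ES ES' v (fcone_sub (finset.subsetT _) vJ) (fcone_sub
    (finset.subsetT _) vJ').
  have : cf E' v (row j E) != 0 by rewrite -ce cf_row.
  move=> /(cf_neq0 uE')[j' [e cj']]; apply/existsP; exists j'; rewrite e eqxx andbT.
  by apply: contraNT cj' => /(vJ' j').2 ->.
rewrite subsetI; split; first by apply: fcone_sub; apply/fintype.subsetP => j;
  rewrite inE => /andP[].
apply: fcone_subP => // j; rewrite inE => /andP[_ /existsP[j' /andP[jJ' /eqP <-]]].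
exact: fcone_row.
Qed.

Lemma fan_sub S s E : valid S -> fan S s -> E \in S ->
  s `<=` fcone E [set: 'I_n]%SET -> exists J, s = fcone E J.
Proof.
move=> vS [E' ES' [J' ->]] ES h; exists (common E [set: 'I_n] E' J').
by rewrite -(fconeI _ _ vS ES ES') setIC; apply/esym/setIidPl.
Qed.

Definition sum_dualv E (J : {set 'I_n}) : M := \sum_(j in J) dualv E j.

Lemma ip_sum_dualv E J j : E \in unitmx -> ip (sum_dualv E J) (row j E) = (j \in J)%:R.
Proof.
move=> uE; rewrite ip_suml.
under eq_bigr do rewrite ip_dual //.
have [jJ|jJ] := boolP (j \in J).
  rewrite (bigD1 j) //= eqxx big1 ?addr0 // => i /andP[_ ij].
  by rewrite eq_sym (negPf ij).
by rewrite big1 // => i iJ; case: eqP => // ji; rewrite ji iJ in jJ.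
Qed.

(** The overlap of the charts of [t] and [t'] is the principal open subset of the latter where [psi]
    is nonzero, and a character regular on the chart of [t] becomes regular on that of [t'] after
    multiplication by a power of [psi]. The sum of the dual vectors of the rays not shared by the
    two cones is such a [psi]. *)
Lemma fan_sep S t t' : valid S -> fan S t -> fan S t' -> exists psi,
  [/\ dual_monoid t' psi, forall v, t' v -> (pairing (real_of psi) v = 0 <-> t v) &
     forall chi, dual_monoid t chi -> exists k : nat, dual_monoid t' (chi + psi *+ k)].
Proof.
move=> vS [E ES [J ->]] [E' ES' [J' ->]].
have [uE uE'] := (vS.1 _ ES, vS.1 _ ES').
pose K := common E' J' E J; pose psi := sum_dualv E' (~: K).
have psiE v : pairing (real_of psi) v = \sum_(j in ~: K) crd E' v j.
  rewrite (pairing_crd _ _ uE') [RHS]big_mkcond /=; apply: eq_bigr => j _.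
  by rewrite pairing_real ip_sum_dualv //; case: ifP; rewrite ?mulr1 ?mulr0.
have KI : fcone E J `&` fcone E' J' = fcone E' K by rewrite setIC (fconeI _ _ vS ES' ES).
exists psi; split.
- by apply/dual_fcone => // j _; rewrite ip_sum_dualv // ler0n.
- move=> v v'; rewrite psiE; split=> [/eqP|tv].
    rewrite psumr_eq0 => [|j _]; last by have [] := v' j.
    move=> /allP h; suff : fcone E' K v by rewrite -KI => -[].
    move=> j; split; first by have [] := v' j.
    by move=> jK; have := h j (mem_index_enum _); rewrite inE jK => /eqP.
  have : fcone E' K v by rewrite -KI.
  by move=> vK; rewrite big1 // => j; rewrite inE => /(vK j).2.
(* On shared rays [chi] is already nonnegative; on the others [psi] is 1, and this [k] outweighs any
   negative value of [chi]. *)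
- move=> chi chiJ; pose k := (\sum_j `|ip chi (row j E')|)%N; exists k.
  apply/dual_fcone => // j jJ'; rewrite -scaler_nat ipDl ipZl ip_sum_dualv // inE.
  have [jK|jK] := boolP (j \in K).
    rewrite mulr0 addr0.
    have : fcone E' K (real_of (row j E')) by apply: fcone_row.
    by rewrite -KI => -[/chiJ + _]; rewrite pairing_real ler0z.
  rewrite mulr1 -lerBlDl sub0r.
  apply: (@le_trans _ _ `|ip chi (row j E')|%N%:Z);
    first by rewrite abszE -normrN ler_norm.
  rewrite natz lez_nat /k (bigD1 j) //= leq_addr //.
Qed.

End Pairing.

(** * Charts of toric varieties *)

Section Charts.
Variables (R : realType) (n : nat).
Local Notation C := R[i].
Local Notation M := 'rV[int]_n.
Local Notation V := 'rV[R]_n.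
Local Notation real_of := (real_of R).
Implicit Types (E : 'M[int]_n) (chi psi e : M) (u v : V) (J K : {set 'I_n}).

Definition top E : set V := fcone E [set: 'I_n]%SET.

Definition mon E (z : 'I_n -> C) chi : C := \prod_j z j ^ ip chi (row j E).

Section KVal.
Variables (D : set (set V)) (p : kpoint D).
Local Notation O := (orthogonal_lattice (kcone p)).

Lemma orth_dual chi : O chi -> dual_monoid (kcone p) chi.
Proof. by move=> h v /h ->. Qed.

Lemma orth0 : O 0.
Proof. by move=> v _; rewrite real_of0 pairing0l. Qed.

Lemma orthD chi psi : O chi -> O psi -> O (chi + psi).
Proof. by move=> h h' v pv; rewrite real_ofD pairingDl h // h' // addr0. Qed.

Lemma orthN chi : O chi -> O (- chi).
Proof. by move=> h v pv; rewrite real_ofN -scaleN1r pairingZl h // mulr0. Qed.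

Lemma orthZ (a : int) chi : O chi -> O (a *: chi).
Proof. by move=> h v pv; rewrite real_ofZ pairingZl h // mulr0. Qed.

Lemma kval_orthN chi : O chi -> kval p (- chi) = (kval p chi)^-1.
Proof.
move=> h; have k0 : kval p chi != 0 by apply/kval_neq0.
apply: (mulfI k0); rewrite divff // -kvalD ?subrr ?kval0 //; apply: orth_dual => //.
exact: orthN.
Qed.

Lemma kvalX chi m : dual_monoid (kcone p) chi ->
  dual_monoid (kcone p) (chi *+ m) /\ kval p (chi *+ m) = kval p chi ^+ m.
Proof.
move=> h; elim: m => [|m [IH1 IH2]]; first by rewrite mulr0n kval0; split=> //;
  apply/orth_dual/orth0.
rewrite mulrS exprS -IH2 kvalD //; split=> // v pv.
by rewrite real_ofD pairingDl addr_ge0 // ?h ?IH1.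
Qed.

Lemma kval_orthZ (a : int) chi : O chi -> kval p (a *: chi) = kval p chi ^ a.
Proof.
have nZ m : m%:Z *: chi = chi *+ m by rewrite -natz scaler_nat.
move=> h; case: a => m; first by rewrite nZ (kvalX _ (orth_dual h)).2.
rewrite NegzE scaleNr nZ kval_orthN ?(kvalX _ (orth_dual h)).2 //.
by rewrite -nZ; exact: orthZ.
Qed.

End KVal.

Section Fan.
Variable S : seq 'M[int]_n.
Hypothesis vS : valid R S.
Local Notation D := (@fan R n S).
Local Notation X := (toric_variety D).
Implicit Types p q : kpoint D.

Lemma fan_top E : E \in S -> D (top E).
Proof. by move=> ES; exists E => //; exists [set: 'I_n]%SET. Qed.

Lemma fan_fcone E J : E \in S -> D (fcone E J).
Proof. by move=> ES; exists E => //; exists J. Qed.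

Lemma kcone_in_top p : exists2 E, E \in S & kcone p `<=` top E.
Proof.
by have [E ES [J ->]] := kcone_in p; exists E => //; apply: fcone_sub;
  exact: finset.subsetT.
Qed.

(** The vector [dualv E j] is orthogonal to the face on [J] exactly when [j] is outside [J], so the
    vanishing coordinates of a point recover its cone. *)
Lemma kcone_chart p E : E \in S -> kcone p `<=` top E ->
  kcone p = fcone E [set j | kval p (dualv E j) == 0].
Proof.
move=> ES pE; have uE := vS.1 _ ES.
have [J eJ] := fan_sub vS (kcone_in p) ES pE.
rewrite eJ; congr fcone; apply/setP => j; rewrite inE.
apply/idP/eqP => [jJ|k0].
  apply/eqP; apply: contraT => /kval_neq0; rewrite eJ => /orth_fcone - /(_ uE j jJ).
  by rewrite ip_dual // eqxx => /eqP; rewrite oner_eq0.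
apply: contraT => jJ; move/eqP: k0; apply: contraLR => _; apply/kval_neq0.
rewrite eJ; apply/orth_fcone => // i iJ; rewrite ip_dual //.
by case: eqP => // ij; rewrite -ij iJ in jJ.
Qed.

(* No sign condition on the exponents is needed: [0 ^ m = 0] for every integer
   [m != 0], in accordance with [kval] being 0 outside of the dual monoid. *)
Lemma kval_mon p E chi : E \in S -> kcone p `<=` top E ->
  kval p chi = mon E (fun j => kval p (dualv E j)) chi.
Proof.
move=> ES pE; have uE := vS.1 _ ES; have eJ := kcone_chart ES pE.
set J := finset _ in eJ.
have [h0|nO] := pselect (orthogonal_lattice (kcone p) chi).
  rewrite {1}(chi_decomp chi uE) /mon.
  pose P x y := orthogonal_lattice (kcone p) x /\ kval p x = y.
  suff [] : P (\sum_j ip chi (row j E) *: dualv E j)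
    (\prod_j kval p (dualv E j) ^ ip chi (row j E)) by [].
  apply: (big_ind2 P) => [|x1 x2 y1 y2 [h1 <-] [h2 <-]|j _].
  - by split; [exact: orth0|exact: kval0].
  - by split; [exact: orthD|rewrite kvalD //; exact: orth_dual].
  - have [jJ|jJ] := boolP (j \in J).
      rewrite eJ in h0; rewrite ((orth_fcone _ _ _ uE).1 h0 j jJ) scale0r expr0z.
      by split; [exact: orth0|exact: kval0].
    have Oj : orthogonal_lattice (kcone p) (dualv E j).
      by apply/kval_neq0; rewrite inE in jJ.
    by split; [exact: orthZ|rewrite kval_orthZ].
have -> : kval p chi = 0 by apply/eqP; apply: contraT => /kval_neq0.
have [j jJ nj] : exists2 j, j \in J & ip chi (row j E) != 0.
  apply: contrapT => h; apply: nO; rewrite eJ; apply/orth_fcone => // j jJ.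
  by apply/eqP; apply: contraT => nj; case: h; exists j.
rewrite /mon (bigD1 j) //=; move: jJ; rewrite inE => /eqP ->.
by rewrite exp0rz (negPf nj) mul0r.
Qed.

Lemma kpoint_chart_eq p q E : E \in S -> kcone p `<=` top E -> kcone q `<=` top E ->
  (forall j, kval p (dualv E j) = kval q (dualv E j)) -> p = q.
Proof.
move=> ES pE qE h; apply: kpoint_eq.
  rewrite (kcone_chart ES pE) (kcone_chart ES qE); congr fcone.
  by apply/setP => j; rewrite !inE h.
apply/funext => chi; rewrite (kval_mon _ ES pE) (kval_mon _ ES qE).
by apply: eq_bigr => j _; rewrite h.
Qed.

Section Point.
Variables (E : 'M[int]_n) (ES : E \in S) (z : 'I_n -> C).
Let J : {set 'I_n} := [set j | z j == 0].

Lemma mon0 : mon E z 0 = 1.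
Proof. by rewrite /mon big1 // => j _; rewrite ip0l expr0z. Qed.

Lemma monD chi psi : dual_monoid (fcone E J : set V) chi ->
  dual_monoid (fcone E J : set V) psi ->
  mon E z (chi + psi) = mon E z chi * mon E z psi.
Proof.
have uE := vS.1 _ ES; move=> /(dual_fcone _ _ _ uE) h /(dual_fcone _ _ _ uE) h'.
rewrite /mon -big_split; apply: eq_bigr => j _ /=; rewrite ipDl.
have [z0|z0] := eqVneq (z j) 0; last by rewrite expfzDr.
have jJ : j \in J by rewrite inE z0.
have := h j jJ; have := h' j jJ; case: (ip chi _) => // a; case: (ip psi _) => // b _ _.
by rewrite -!exprnP exprD.
Qed.

Lemma mon_neq0 chi : mon E z chi != 0 <-> orthogonal_lattice (fcone E J : set V) chi.
Proof.
have uE := vS.1 _ ES; rewrite orth_fcone //; split=> [/prodf_neq0 h j|h].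
  by rewrite inE => /eqP zj; have := h j isT; rewrite zj exp0rz;
    case: (ip _ _ =P 0) => // _; rewrite eqxx.
apply/prodf_neq0 => j _; have [z0|z0] := eqVneq (z j) 0; last exact: expfz_neq0.
by rewrite h ?expr0z ?oner_neq0 // inE z0.
Qed.

(** Together with [kpoint_chart_eq] this identifies the chart of [E] with affine n-space. *)
Definition pt : kpoint D := KPoint (fan_fcone J ES) mon0 monD mon_neq0.

Lemma pt_top : kcone pt `<=` top E.
Proof. by apply: fcone_sub; exact: finset.subsetT. Qed.

Lemma pt_coord j : kval pt (dualv E j) = z j.
Proof.
have uE := vS.1 _ ES; rewrite /= /mon (bigD1 j) //= ip_dual // eqxx expr1z.
by rewrite big1 ?mulr1 // => i ij; rewrite ip_dual // (negPf ij) expr0z.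
Qed.
End Point.

Lemma pt_eq p E (ES : E \in S) z : kcone p `<=` top E ->
  (forall j, kval p (dualv E j) = z j) -> p = pt ES z.
Proof.
move=> pE h; apply: (kpoint_chart_eq ES pE); first exact: pt_top.
by move=> j; rewrite pt_coord.
Qed.

Definition uchart t : set X := [set p | kcone p `<=` t].

Lemma sep_kval p t t' psi : kcone p `<=` t' ->
  (forall v, t' v -> (pairing (real_of psi) v = 0 <-> t v)) ->
  kval p psi != 0 <-> kcone p `<=` t.
Proof.
move=> pt' h; split=> [/kval_neq0 o v pv|pt0]; first by apply/h; [exact: pt'|exact: o].
by apply/kval_neq0 => v pv; apply/h; [exact: pt'|exact: pt0].
Qed.

Lemma uchart_open t : D t -> open (uchart t).
Proof.
move=> Dt; rewrite /= glued_openE => -[t' Dt'] p /= pt' pt0.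
have [psi [d h _]] := fan_sep vS Dt Dt'.
exists (fun q => kval q psi); split.
- by apply: cr_gen; exists psi.
- by apply/(sep_kval pt' h).
- by move=> q /= qt'; move/(sep_kval qt' h).
Qed.

Lemma kval_reg t chi : D t -> dual_monoid t chi ->
  reg (uchart t) (fun p : X => kval p chi).
Proof.
move=> Dt dchi [t' Dt'] p /= pt' pt0.
have [psi [d h f]] := fan_sep vS Dt Dt'; have [k dk] := f _ dchi.
(* Multiplying numerator and denominator by a power of [psi] turns [chi] into a fraction of
   characters regular on the chart of [t']. *)
exists (fun q => kval q (chi + psi *+ k)), (fun q => kval q (psi *+ k)).
have dq q : kcone q `<=` t' -> dual_monoid (kcone q) psi by move=> qt' v /qt'/d.
have dkk : dual_monoid t' (psi *+ k).
  move=> v t'v; elim: k {dk} => [|k IH];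
    last by rewrite mulrS real_ofD pairingDl addr_ge0 // d.
  by rewrite mulr0n real_of0 pairing0l.
split; [by apply: cr_gen; exists (chi + psi *+ k)|by apply: cr_gen; exists (psi *+ k)| |].
  by rewrite (kvalX _ (dq _ pt')).2 expf_neq0 //; apply/(sep_kval pt' h).
move=> q /= qt' qt _; rewrite (kvalX _ (dq _ qt')).2.
have dc : dual_monoid (kcone q) chi by move=> v /qt/dchi.
rewrite kvalD // ?(kvalX _ (dq _ qt')).2 ?mulfK //; last exact: (kvalX _ (dq _ qt')).1.
by rewrite expf_neq0 //; apply/(sep_kval qt' h).
Qed.

Lemma dual_top E j : E \in S -> dual_monoid (top E) (dualv E j).
Proof.
move=> ES; have uE := vS.1 _ ES; apply/dual_fcone => // i _.
by rewrite ip_dual // ler0n.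
Qed.

Lemma coord_reg E j : E \in S -> reg (uchart (top E)) (fun p : X => kval p (dualv E j)).
Proof. by move=> ES; apply: kval_reg; [exact: fan_top|exact: dual_top]. Qed.

Lemma uchart_top_open E : E \in S -> open (uchart (top E)).
Proof. by move=> /fan_top/uchart_open. Qed.

Definition cidx E (ES : E \in S) : at_idx (toric_atlas D) := exist _ (top E) (fan_top ES).

Lemma kval_monn p E chi : E \in S -> kcone p `<=` top E -> dual_monoid (top E) chi ->
  kval p chi = \prod_j kval p (dualv E j) ^+ `|ip chi (row j E)|%N.
Proof.
move=> ES pE /(dual_fcone _ _ _ (vS.1 _ ES)) d; rewrite (kval_mon _ ES pE).
by apply: eq_bigr => j _; rewrite exprnP gez0_abs // d // inE.
Qed.

Lemma mor_at_top (W : fspace C) (f : W -> X) (U : set W) E : E \in S ->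
  open U -> U `<=` f @^-1` (uchart (top E)) ->
  (forall j, reg U (fun w => kval (f w) (dualv E j))) ->
  forall w, U w -> mor_at f w.
Proof.
move=> ES oU Uf h w Uw.
apply: (@mor_at_chart _ (toric_atlas D) W f U (cidx ES)) => //.
move=> _ [chi d <-].
apply: (@reg_ext _ _ _ (fun w => \prod_j kval (f w) (dualv E j) ^+ `|ip chi (row j
  E)|%N)).
  by apply: reg_prod => // j; apply: reg_exp.
by move=> v Uv /=; rewrite -kval_monn //; exact: Uf.
Qed.

Lemma coord_ring_regE E (ES : E \in S) g : coord_ring (cidx ES) g ->
  reg (uchart (top E)) (g : X -> C).
Proof.
elim=> {g} [_ [chi d <-]|a|g1 g2 _ h1 _ h2|g1 g2 _ h1 _ h2].
- by apply: kval_reg => //; exact: fan_top.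
- by apply: reg_cst; exact: uchart_top_open.
- by apply: reg_add => //; exact: uchart_top_open.
- by apply: reg_mul => //; exact: uchart_top_open.
Qed.

End Fan.
End Charts.

(** The naturals below [size P] are too many to be all roots. The density arguments below restrict
    functions to a curve and end here. *)
Lemma poly_nonroot (F : numDomainType) (P : {poly F}) : P != 0 -> exists e, P.[e] != 0.
Proof.
move=> P0; apply: contrapT => h.
suff : (size [seq i%:R : F | i <- iota 0 (size P)] < size P)%N.
  by rewrite size_map size_iota ltnn.
apply: max_poly_roots => //.
  by apply/allP => x _; rewrite /root; apply: contraT => Px; case: h; exists x.
by rewrite map_inj_uniq ?iota_uniq // => i j /eqP; rewrite eqr_nat => /eqP.
Qed.

Lemma poly_nonroot_neq (F : numDomainType) (P : {poly F}) : P.[0] != 0 ->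
  exists e, e != 0 /\ P.[e] != 0.
Proof.
move=> P0; have PX0 : P * 'X != 0.
  by rewrite mulf_neq0 ?polyX_eq0 //; apply: contraNneq P0 => ->; rewrite horner0.
have [e] := poly_nonroot PX0.
by rewrite hornerM hornerX mulf_eq0 negb_or => /andP[Pe e0]; exists e.
Qed.

(** * The axioms of a fan *)

Section FanIsFan.
Variables (R : realType) (n : nat).
Local Notation C := R[i].
Local Notation M := 'rV[int]_n.
Local Notation V := 'rV[R]_n.
Local Notation real_of := (real_of R).
Implicit Types (E : 'M[int]_n) (chi psi : M) (u v : V) (J K : {set 'I_n}).

Lemma sum_enum_val (I : finType) (W : nmodType) (J : {set I}) (F : I -> W) :
  \sum_(i < #|J|) F (enum_val i) = \sum_(j in J) F j.
Proof. by rewrite [RHS]big_enum_val. Qed.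

Lemma fcone_cone E J : E \in unitmx ->
  fcone E J = cone (fun i : 'I_#|J| => real_of (row (enum_val i) E)).
Proof.
move=> uE; apply/seteqP; split=> [v vJ|_ [a a0 ->]].
  exists (fun i => crd E v (enum_val i)) => [i|]; first by have [] := vJ (enum_val i).
  rewrite (sum_enum_val J (fun j => crd E v j *: real_of (row j E))).
  rewrite {1}(crd_decomp v uE) [RHS]big_mkcond /=; apply: eq_bigr => j _.
  by case: ifPn => // /(vJ j).2 ->; rewrite scale0r.
by apply: fcone_comb => // i _ _; apply: fcone_row => //; exact: enum_valP.
Qed.

Lemma rows_free E J : E \in unitmx ->
  free [tuple real_of (row (enum_val i) E) | i < #|J|].
Proof.
move=> uE; apply/freeP => k h i.
have h' : \sum_i k i *: real_of (row (enum_val i) E) = 0.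
  by rewrite -[RHS]h; apply: eq_bigr => j _; rewrite -tnth_nth tnth_mktuple.
have /(congr1 (fun v => crd E v (enum_val i))) := h'.
rewrite crd_sum (bigD1 i) //= big1 => [|j ji].
  rewrite crdZ crd_row // eqxx mulr1 addr0 => ->; exact: pairing0r.
rewrite crdZ crd_row //.
by case: eqP => [/enum_val_inj e|]; [rewrite e eqxx in ji|rewrite mulr0].
Qed.

Variable S : seq 'M[int]_n.
Hypothesis vS : valid R S.
Hypothesis S0 : S != [::].
Local Notation D := (@fan R n S).
Local Notation X := (toric_variety D).

Lemma fan_is_fan : is_fan D.
Proof.
split.
- apply: (@sub_finite_set _ _ ((fun q => fcone q.1 q.2) @` [set` [seq (E, J) | E <- S,
  J <- enum {set 'I_n}]])).
    move=> s [E ES [J ->]]; exists (E, J) => //=.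
    by apply/allpairsP; exists (E, J); rewrite /= ES mem_enum.
  exact/finite_image/finite_seq.
- case: S S0 => // E s _; exists (fcone E finset.set0); exists E;
  last by exists finset.set0.
  exact: mem_head.
- move=> s [E ES [J ->]]; have uE := vS.1 _ ES; split.
    by exists #|J|, (fun i => row (enum_val i) E); exact: fcone_cone.
  move=> v h1 h2; apply: (crd_eq uE) => j; apply/eqP.
  rewrite [X in _ == X]pairing0r eq_le; have [-> _] := h1 j; have [+ _] := h2 j.
  by rewrite -scaleN1r crdZ mulN1r oppr_ge0 => ->.
- move=> s f [E ES [J ->]] [u u0 ->]; have uE := vS.1 _ ES.
  (* As [u] is nonnegative on the rays, it vanishes at [v] only if it vanishes on every ray with a
     nonzero coefficient in [v]. *)
  exists E => //; exists [set j in J | pairing u (real_of (row j E)) == 0]%SET.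
  have ur j : j \in J -> 0 <= pairing u (real_of (row j E)) by move=> jJ; apply: u0;
    exact: fcone_row.
  apply/seteqP; split=> [v [vJ] | v vJ].
    rewrite (pairing_crd _ _ uE) => /eqP; rewrite psumr_eq0 => [/allP h j|j _].
      have [cj0 cj] := vJ j; split=> //; rewrite inE negb_and.
      have [jJ /= pj|jJ _] := boolP (j \in J); last exact: cj.
      have /= := h j (mem_index_enum _); rewrite mulf_eq0 (negPf pj) orbF.
      by move/eqP.
    have [cj0 cj] := vJ j; have [jJ|/cj ->] := boolP (j \in J); last by rewrite mul0r.
    by rewrite mulr_ge0 ?ur.
  split; first by apply: fcone_sub vJ; apply/fintype.subsetP => j; rewrite inE => /andP[].
  rewrite (pairing_crd _ _ uE) big1 // => j _.
  have [jJ|/(vJ j).2 ->] := boolP (j \in [set j in J | pairing u (real_of (row j E)) ==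
    0]%SET).
    by move: jJ; rewrite inE => /andP[_ /eqP ->]; rewrite mulr0.
  by rewrite mul0r.
- have sepI t t' : D t -> D t' -> face (t `&` t') t'.
    move=> Dt Dt'; have [psi [d h _]] := fan_sep vS Dt Dt'.
    exists (real_of psi); first exact: d.
    apply/seteqP; split=> v; [move=> [tv t'v]|move=> [t'v p0]]; split=> //.
      exact/(h v t'v).
    exact/(h v t'v).
  by move=> s s' Ds Ds'; split; [rewrite setIC|]; exact: sepI.
Qed.

End FanIsFan.

(** * Polynomial functions on a chart and smoothness *)

Section Smooth.
Variables (R : realType) (n : nat).
Local Notation C := R[i].
Local Notation M := 'rV[int]_n.
Local Notation V := 'rV[R]_n.
Local Notation real_of := (real_of R).
Implicit Types (E : 'M[int]_n) (chi psi : M) (u v : V) (J K : {set 'I_n}).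
Variable S : seq 'M[int]_n.
Hypothesis vS : valid R S.
Local Notation D := (@fan R n S).
Local Notation X := (toric_variety D).

Section InChart.
Variables (E : 'M[int]_n) (ES : E \in S).
Local Notation cr := (@coord_ring _ (toric_atlas D) (cidx R ES)).
Local Notation z := (fun j (p : kpoint D) => kval p (dualv E j)).
Local Notation dm := (fun p : kpoint D => kcone p `<=` @top R n E).

Lemma coord_ring_coord j : cr (z j).
Proof. by apply: cr_gen; exists (dualv E j) => //; exact: (dual_top vS). Qed.

(* On the chart the coordinate ring is the polynomial ring in the coordinates. *)
Lemma coord_ring_ind (P : (kpoint D -> C) -> Prop) :
  (forall f g, (forall p, dm p -> f p = g p) -> P f -> P g) ->
  (forall a, P (fun=> a)) -> (forall j, P (z j)) ->
  (forall f g, cr f -> cr g -> P f -> P g -> P (fun x => f x + g x)) ->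
  (forall f g, cr f -> cr g -> P f -> P g -> P (fun x => f x * g x)) ->
  forall f, cr f -> P f.
Proof.
move=> Pext Pc Pz PD PM f; elim=> {f} [_ [chi d <-]|a|f g cf Pf cg Pg|f g cf Pf cg Pg].
- pose Q f := cr f /\ P f.
  have Q1 : Q (fun=> 1) by split; [exact: cr_cst|exact: Pc].
  have QM f g : Q f -> Q g -> Q (fun x => f x * g x).
    by move=> [? ?] [? ?]; split; [exact: cr_mul|exact: PM].
  have Qp (r : nat) (F : 'I_r -> kpoint D -> C) : (forall i, Q (F i)) ->
      Q (fun x => \prod_(i < r) F i x).
    elim: r F => [|r IH] F QF.
      by suff -> : (fun x => \prod_(i < 0) F i x) = (fun=> 1); first exact: Q1;
         apply/funext => x; rewrite big_ord0.
    suff -> : (fun x => \prod_(i < r.+1) F i x) =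
       (fun x => \prod_(i < r) F (widen_ord (leqnSn r) i) x * F ord_max x).
      by apply: QM => //; apply: IH.
    by apply/funext => x; rewrite big_ord_recr.
  have QX f k : Q f -> Q (fun x => f x ^+ k).
    move=> Qf; elim: k => [|k IH].
      by suff -> : (fun x => f x ^+ 0) = (fun=> 1); last by apply/funext.
    suff -> : (fun x => f x ^+ k.+1) = (fun x => f x * f x ^+ k) by exact: QM.
    by apply/funext => x; rewrite exprS.
  apply: (Pext (fun p => \prod_j z j p ^+ `|ip chi (row j E)|%N)).
    by move=> p pE; rewrite (kval_monn vS ES pE d).
  apply: (Qp _ (fun j p => z j p ^+ _) _).2 => j; apply: QX; split;
    [exact: coord_ring_coord|exact: Pz].
- exact: Pc.
- exact: PD.
- exact: PM.
Qed.

(** Such first-order expansions are stable under sums and products. They show that the coordinates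
    shifted to vanish at [x] generate the maximal ideal there. *)
Lemma coord_ring_taylor x f : dm x -> cr f -> exists a : 'I_n -> kpoint D -> C,
  (forall j, cr (a j)) /\
  forall y, dm y -> f y - f x = \sum_j a j y * (z j y - z j x).
Proof.
move=> dx; elim/coord_ring_ind => {f} [f g fg [a [ca h]]|b|j|f g cf cg [a [ca ha]] [b
  [cb hb]]|f g cf cg [a [ca ha]] [b [cb hb]]].
- by exists a; split=> // y dy; rewrite -!fg // h.
- exists (fun _ _ => 0); split=> [j|y dy]; first exact: cr_cst.
  by rewrite subrr big1 // => i _; rewrite mul0r.
- exists (fun i _ => (i == j)%:R); split=> [i|y dy]; first exact: cr_cst.
  rewrite (bigD1 j) //= eqxx mul1r big1 ?addr0 // => i ij.
  by rewrite (negPf ij) mul0r.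
- exists (fun i y => a i y + b i y); split=> [i|y dy]; first exact: cr_add.
  have -> : f y + g y - (f x + g x) = (f y - f x) + (g y - g x) by ring.
  rewrite ha // hb // -big_split.
  by apply: eq_bigr => i _; rewrite mulrDl.
- exists (fun i y => a i y * g y + f x * b i y); split=> [i|y dy].
    by apply: cr_add; apply: cr_mul => //; exact: cr_cst.
  have -> : f y * g y - f x * g x = (f y - f x) * g y + f x * (g y - g x) by ring.
  rewrite ha // hb // mulr_suml mulr_sumr -big_split.
  by apply: eq_bigr => i _ /=; ring.
Qed.

Lemma coord_ring_curve (q : 'I_n -> {poly C}) f : cr f ->
  exists P : {poly C}, forall e, f (pt vS ES (fun j => (q j).[e])) = P.[e].
Proof.
elim/coord_ring_ind => {f} [f g fg [P h]|b|j|f g cf cg [P hP] [Q hQ]|f g cf cg [P hP]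
  [Q hQ]].
- by exists P => e; rewrite -fg //; exact: pt_top.
- by exists b%:P => e; rewrite hornerC.
- by exists (q j) => e; rewrite pt_coord.
- by exists (P + Q) => e; rewrite hP hQ hornerD.
- by exists (P * Q) => e; rewrite hP hQ hornerM.
Qed.

(** If [a] were nonzero at a point where [z i] vanishes, then on the line through it in the
    direction [i] there would be another point, with [z i] nonzero, at which [a] is still
    nonzero. *)
Lemma coord_nonzerodivisor i (U : set X) : U `<=` uchart (@top R n E) ->
  nonzerodivisor U (z i : X -> C).
Proof.
move=> UE V' a oV' V'U ra h p V'p; apply/eqP; apply: contraT => ap.
have pE := UE _ (V'U _ V'p).
have [f [g [cf cg gp fgE]]] := @glued_reg_frac _ (toric_atlas D) V' a (cidx R ES) p oV'
  ra pE V'p.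
have [z0|z0] := eqVneq (z i p) 0; last first.
  by have /eqP := h p V'p; rewrite mulf_eq0 (negPf ap) (negPf z0).
pose q j : {poly C} := if j == i then 'X else (z j p)%:P.
have [F hF] := coord_ring_curve q cf; have [G hG] := coord_ring_curve q cg.
have p0 : p = pt vS ES (fun j => (q j).[0]).
  apply: pt_eq => // j; rewrite /q; case: eqP => [->|_]; by rewrite !hornerE.
have fp : f p != 0.
  apply: contraNneq ap => f0; have [_ ->] := fgE p pE gp.
  by rewrite f0 mul0r.
have [e [e0]] : exists e, e != 0 /\ (F * G).[e] != 0.
  by apply: poly_nonroot_neq; rewrite hornerM -hF -hG -p0 mulf_neq0.
rewrite hornerM -hF -hG mulf_eq0 negb_or; set y := pt _ _ _ => /andP[fy gy].
have yE : dm y by exact: pt_top.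
have [V'y ay] := fgE y yE gy.
have := h y V'y; rewrite ay pt_coord /q eqxx hornerX => /eqP.
by rewrite !mulf_eq0 invr_eq0 (negPf fy) (negPf gy) (negPf e0).
Qed.

End InChart.

Lemma toric_smooth : smooth n X.
Proof.
move=> x; have [E ES xE] := kcone_in_top x.
exists (uchart (@top R n E)), (fun j (p : X) => kval p (dualv E j) - kval x (dualv E j)).
have oU := uchart_top_open vS ES.
split=> //.
- move=> j; apply: reg_sub => //; first exact: coord_reg.
  exact: reg_cst.
- by move=> j; rewrite subrr.
move=> W g oW Wx rg gx.
have [a [b [ca cb bx h]]] := @glued_reg_frac _ (toric_atlas D) W g (cidx R ES) x oW rg
  xE Wx.
have [c [cc hc]] := coord_ring_taylor xE ca.
have ax : a x = 0.
  by have [_] := h x xE bx; rewrite gx => /esym/eqP;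
    rewrite mulf_eq0 invr_eq0 (negPf bx) orbF => /eqP.
have rb := coord_ring_regE vS cb.
have oW' := reg_open oU rb.
exists [set y | uchart (@top R n E) y /\ b y != 0], (fun j y => c j y / b y); split=> //.
- by move=> y [yE /(h _ yE)[]].
- move=> j; apply: reg_div => //.
  + by apply: reg_restr (coord_ring_regE vS (cc j)) => //; move=> y [].
  + by apply: reg_restr rb => //; move=> y [].
  + by move=> y [].
- move=> y [yE by0]; have [_ ->] := h y yE by0.
  have := hc y yE; rewrite ax subr0 => ->; rewrite mulr_suml; apply: eq_bigr => j _.
  by rewrite mulrAC.
Qed.

End Smooth.

(** * Orbit closures and their ideals *)

Section SpanBasis.
Variables (R : realType) (n : nat).
Local Notation M := 'rV[int]_n.
Local Notation V := 'rV[R]_n.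
Local Notation real_of := (real_of R).
Implicit Types (E : 'M[int]_n) (chi psi : M) (u v : V) (J K : {set 'I_n}).

(** For unimodular [E] this is the lattice spanned by the [dualv E j] with [j] in [J]. *)
Definition supp_lattice E J : set M :=
  [set chi | forall j, j \notin J -> ip chi (row j E) = 0].

Lemma pairing_dual E j k : E \in unitmx ->
  pairing (real_of (dualv E j)) (real_of (row k E)) = (k == j)%:R.
Proof. by move=> uE; rewrite pairing_real ip_dual //; case: eqP. Qed.

(** The scalars [c] leave room for the sign changes of property (E); for the codimension of orbits
    they are all 1. *)
Lemma supp_lattice_basis E J (c : 'I_n -> R) : E \in unitmx -> (forall j, c j != 0) ->
  is_basis (real_span (supp_lattice E J))
    [tuple c (enum_val i) *: real_of (dualv E (enum_val i)) | i < #|J|].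
Proof.
move=> uE c0; set u := mktuple _; split.
  apply/freeP => k h i.
  have h' : \sum_i (k i * c (enum_val i)) *: real_of (dualv E (enum_val i)) = 0.
    by rewrite -[RHS]h; apply: eq_bigr => j _; rewrite -tnth_nth tnth_mktuple scalerA.
  have /(congr1 (fun v => pairing v (real_of (row (enum_val i) E)))) := h'.
  rewrite pairing0l pairing_suml (bigD1 i) //= big1 => [|j ji].
    rewrite pairingZl pairing_dual // eqxx mulr1 addr0 => /eqP.
    by rewrite mulf_eq0 (negPf (c0 _)) orbF => /eqP.
  rewrite pairingZl pairing_dual //.
  by case: eqP => [/enum_val_inj e|]; [rewrite e eqxx in ji|rewrite mulr0].
have uj j : j \in J -> real_of (dualv E j) \in <<u>>%VS.
  move=> jJ; have -> : real_of (dualv E j) = (c j)^-1 *: tnth u (enum_rank_in jJ j).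
    by rewrite tnth_mktuple enum_rankK_in // scalerA mulVf ?scale1r.
  by rewrite memvZ // memv_span // mem_tnth.
apply/seteqP; split=> [_ [s sG ->]|v].
  elim: s sG => [|[a chi] s IH] sG; first by rewrite big_nil /= mem0v.
  rewrite big_cons /= memvD //; last by apply: IH => q qs; apply: sG; rewrite inE qs orbT.
  have chiG : supp_lattice E J chi by apply: (sG (a, chi)); rewrite mem_head.
  rewrite memvZ // (chi_decomp chi uE) real_of_sum memv_suml // => j _.
  rewrite real_ofZ; have [jJ|/chiG ->] := boolP (j \in J); last by rewrite scale0r mem0v.
  by rewrite memvZ // uj.
move=> vu; have ve : v = \sum_i coord u i v *: u`_i by exact: coord_span.
exists [seq (coord u i v * c (enum_val i), dualv E (enum_val i)) | i <- enum 'I_#|J|].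
  move=> q /mapP[i _ ->] j jJ /=; rewrite ip_dual //.
  by case: eqP => // e; rewrite e enum_valP in jJ.
rewrite big_map big_enum [LHS]ve; apply: eq_bigr => i _.
by rewrite -tnth_nth tnth_mktuple scalerA.
Qed.

End SpanBasis.

Section Orbits.
Variables (R : realType) (n : nat).
Local Notation C := R[i].
Local Notation M := 'rV[int]_n.
Local Notation V := 'rV[R]_n.
Local Notation real_of := (real_of R).
Implicit Types (E : 'M[int]_n) (chi psi : M) (u v : V) (J K : {set 'I_n}).

(** The point is the product over [j] of the one-parameter subgroup given by row [j], evaluated at
    [c j]. *)
Lemma torus_point E (c : 'I_n -> C) : (forall j, c j != 0) ->
  exists t : torus C n, forall chi, tchar chi t = mon E c chi.
Proof.
move=> c0.
have t0 l : \prod_j c j ^ E j l != 0 by apply/prodf_neq0 => j _; exact: expfz_neq0.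
exists (Torus t0) => chi; rewrite /tchar /= /mon.
transitivity (\prod_(l < n) \prod_(j < n) c j ^ (E j l * chi 0 l)).
  apply: eq_bigr => l _; elim/big_rec2: _ => [|j x y _ <-]; first by rewrite exp1rz.
  by rewrite expfzMl exprz_exp.
rewrite exchange_big /=; apply: eq_bigr => j _.
have cD : forall a b, c j ^ (a + b) = c j ^ a * c j ^ b by move=> a b; rewrite expfzDr.
rewrite /ip (big_morph (fun a : int => c j ^ a) cD (expr0z _)).
by apply: eq_bigr => l _; rewrite mxE mulrC.
Qed.

Variable S : seq 'M[int]_n.
Hypothesis vS : valid R S.
Local Notation D := (@fan R n S).
Local Notation X := (toric_variety D).

(** The ray has coefficient 1 on itself in the expansion on [E]; by compatibility the same
    coefficient occurs on [E'], which must therefore have this ray. *)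
Lemma ray_in E E' J i : E \in S -> E' \in S -> fcone E' J (real_of (row i E)) ->
  exists2 i', i' \in J & row i' E' = row i E.
Proof.
move=> ES ES' h; have [uE uE'] := (vS.1 _ ES, vS.1 _ ES').
have ce := vS.2 _ _ ES ES' (real_of (row i E))
   (fcone_row R uE (finset.in_setT i)) (fcone_sub (finset.subsetT _) h).
have : cf E' (real_of (row i E)) (row i E) != 0.
  by rewrite -ce cf_row // crd_row // eqxx oner_eq0.
move=> /(cf_neq0 uE')[i' [e ci']]; exists i' => //.
by apply: contraNT ci' => /(h i').2 ->.
Qed.

(* The points whose orbit lies in the closure of the orbit of the cone on [rho]
   and [sigma], cf. [orbit_closure]. *)
Definition oclosure (rho sigma : M) : set X :=
  [set p | kcone p (real_of rho) /\ kcone p (real_of sigma)].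

Lemma oclosure_top (p : X) E i j : E \in S -> kcone p `<=` top E ->
  oclosure (row i E) (row j E) p <-> kval p (dualv E i) = 0 /\ kval p (dualv E j) = 0.
Proof.
move=> ES pE; have uE := vS.1 _ ES; rewrite /oclosure /= (kcone_chart vS ES pE).
set J := finset _.
have h k : fcone E J (real_of (row k E)) <-> kval p (dualv E k) = 0.
  split=> [|k0]; last by apply: fcone_row => //; rewrite inE k0.
  move=> /(ray_in ES ES)[k' + /(row_inj uE) <-].
  by rewrite inE => /eqP.
by rewrite !h.
Qed.

Lemma oclosure_closed rho sigma : closed (oclosure rho sigma).
Proof.
rewrite -openC; apply: (@open_local _ X) => p np.
exists (uchart (kcone p)); split.
- by apply: uchart_open => //; exact: kcone_in.
- by [].
- by move=> q qp [h1 h2]; apply: np; split; exact: qp.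
Qed.

Lemma same_orbit (p q : X) : kcone p = kcone q -> torbit p q.
Proof.
move=> e; have [E ES pE] := kcone_in_top p.
have qE : kcone q `<=` top E by rewrite -e.
have uE := vS.1 _ ES.
(* The two points have the same vanishing coordinates, where any nonzero factor would do; elsewhere
   the ratio carries [p] to [q]. *)
pose c j := if kval p (dualv E j) == 0 then 1 else kval q (dualv E j) / kval p (dualv E
  j).
have zpq j : (kval p (dualv E j) == 0) = (kval q (dualv E j) == 0).
  by apply: negb_inj; apply/idP/idP => /kval_neq0 h; apply/kval_neq0;
    [rewrite -e|rewrite e].
have c0 j : c j != 0.
  rewrite /c; case: ifPn => [_|p0]; first exact: oner_neq0.
  by rewrite mulf_neq0 // ?invr_neq0 // -zpq.
have [t tE] := torus_point E c0; exists t => //=.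
apply: (kpoint_chart_eq vS ES) => // j; rewrite /= /kact_val tE /mon (bigD1 j) //=.
rewrite ip_dual // eqxx expr1z big1 ?mulr1 /c => [|k kj].
  case: ifPn => [/eqP p0|p0]; last by rewrite mulfVK.
  by rewrite p0 mulr0; apply/esym/eqP; rewrite -zpq p0.
by rewrite ip_dual // (negPf kj) expr0z.
Qed.

Lemma orbit_closure E i j (x : X) : E \in S -> kcone x = fcone E [set i; j]%SET ->
  closure (torbit x) = oclosure (row i E) (row j E).
Proof.
move=> ES xE; have uE := vS.1 _ ES; apply/seteqP; split.
  have /closure_id -> := @oclosure_closed (row i E) (row j E); apply: closureS.
  move=> _ [t _ <-] /=; rewrite /oclosure /= xE.
  by split; apply: fcone_row => //; rewrite !inE eqxx ?orbT.
move=> p [pi pj] U; rewrite nbhsE => -[B [oB Bp] BU].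
have [E' ES' pE'] := kcone_in_top p; have uE' := vS.1 _ ES'.
have kp := kcone_chart vS ES' pE'; set J := finset _ in kp.
rewrite kp in pi pj.
have [i' iJ ei] := ray_in ES ES' pi; have [j' jJ ej] := ray_in ES ES' pj.
rewrite inE in iJ; rewrite inE in jJ.
rewrite /= glued_openE in oB.
have [f [cf fp fB]] := oB (cidx R ES') p pE' Bp.
(* This curve leaves [p] by moving exactly the vanishing coordinates that do not belong to the two
   rays, so it lies in the orbit for every nonzero parameter. *)
pose q k : {poly C} := if (k \in [set i'; j']%SET) || (kval p (dualv E' k) != 0)
  then (kval p (dualv E' k))%:P else 'X.
have [P hP] := coord_ring_curve vS q cf.
have p0 : p = pt vS ES' (fun k => (q k).[0]).
  apply: pt_eq => // k; rewrite /q; case: ifPn => [_|]; rewrite ?hornerC ?hornerX //.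
  by rewrite negb_or negbK => /andP[_ /eqP].
have [e [e0]] : exists e, e != 0 /\ P.[e] != 0.
  by apply: poly_nonroot_neq; rewrite -hP -p0.
rewrite -hP; set y := pt _ _ _ => fy.
have yE : kcone y `<=` top E' by exact: pt_top.
exists y; split; last by apply: BU; exact: (fB y yE).
apply: same_orbit; rewrite xE.
have -> : kcone y = fcone E' [set i'; j']%SET.
  rewrite /=; congr fcone; apply/setP => k; rewrite [LHS]inE /q.
  case: ifPn => [/orP[kij|k0]|]; rewrite ?hornerC ?hornerX.
  - by rewrite kij; move: kij; rewrite !inE => /orP[/eqP->|/eqP->].
  - rewrite (negPf k0); apply/esym/negP; rewrite !inE => /orP[/eqP e1|/eqP e1];
      by rewrite e1 ?iJ ?jJ in k0.
  - by rewrite negb_or => /andP[/negPf-> _]; rewrite (negPf e0).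
apply/seteqP; split; apply: fcone_subP => // k; rewrite !inE => /orP[/eqP->|/eqP->].
- by rewrite -ei; apply: fcone_row => //; rewrite !inE eqxx.
- by rewrite -ej; apply: fcone_row => //; rewrite !inE eqxx orbT.
- by rewrite ei; apply: fcone_row => //; rewrite !inE eqxx.
- by rewrite ej; apply: fcone_row => //; rewrite !inE eqxx orbT.
Qed.

Lemma orbit_codim2 E i j (x : X) : E \in S -> i != j ->
  kcone x = fcone E [set i; j]%SET -> orbit_codim x 2.
Proof.
move=> ES ij xE; have uE := vS.1 _ ES.
pose J := (~: [set i; j])%SET.
exists #|J|, [tuple 1 *: real_of (dualv E (enum_val i)) | i < #|J|]; split; last first.
  by have := cardsC [set i; j]%SET; rewrite cards2 ij card_ord addnC.
suff -> : orbit_lattice x = supp_lattice E J.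
  by apply: (supp_lattice_basis J uE (fun=> oner_neq0 _)).
have stab (t : torus C n) : stabilizer x t <->
    forall chi, orthogonal_lattice (kcone x) chi -> tchar chi t = 1.
  split=> [h chi /kval_neq0 k0|h].
    have /(congr1 (fun p : kpoint D => kval p chi)) /= := h.
    by rewrite /kact_val => /eqP; rewrite -subr_eq0 -{2}[kval x chi]mul1r -mulrBl
      mulf_eq0 (negPf k0) orbF subr_eq0 => /eqP.
  apply: kpoint_eq => //=; apply/funext => chi; rewrite /kact_val.
  have [k0|/kval_neq0 /h ->] := eqVneq (kval x chi) 0; first by rewrite k0 mulr0.
  by rewrite mul1r.
have orthE chi : orthogonal_lattice (kcone x) chi <-> supp_lattice E J chi.
  rewrite xE orth_fcone //; split=> h k; first by rewrite inE negbK => /h.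
  by move=> kJ; apply: h; rewrite inE negbK.
apply/seteqP; split=> [chi h k kJ|chi /orthE h t /stab h']; last exact: (h' _ h).
apply/eqP; apply: contraT => nk.
(* The torus point with value 2 on [dualv E k] and 1 on the other dual vectors stabilizes [x]; as 2
   has infinite order, a character trivial on it vanishes on row [k]. *)
have c0 l : (if l == k then 2%:R else 1 : C) != 0 by case: ifP => _;
  rewrite ?pnatr_eq0 ?oner_eq0.
have [t tE] := torus_point E c0.
have : tchar chi t = 1.
  apply: h; apply/stab => psi /orthE h; rewrite tE /mon big1 // => l _.
  by case: eqP => [->|_]; rewrite ?(h _ kJ) ?expr0z ?exp1rz.
rewrite tE /mon (bigD1 k) //= eqxx big1 ?mulr1 => [|l /negPf ->]; last by rewrite exp1rz.
move=> /eqP.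
case: (ip chi (row k E)) nk => m; rewrite ?NegzE; [|rewrite -exprnN invr_eq1 => _];
  rewrite -?exprnP -natrX (@eqr_nat _ _ 1).
  by case: m => // m _; rewrite gtn_eqF // -{1}(expn0 2) ltn_exp2l.
by rewrite gtn_eqF // -{1}(expn0 2) ltn_exp2l.
Qed.

End Orbits.

Section Vanishing.
Variables (R : realType) (n : nat).
Local Notation C := R[i].
Local Notation M := 'rV[int]_n.
Local Notation V := 'rV[R]_n.
Local Notation real_of := (real_of R).
Implicit Types (E : 'M[int]_n) (chi psi : M) (u v : V) (J K : {set 'I_n}).
Variable S : seq 'M[int]_n.
Hypothesis vS : valid R S.
Local Notation D := (@fan R n S).
Local Notation X := (toric_variety D).
Variables (E : 'M[int]_n) (ES : E \in S) (i j : 'I_n).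
Local Notation cr := (@coord_ring _ (toric_atlas D) (cidx R ES)).
Local Notation z := (fun j (p : kpoint D) => kval p (dualv E j)).
Local Notation dm := (fun p : kpoint D => kcone p `<=` @top R n E).

Definition zproj (p : kpoint D) : kpoint D :=
  pt vS ES (fun k => if (k == i) || (k == j) then 0 else z k p).

(** Division with remainder by [z i] and [z j]: the remainder is [f] with these coordinates set to
    zero, so it disappears when [f] vanishes on their common zero locus. *)
Lemma coord_ring_zproj f : cr f -> exists a b g : kpoint D -> C, [/\ cr a, cr b, cr g,
  forall y, dm y -> f y = g y + (a y * z i y + b y * z j y) &
  forall y, dm y -> g y = f (zproj y)].
Proof.
elim/(coord_ring_ind vS) => {f} [f g fg [a [b [h [ca cb cg h1 h2]]]]|c|k|f f' cf cf' [a
  [b [g [ca cb cg h1 h2]]]] [a' [b' [g' [ca' cb' cg' h1' h2']]]]|f f' cf cf' [a [b [g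
    [ca cb cg h1 h2]]]] [a' [b' [g' [ca' cb' cg' h1' h2']]]]].
- exists a, b, h; split=> // y dy; first by rewrite -fg // h1.
  by rewrite -fg ?h2 //; exact: pt_top.
- exists (fun=> 0), (fun=> 0), (fun=> c); split; try exact: cr_cst.
    by move=> y _; rewrite !mul0r !addr0.
  by [].
- have [ki|ki] := eqVneq k i.
    exists (fun=> 1), (fun=> 0), (fun=> 0); split; try exact: cr_cst.
      by move=> y _; rewrite ki mul1r mul0r addr0 add0r.
    by move=> y _; rewrite pt_coord ki eqxx.
  have [kj|kj] := eqVneq k j.
    exists (fun=> 0), (fun=> 1), (fun=> 0); split; try exact: cr_cst.
      by move=> y _; rewrite kj mul1r mul0r !add0r.
    by move=> y _; rewrite pt_coord kj eqxx orbT.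
  exists (fun=> 0), (fun=> 0), (z k); split; try exact: cr_cst.
  + exact: coord_ring_coord.
  + by move=> y _; rewrite !mul0r !addr0.
  + by move=> y _; rewrite pt_coord (negPf ki) (negPf kj).
- exists (fun x => a x + a' x), (fun x => b x + b' x), (fun x => g x + g' x).
  split; try exact: cr_add.
    by move=> y dy; rewrite h1 // h1' //; ring.
  by move=> y dy; rewrite h2 // h2'.
- exists (fun x => a x * f' x + g x * a' x), (fun x => b x * f' x + g x * b' x),
    (fun x => g x * g' x); split.
  + by apply: cr_add; exact: cr_mul.
  + by apply: cr_add; exact: cr_mul.
  + exact: cr_mul.
  + by move=> y dy; rewrite h1 // h1' //; ring.
  + by move=> y dy; rewrite h2 // h2'.
Qed.

(** Away from the orbit closure one of the coordinates is invertible and [s] is a multiple of it; on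
    the orbit closure the numerator of [s] is divided by the two coordinates. *)
Lemma vanishing_ideal (U : set X) s (x : X) : open U -> U x -> dm x ->
  vanishing (oclosure (row i E) (row j E)) U s ->
  exists (U' : set X) (a b : X -> C), [/\ open U', U' x, U' `<=` U `&` uchart (top E),
   reg U' a /\ reg U' b &
   forall y, U' y -> s y = a y * z i y + b y * z j y].
Proof.
move=> oU Ux xE [rs s0].
have oE := uchart_top_open vS ES.
have oUE : open (U `&` uchart (top E)) by exact: openI.
have rz k : reg (uchart (top E)) (z k : X -> C) by exact: coord_reg.
have rzU k : reg (U `&` uchart (top E)) (z k : X -> C).
  by apply: reg_restr (rz k) => //; move=> y [].
have rsU : reg (U `&` uchart (top E)) s by apply: reg_restr rs => //; move=> y [].
have [zi|zi] := eqVneq (z i x) 0; last first.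
  exists [set y | (U `&` uchart (top E)) y /\ z i y != 0], (fun y => s y / z i y),
    (fun=> 0).
  have oU' := reg_open oUE (rzU i).
  split=> //; first by move=> y [].
    split; last exact: reg_cst.
    apply: reg_div => //; last by move=> y [].
      by apply: reg_restr rsU => //; move=> y [].
    by apply: reg_restr (rzU i) => //; move=> y [].
  by move=> y [_ zy]; rewrite mulfVK // mul0r addr0.
have [zj|zj] := eqVneq (z j x) 0; last first.
  exists [set y | (U `&` uchart (top E)) y /\ z j y != 0], (fun=> 0),
    (fun y => s y / z j y).
  have oU' := reg_open oUE (rzU j).
  split=> //; first by move=> y [].
    split; first exact: reg_cst.
    apply: reg_div => //; last by move=> y [].
      by apply: reg_restr rsU => //; move=> y [].
    by apply: reg_restr (rzU j) => //; move=> y [].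
  by move=> y [_ zy]; rewrite mulfVK // mul0r add0r.
have [f [g [cf cg gx h]]] := @glued_reg_frac _ (toric_atlas D) U s (cidx R ES) x oU rs
  xE Ux.
have [a [b [f' [ca cb cf' h1 h2]]]] := coord_ring_zproj cf.
(* Since [g'] is [g] composed with the projection, requiring both to be nonzero keeps the projected
   point in the domain of [s], where [s] is known to vanish. *)
have [_ [_ [g' [_ _ cg' _ h3]]]] := coord_ring_zproj cg.
have xx : zproj x = x.
  apply/esym; apply: pt_eq => // k; case: ifP => // /orP[/eqP->|/eqP->] //.
have rg := coord_ring_regE vS cg.
have rgg : reg (uchart (top E)) (fun y => g y * g' y).
  by apply: reg_mul => //; exact: (coord_ring_regE vS cg').
have oU' := reg_open oE rgg.
exists [set y | uchart (top E) y /\ g y * g' y != 0], (fun y => a y / g y),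
  (fun y => b y / g y).
split=> //.
- by split=> //; rewrite mulf_neq0 // h3 // xx.
- by move=> y [yE]; rewrite mulf_eq0 negb_or => /andP[gy _]; split=> //;
  have [] := h y yE gy.
- have rgU : reg [set y | uchart (top E) y /\ g y * g' y != 0] g.
    by apply: reg_restr rg => //; move=> y [].
  split; apply: reg_div => //; try by move=> y [_]; rewrite mulf_eq0 negb_or => /andP[].
    by apply: reg_restr (coord_ring_regE vS ca) => //; move=> y [].
  by apply: reg_restr (coord_ring_regE vS cb) => //; move=> y [].
- move=> y [yE]; rewrite mulf_eq0 negb_or => /andP[gy g'y].
  have [Uy ->] := h y yE gy; rewrite h1 //.
  have pE : dm (zproj y) by exact: pt_top.
  have [Upy spy] : U (zproj y) /\ s (zproj y) = f (zproj y) / g (zproj y).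
    by apply: h => //; rewrite -h3.
  have sp0 : s (zproj y) = 0.
    apply: s0 => //; apply/(oclosure_top vS i j ES pE).
    by rewrite !pt_coord !eqxx orbT.
  have fp0 : f' y = 0.
    rewrite h2 //; apply/eqP; move/eqP: sp0; rewrite spy mulf_eq0 invr_eq0.
    by rewrite -h3 // (negPf g'y) orbF.
  by rewrite fp0 add0r mulrDl mulrAC [X in _ + X]mulrAC.
Qed.

End Vanishing.

(** * Star subdivision of a 2-dimensional cone *)

Section Star.
Variables (n : nat).
Local Notation M := 'rV[int]_n.
Implicit Types (S : seq 'M[int]_n) (E : 'M[int]_n) (rho sigma : M).

Definition star S rho sigma : seq 'M[int]_n :=
  flatten [seq if ([pick i | row i E == rho], [pick j | row j E == sigma])
                 is (Some i, Some j) then [:: subm E i j; subm E j i] else [:: E]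
          | E <- S].

Lemma starP S rho sigma E' : (forall E, E \in S -> E \in unitmx) ->
  reflect ((E' \in S /\ forall i j, row i E' = rho -> row j E' = sigma -> False) \/
    exists E i j, [/\ E \in S, row i E = rho, row j E = sigma &
      E' = subm E i j \/ E' = subm E j i])
    (E' \in star S rho sigma).
Proof.
move=> uS; apply: (iffP flatten_mapP) => [[E ES]|].
  case: pickP => [i /eqP ei|ni]; last first.
    by rewrite inE => /eqP ->; left; split=> // i j /eqP; rewrite ni.
  case: pickP => [j /eqP ej|nj]; last first.
    by rewrite inE => /eqP ->; left; split=> // k j _ /eqP; rewrite nj.
  rewrite !inE => h; right; exists E, i, j; split=> //.
  by case/orP: h => /eqP ->; [left|right].
case=> [[ES h]|[E [i [j [ES ei ej h]]]]].
  exists E' => //; case: pickP => [i /eqP ei|_]; last exact: mem_head.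
  case: pickP => [j /eqP ej|_]; last exact: mem_head.
  by case: (h i j ei ej).
exists E => //; case: pickP => [i' /eqP ei'|/(_ i)]; last by rewrite ei eqxx.
case: pickP => [j' /eqP ej'|/(_ j)]; last by rewrite ej eqxx.
have -> : i' = i by apply: (row_inj (uS _ ES)); rewrite ei ei'.
have -> : j' = j by apply: (row_inj (uS _ ES)); rewrite ej ej'.
by rewrite !inE; case: h => ->; rewrite eqxx ?orbT.
Qed.

Lemma star_neq E i j rho sigma : row i E = rho -> row j E = sigma -> rho != sigma -> i
  != j.
Proof. by move=> <- <-; apply: contraNneq => ->. Qed.

End Star.

Section StarValid.
Variables (R : realType) (n : nat).
Local Notation M := 'rV[int]_n.
Local Notation V := 'rV[R]_n.
Local Notation real_of := (real_of R).
Local Notation top E := (@top R n E).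
Implicit Types (E : 'M[int]_n) (chi psi : M) (u v : V) (J K : {set 'I_n}).

Lemma crd_subm E i j v k : E \in unitmx -> i != j ->
  crd (subm E i j) v k = crd E v k - (if k == j then crd E v i else 0).
Proof.
move=> uE ij; rewrite /crd (subm_dual uE ij).2; case: eqP => [->|_];
  last by rewrite subr0.
by rewrite real_ofB -scaleN1r pairingDl pairingZl mulN1r.
Qed.

Lemma cf_subm E i j v m : E \in unitmx -> i != j ->
  cf (subm E i j) v m = cf E v m + ((row i E + row j E == m)%:R - (row i E == m)%:R
     - (row j E == m)%:R) * crd E v i.
Proof.
move=> uE ij; have ji : (j == i) = false by rewrite eq_sym (negPf ij).
rewrite /cf (bigD1 i) //= [in RHS](bigD1 i) //=.
rewrite crd_subm // row_subm eqxx (negPf ij) subr0.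
rewrite (bigD1 j) ?ji //= [in RHS](bigD1 j) ?ji //=.
rewrite crd_subm // row_subm eqxx ji.
rewrite (eq_bigr (fun k => (row k E == m)%:R * crd E v k)); first by ring.
by move=> k /andP[ki kj]; rewrite crd_subm // row_subm (negPf ki) (negPf kj) subr0.
Qed.

Lemma topP E v : top E v <-> forall j, 0 <= crd E v j.
Proof. exact: fconeT. Qed.

(** From a rho + b sigma = a (rho + sigma) + (b - a) sigma: the half that keeps the ray [j] is where
    the coordinate [i] is the smaller one. *)
Lemma top_subm E i j v : E \in unitmx -> i != j ->
  top (subm E i j) v <-> top E v /\ crd E v i <= crd E v j.
Proof.
move=> uE ij; rewrite !topP; split=> [h|[h le] k].
  have h' k := h k.
  have hj := h j; rewrite crd_subm // eqxx subr_ge0 in hj.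
  have hi := h i; rewrite crd_subm // (negPf ij) subr0 in hi.
  split=> // k; have := h k; rewrite crd_subm //; case: eqP => [->|_];
    last by rewrite subr0.
  by move=> _; exact: le_trans hj.
rewrite crd_subm //; case: eqP => [->|_]; first by rewrite subr_ge0.
by rewrite subr0 h.
Qed.

(* The coefficients of [v] in the subdivided cone depend only on those in the
   original one: replace [min (c rho) (c sigma)] copies of [rho] and of [sigma]
   by as many of [rho + sigma]. *)
Definition star_coef (rho sigma : M) (c : M -> R) (m : M) : R :=
  c m + ((rho + sigma == m)%:R - (rho == m)%:R - (sigma == m)%:R) * Num.min (c rho) (c
    sigma).

Lemma star_coefC rho sigma : star_coef rho sigma = star_coef sigma rho.
Proof.
apply/funext => c; apply/funext => m; rewrite /star_coef minC (addrC rho).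
by congr (_ + _ * _); rewrite addrAC.
Qed.

Lemma cf_ge0 E v m : top E v -> 0 <= cf E v m.
Proof. by move=> /topP h; apply: sumr_ge0 => j _; rewrite mulr_ge0 ?ler0n. Qed.

Lemma subm_cf E i j v : E \in unitmx -> i != j -> top (subm E i j) v ->
  cf (subm E i j) v = star_coef (row i E) (row j E) (cf E v).
Proof.
move=> uE ij /(top_subm v uE ij)[tv le]; apply/funext => m.
by rewrite cf_subm // /star_coef !cf_row // min_l.
Qed.

Variables (S : seq 'M[int]_n) (rho sigma : M).
Hypothesis vS : valid R S.
Hypothesis rs : rho != sigma.
Local Notation S' := (star S rho sigma).

(** One formula covers kept cones too: at least one of the two rays is missing from such a cone, so
    the minimum in [star_coef] is zero. *)
Lemma star_cf E' : E' \in S' -> E' \in unitmx /\ exists2 E, E \in S &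
  forall v, top E' v -> top E v /\ cf E' v = star_coef rho sigma (cf E v).
Proof.
move=> /(starP rho sigma E' vS.1)[[ES h]|[E [i [j [ES ei ej h]]]]].
  split; [exact: vS.1|exists E' => // v tv; split=> //].
  apply/funext => m; rewrite /star_coef.
  have [c0|c0] : cf E' v rho = 0 \/ cf E' v sigma = 0.
  - have [[i ei]|nr] := pselect (exists i, row i E' = rho).
      right; apply: cf_notin => j; apply/eqP => ej; exact: (h i j).
    by left; apply: cf_notin => j; apply/eqP => ej; apply: nr; exists j.
  - by rewrite c0 min_l ?mulr0 ?addr0 // cf_ge0.
  - by rewrite c0 min_r ?mulr0 ?addr0 // cf_ge0.
have uE := vS.1 _ ES; have ij := star_neq ei ej rs.
have ji : j != i by rewrite eq_sym.
case: h => ->; [have [-> _] := subm_dual uE ij|have [-> _] := subm_dual uE ji];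
  split=> //; exists E => // v tv.
  by rewrite (subm_cf uE ij tv) ei ej; split=> //; have /(top_subm v uE ij)[] := tv.
by rewrite (subm_cf uE ji tv) star_coefC ei ej; split=> //;
  have /(top_subm v uE ji)[] := tv.
Qed.

(** The new coefficients are the same function of the old ones in every cone, so compatibility is
    inherited. *)
Lemma star_valid : valid R S'.
Proof.
split=> [E /star_cf[]//|E1 E2 /star_cf[_ [F1 FS1 h1]] /star_cf[_ [F2 FS2 h2]] v t1 t2].
have [tF1 ->] := h1 v t1; have [tF2 ->] := h2 v t2.
by rewrite (vS.2 _ _ FS1 FS2 v tF1 tF2).
Qed.

Lemma star_kept E : E \in S -> (forall i j, row i E = rho -> row j E = sigma -> False) ->
  E \in S'.
Proof. by move=> ES h; apply/(starP _ _ _ vS.1); left. Qed.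

Lemma star_subm E i j : E \in S -> row i E = rho -> row j E = sigma ->
  subm E i j \in S' /\ subm E j i \in S'.
Proof.
by move=> ES ei ej; split; apply/(starP _ _ _ vS.1); right; exists E, i, j; split=> //;
  [left|right].
Qed.

(** If the new ray is present, both old rays are adjoined. The second clause expresses minimality: a
    character nonnegative on the old rays and zero on their sum is zero on each. *)
Lemma subm_carrier E i j J : E \in unitmx -> i != j ->
  exists J0, (fcone (subm E i j) J : set V) `<=` fcone E J0 /\
  forall chi, dual_monoid (fcone E J0 : set V) chi ->
    orthogonal_lattice (fcone (subm E i j) J : set V) chi ->
    orthogonal_lattice (fcone E J0 : set V) chi.
Proof.
move=> uE ij; have [uE1 _] := subm_dual uE ij.
exists (if i \in J then J :|: [set i; j] else J)%SET; split.
  apply: fcone_subP => // k kJ; rewrite row_subm; case: eqP => [ki|/eqP ki].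
    rewrite -ki kJ real_ofD -[X in X + _]scale1r -[X in _ + X]scale1r.
    pose F b := if b then real_of (row k E) else real_of (row j E).
    have -> : 1 *: real_of (row k E) + 1 *: real_of (row j E) = \sum_b (1 : R) *: F b
      by rewrite big_bool.
    apply: fcone_comb => [//|[] _ _ /=]; apply: fcone_row => //;
      by rewrite !inE ?ki eqxx ?orbT.
  by apply: fcone_row => //; case: ifP => // _; rewrite inE kJ.
move=> chi /(dual_fcone _ _ _ uE) d /(orth_fcone _ _ _ uE1) h; apply/orth_fcone => // k.
case: ifPn d => [iJ d kJ|iJ d kJ]; last first.
  have := h k kJ; rewrite row_subm; case: eqP => // ki; by rewrite -ki kJ in iJ.
have := h i iJ; rewrite row_subm eqxx ipDr => /eqP.
rewrite paddr_eq0 ?d ?inE ?eqxx ?orbT // => /andP[/eqP h1 /eqP h2].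
have [->//|ki] := eqVneq k i; have [->//|kj] := eqVneq k j.
have kJ' : k \in J by move: kJ; rewrite !inE (negPf ki) (negPf kj) !orbF.
by have := h k kJ'; rewrite row_subm (negPf ki).
Qed.

Lemma star_carrier (s' : set V) : fan S' s' -> exists s, [/\ fan S s, s' `<=` s &
  forall chi, dual_monoid s chi -> orthogonal_lattice s' chi -> orthogonal_lattice s chi].
Proof.
move=> [E' + [J ->]] => /(starP rho sigma E' vS.1)[[ES h]|[E [i [j [ES ei ej h]]]]].
  by exists (fcone E' J); split=> //; exact: fan_fcone.
have uE := vS.1 _ ES; have ij := star_neq ei ej rs.
have ji : j != i by rewrite eq_sym.
case: h => ->; [have [J0 [h1 h2]] := subm_carrier J uE ij|have [J0 [h1 h2]] :=
  subm_carrier J uE ji];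
  by exists (fcone E J0); split=> //; exact: fan_fcone.
Qed.

Lemma star_split s' E i j : fan S' s' -> E \in S -> row i E = rho -> row j E = sigma ->
  s' `<=` top E -> s' `<=` top (subm E i j) \/ s' `<=` top (subm E j i).
Proof.
move=> [E' ES' [J ->]] ES ei ej sE; have uE := vS.1 _ ES.
have ij := star_neq ei ej rs; have ji : j != i by rewrite eq_sym.
have [uS' cS'] := star_valid; have uE' := uS' _ ES'.
(* This interior vector has a nonzero coefficient on every ray of the cone, so by compatibility a
   maximal cone of the new fan containing [v] contains the whole cone. *)
pose v : V := \sum_(k in J) (1 : R) *: real_of (row k E').
have vs : fcone E' J v by apply: fcone_comb => // k kJ _; exact: fcone_row.
have tE := sE _ vs.
have key E1 : E1 \in S' -> top E1 v -> fcone E' J `<=` top E1.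
  move=> ES1 tv; apply: fcone_subP => // k kJ; have uE1 := uS' _ ES1.
  have ce := cS' _ _ ES' ES1 v (fcone_sub (finset.subsetT _) vs) tv.
  have : cf E1 v (row k E') != 0.
    rewrite -ce cf_row // crd_sum (bigD1 k) //= scale1r crd_row // eqxx big1 ?addr0
      ?oner_eq0 //.
    by move=> l /andP[_ lk]; rewrite scale1r crd_row // (negPf lk).
  by move=> /(cf_neq0 uE1)[k' [<- _]]; apply: fcone_row.
have [E1S E2S] := star_subm ES ei ej.
have [le|/ltW le] := leP (crd E v i) (crd E v j); [left|right]; apply: key => //;
  apply/top_subm => //.
Qed.

End StarValid.

(** * Star subdivision is a blowup *)

Section Ideals.
Variables (R : realType) (n : nat).
Local Notation C := R[i].
Local Notation M := 'rV[int]_n.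
Local Notation V := 'rV[R]_n.
Local Notation real_of := (real_of R).
Local Notation top E := (@top R n E).
Implicit Types (E : 'M[int]_n) (chi psi : M) (J K : {set 'I_n}).
Variable S : seq 'M[int]_n.
Hypothesis vS : valid R S.
Local Notation D := (@fan R n S).
Local Notation X := (toric_variety D).
Variables (W : fspace C) (f : W -> X).
Hypothesis mf : fmorphism f.

Lemma pull_reg (U : set X) s : open U -> reg U s ->
  open (f @^-1` U) /\ reg (f @^-1` U) (s \o f).
Proof.
by move=> oU rs; split; [have /continuousP := mf.1; apply|exact: mf.2].
Qed.

Lemma pull_top E : E \in S -> open (f @^-1` (uchart (top E))).
Proof.
move=> ES; have oU := uchart_top_open vS ES.
by have [] := pull_reg oU (reg_cst 0 oU).
Qed.

Lemma pull_coord E k : E \in S ->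
  reg (f @^-1` (uchart (top E))) (fun w => kval (f w) (dualv E k)).
Proof.
move=> ES; have oU := uchart_top_open vS ES.
by have [] := pull_reg oU (coord_reg vS k ES).
Qed.

Lemma oclosureC rho sigma : @oclosure R n S rho sigma = oclosure sigma rho.
Proof. by apply/seteqP; split=> p []. Qed.

Lemma vanishing_coord E i j : E \in S ->
  vanishing (oclosure (row i E) (row j E)) (uchart (top E)) (fun p : X => kval p (dualv
    E i)).
Proof.
move=> ES; split; first exact: coord_reg.
by move=> p pE /(oclosure_top vS i j ES pE)[].
Qed.

Lemma ideal_of_coord E i j (N : set W) w a g : E \in S -> open N -> N w -> reg N a ->
  N `<=` f @^-1` (uchart (top E)) -> (forall v,
    N v -> g v = a v * kval (f v) (dualv E i)) ->
  in_inverse_image_ideal f (oclosure (row i E) (row j E)) w g.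
Proof.
move=> ES oN Nw ra Nf gE; have oU := uchart_top_open vS ES.
exists N, (uchart (top E)), 1%N, (fun=> a), (fun=> fun p : X => kval p (dualv E i)).
split=> // [|v Nv]; first by move=> _; exact: vanishing_coord.
by rewrite big_ord_recl big_ord0 addr0 gE.
Qed.

Lemma ideal_coords E i j w g : E \in S -> kcone (f w) `<=` top E ->
  in_inverse_image_ideal f (oclosure (row i E) (row j E)) w g ->
  exists (N : set W) b1 b2, [/\ open N, N w, N `<=` f @^-1` (uchart (top E)),
    reg N b1 /\ reg N b2 & forall v, N v ->
    g v = b1 v * kval (f v) (dualv E i) + b2 v * kval (f v) (dualv E j)].
Proof.
move=> ES wE [V0 [U [r [a [s [[oV0 V0w oU V0U] ra vs gE]]]]]].
(* Replacing [g] by the sum itself allows induction on the number of sections, each expanded by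
   [vanishing_ideal]. *)
suff [N [b1 [b2 [oN Nw NV [r1 r2] h]]]] : exists (N : set W) b1 b2, [/\ open N, N w,
    N `<=` V0 `&` f @^-1` (uchart (top E)),
    reg N b1 /\ reg N b2 & forall v, N v -> \sum_(l < r) a l v * s l (f v) =
      b1 v * kval (f v) (dualv E i) + b2 v * kval (f v) (dualv E j)].
  exists N, b1, b2; split=> // v Nv; first by have [] := NV v Nv.
  by rewrite gE ?h //; have [] := NV v Nv.
have oVE : open (V0 `&` f @^-1` (uchart (top E))) by apply: openI => //; exact: pull_top.
elim: r a s ra vs {gE} => [|r IH] a s ra vs.
  exists (V0 `&` f @^-1` (uchart (top E))), (fun=> 0), (fun=> 0); split=> //.
    by split; exact: reg_cst.
  by move=> v _; rewrite big_ord0 !mul0r addr0.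
have [N [b1 [b2 [oN Nw NV [r1 r2] h]]]] := IH (fun l => a (widen_ord (leqnSn r) l))
  (fun l => s (widen_ord (leqnSn r) l)) (fun l => ra _) (fun l => vs _).
have [U' [al [be [oU' U'w U'U [ral rbe] sE]]]] :=
  vanishing_ideal vS ES oU (V0U _ V0w) wE (vs ord_max).
have [oP rP] := pull_reg oU' ral; have [_ rQ] := pull_reg oU' rbe.
have oNP : open (N `&` f @^-1` U') by exact: openI.
have rN b : reg N b -> reg (N `&` f @^-1` U') b.
  by move=> rb; apply: reg_restr rb => //; move=> y [].
have rU b : reg (f @^-1` U') b -> reg (N `&` f @^-1` U') b.
  by move=> rb; apply: reg_restr rb => //; move=> y [].
have rA : reg (N `&` f @^-1` U') (a ord_max).
  by apply: reg_restr (ra ord_max) => //; move=> y [/NV[]].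
exists (N `&` f @^-1` U'), (fun v => b1 v + a ord_max v * al (f v)),
  (fun v => b2 v + a ord_max v * be (f v)); split=> //.
- by move=> v [/NV].
- split; apply: reg_add => //; try exact: rN; apply: reg_mul => //; exact: rU.
- move=> v [Nv U'v]; rewrite big_ord_recr h // sE //=; ring.
Qed.

Lemma ideal_split E i j w : E \in S -> kcone (f w) `<=` top E ->
  inverse_image_invertible f (oclosure (row i E) (row j E)) ->
  exists (N : set W) h a1 a2 b1 b2,
   [/\ [/\ open N, N w & N `<=` f @^-1` (uchart (top E))],
     [/\ reg N a1, reg N a2, reg N b1 & reg N b2], nonzerodivisor N h,
     forall v, N v -> kval (f v) (dualv E i) = a1 v * h v /\ kval (f v) (dualv E j) =
       a2 v * h v &
     forall v, N v -> h v = b1 v * kval (f v) (dualv E i) + b2 v * kval (f v) (dualv E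
       j) /\
        b1 v * a1 v + b2 v * a2 v = 1].
Proof.
move=> ES wE /(_ w)[V0 [h [oV0 V0w rh nzh idh]]].
have oE := pull_top ES.
have pr k : (k = i \/ k = j) -> exists (N : set W) a, [/\ open N, N w, reg N a &
    forall v, N v -> kval (f v) (dualv E k) = a v * h v].
  move=> kij.
  have oI : open (V0 `&` f @^-1` (uchart (top E))) by exact: openI.
  have rk : reg (V0 `&` f @^-1` (uchart (top E))) (fun v => kval (f v) (dualv E k)).
    by apply: reg_restr (pull_coord k ES) => //; move=> y [].
  have /idh := V0w => /(_ _ _ oI (conj V0w wE) rk)[+ _].
  case=> [|N [a [oN Nw ra ha]]]; last by exists N, a.
  case: kij => ->; last rewrite oclosureC;
    apply: (@ideal_of_coord E _ _ (f @^-1` (uchart (top E))) w (fun=> 1)) => //;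
    by [exact: reg_cst|move=> v _; rewrite mul1r].
have [N1 [a1 [oN1 N1w ra1 h1]]] := pr i (or_introl erefl).
have [N2 [a2 [oN2 N2w ra2 h2]]] := pr j (or_intror erefl).
have : in_inverse_image_ideal f (oclosure (row i E) (row j E)) w h.
  have [_ ih] := idh w V0w V0 h oV0 V0w rh; apply: ih.
  exists V0, (fun=> 1); split=> //; first exact: reg_cst.
  by move=> v _; rewrite mul1r.
move=> /(ideal_coords ES wE)[N3 [b1 [b2 [oN3 N3w N3E [rb1 rb2] h3]]]].
pose N := V0 `&` (N1 `&` (N2 `&` N3)).
have oN : open N by do 3?apply: openI.
exists N, h, a1, a2, b1, b2.
have rN U b : open U -> N `<=` U -> reg U b -> reg N b.
  by move=> oU NU rb; apply: reg_restr rb.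
have S1 : N `<=` N1 by move=> y [_ []].
have S2 : N `<=` N2 by move=> y [_ [_ []]].
have S3 : N `<=` N3 by move=> y [_ [_ []]].
have S0 : N `<=` V0 by move=> y [].
have ra1' := rN _ _ oN1 S1 ra1; have ra2' := rN _ _ oN2 S2 ra2.
have rb1' := rN _ _ oN3 S3 rb1; have rb2' := rN _ _ oN3 S3 rb2.
have nzN : nonzerodivisor N h by move=> V' a oV' V'N; apply: nzh => //;
  exact: subset_trans V'N S0.
split=> //.
- by split=> // v /S3/N3E.
- by move=> v Nv; split; [apply/h1/S1|apply/h2/S2].
(* Substituting the multiples of [h] into its own expression gives (b1 a1 + b2 a2 - 1) h = 0, and
   [h] cancels. *)
have e1 : forall v, N v -> b1 v * a1 v + b2 v * a2 v - 1 = 0.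
  apply: nzN => //.
    by apply: reg_sub => //; [apply: reg_add => //; exact: reg_mul|exact: reg_cst].
  move=> v Nv; have hv := h3 v (S3 _ Nv).
  have i1 := h1 v (S1 _ Nv); have i2 := h2 v (S2 _ Nv).
  rewrite i1 i2 in hv; rewrite mulrBl mul1r {2}hv; ring.
move=> v Nv; split; first by apply/h3/S3.
by apply/eqP; rewrite -subr_eq0; apply/eqP/e1.
Qed.

End Ideals.

Section Blowup.
Variables (R : realType) (n : nat).
Local Notation C := R[i].
Local Notation M := 'rV[int]_n.
Local Notation V := 'rV[R]_n.
Local Notation real_of := (real_of R).
Local Notation top E := (@top R n E).
Implicit Types (E : 'M[int]_n) (chi psi : M) (J K : {set 'I_n}).
Variables (S : seq 'M[int]_n) (rho sigma : M).
Hypothesis vS : valid R S.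
Hypothesis rs : rho != sigma.
Local Notation S' := (star S rho sigma).
Local Notation X := (toric_variety (@fan R n S)).
Local Notation X' := (toric_variety (@fan R n S')).
Let vS' : valid R S' := star_valid vS rs.

(* The smallest cone of the original fan containing [s']. *)
Definition carrier (s' : set V) : set V := xget setT [set s | [/\ fan S s, s' `<=` s &
  forall chi, dual_monoid s chi -> orthogonal_lattice s' chi -> orthogonal_lattice s
    chi]].

Lemma carrierP s' : fan S' s' -> [/\ fan S (carrier s'), s' `<=` carrier s' &
  forall chi, dual_monoid (carrier s') chi -> orthogonal_lattice s' chi ->
    orthogonal_lattice (carrier s') chi].
Proof.
move=> /(star_carrier vS rs) h; rewrite /carrier.
by have := @xgetPex _ setT _ h.
Qed.

(** The character separating [t] from the carrier vanishes on [s'], hence by minimality on the whole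
    carrier, which therefore lies in [t]. *)
Lemma carrier_sub s' t : fan S' s' -> fan S t -> s' `<=` t -> carrier s' `<=` t.
Proof.
move=> Ds Dt st; have [Dc sc h] := carrierP Ds.
have [psi [d hpsi _]] := fan_sep vS Dt Dc.
move=> v cv; apply/(hpsi v cv); apply: (h _ d) => // u su.
by apply/(hpsi u (sc _ su)); exact: st.
Qed.

Section BlPoint.
Variable q : kpoint (@fan R n S').
Local Notation c := (carrier (kcone q)).

(** Truncated because a character orthogonal to [kcone q] need not be orthogonal to the carrier, for
    instance the difference of the two dual vectors when [kcone q] is the new ray. *)
Definition blowdown_val chi : C := if `[< dual_monoid c chi >] then kval q chi else 0.

Lemma blowdown_valE chi : dual_monoid c chi -> blowdown_val chi = kval q chi.
Proof. by move=> d; rewrite /blowdown_val asboolT. Qed.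

Let dq chi : dual_monoid c chi -> dual_monoid (kcone q) chi.
Proof. by have [_ sc _] := carrierP (kcone_in q); move=> h v /sc/h. Qed.

Lemma blowdown_val0 : blowdown_val 0 = 1.
Proof. by rewrite blowdown_valE ?kval0 // => v _;
  rewrite (_ : Defs.real_of R 0 = 0) ?pairing0l //; apply/rowP => i; rewrite !mxE. Qed.

Lemma blowdown_valD chi psi : dual_monoid c chi -> dual_monoid c psi ->
  blowdown_val (chi + psi) = blowdown_val chi * blowdown_val psi.
Proof.
move=> d d'; rewrite !blowdown_valE // ?kvalD //; try exact: dq.
by move=> v cv; rewrite real_ofD pairingDl addr_ge0 ?d ?d'.
Qed.

Lemma blowdown_val_neq0 chi : blowdown_val chi != 0 <-> orthogonal_lattice c chi.
Proof.
have [_ sc h] := carrierP (kcone_in q); split=> [|o].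
  rewrite /blowdown_val; case: asboolP => [d|_]; last by rewrite eqxx.
  by move=> /kval_neq0; exact: h.
rewrite blowdown_valE; first by apply/kval_neq0 => v /sc/o.
by move=> v /o ->.
Qed.

Let cin : fan S c. Proof. by have [] := carrierP (kcone_in q). Qed.

Definition blowdown_pt : kpoint (@fan R n S) :=
  KPoint cin blowdown_val0 blowdown_valD blowdown_val_neq0.

End BlPoint.

Definition blowdown : X' -> X := blowdown_pt.

Lemma blowdown_kcone (q : X') : kcone q `<=` kcone (blowdown q).
Proof. by have [] := carrierP (kcone_in q). Qed.

Lemma blowdown_top (q : X') E : E \in S -> kcone q `<=` top E -> kcone (blowdown q)
  `<=` top E.
Proof. by move=> ES; apply: carrier_sub; [exact: kcone_in|exact: fan_top]. Qed.

Lemma blowdown_coord (q : X') E k : E \in S -> kcone q `<=` top E ->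
  kval (blowdown q) (dualv E k) = kval q (dualv E k).
Proof.
move=> ES qE; rewrite /= blowdown_valE // => v /(blowdown_top ES qE).
exact: (dual_top vS).
Qed.

Lemma blowdown_equivariant : equivariant blowdown.
Proof.
move=> t q; apply: kpoint_eq => //=; apply/funext => chi.
by rewrite /blowdown_val /kact_val /= /blowdown_val; case: ifP => _; rewrite ?mulr0.
Qed.

Lemma blowdown_morphism : fmorphism blowdown.
Proof.
apply/fmorphismP => q; have [E' ES' qE] := kcone_in_top q.
have [_ [E ES h]] := star_cf vS rs ES'.
have tt : top E' `<=` top E by move=> v /h[].
have oU := uchart_top_open vS' ES'.
apply: (@mor_at_top _ _ _ vS _ blowdown (uchart (top E')) E ES) => //.
  by move=> p pE; apply: blowdown_top => //; exact: subset_trans tt.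
move=> j; apply: (@reg_ext _ _ _ (fun p : X' => kval p (dualv E j))).
  apply: kval_reg => //; first exact: fan_top.
  by move=> v /tt; exact: (dual_top vS).
by move=> p pE; rewrite blowdown_coord //; exact: subset_trans tt.
Qed.

Lemma subm_top E i j : E \in S -> i != j -> top (subm E i j) `<=` top E.
Proof. by move=> ES ij v /(top_subm v (vS.1 _ ES) ij)[]. Qed.

(** The old dual vector [j] is the sum of the new dual vectors [i] and [j], which gives the familiar
    blowup chart sending z_i, z_j to z_i, z_i z_j. *)
Lemma subm_coord (q : X') E i j k : E \in S -> i != j ->
  kcone q `<=` top (subm E i j) ->
  kval (blowdown q) (dualv E k) = if k == j
    then kval q (dualv (subm E i j) j) * kval q (dualv (subm E i j) i)
    else kval q (dualv (subm E i j) k).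
Proof.
move=> ES ij qE; have uE := vS.1 _ ES; have [uE1 dE] := subm_dual uE ij.
rewrite blowdown_coord //; last exact: subset_trans (subm_top ES ij).
case: eqP => [->|/eqP kj]; last by rewrite dE (negPf kj).
have dd k' : dual_monoid (kcone q) (dualv (subm E i j) k').
  have dt : dual_monoid (top (subm E i j)) (dualv (subm E i j) k').
    by apply/dual_fcone => // l _; rewrite ip_dual // ler0n.
  by move=> v /qE/dt.
by rewrite -kvalD ?dd // !dE eqxx (negPf ij) subrK.
Qed.

(** The exceptional divisor has equation z_i on this chart: it divides the pullbacks of both
    coordinates and is itself the pullback of the first. *)
Lemma blowdown_invertible_subm (q : X') E i j : E \in S -> i != j ->
  subm E i j \in S' -> kcone q `<=` top (subm E i j) ->
  exists (N : set X') (h : X' -> C), [/\ open N, N q, reg N h, nonzerodivisor N h &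
      forall v, N v -> forall V' g, open V' -> V' v -> reg V' g ->
        (in_inverse_image_ideal blowdown (oclosure (row i E) (row j E)) v g
          <-> in_principal_ideal h v g)].
Proof.
move=> ES ij E1S qE; have uE := vS.1 _ ES; have [uE1 dE] := subm_dual uE ij.
have oU := uchart_top_open vS' E1S.
exists (uchart (top (subm E i j))), (fun p => kval p (dualv (subm E i j) i)); split=> //.
- exact: coord_reg.
- exact: coord_nonzerodivisor.
move=> v vE V' g oV' V'v rg; split.
  have vE' := blowdown_top ES (subset_trans vE (subm_top ES ij)).
  move=> /(ideal_coords vS blowdown_morphism ES vE')[N [b1 [b2 [oN Nv NE [r1 r2] hg]]]].
  have oI : open (N `&` uchart (top (subm E i j))) by exact: openI.
  exists (N `&` uchart (top (subm E i j))),
     (fun p => b1 p + b2 p * kval p (dualv (subm E i j) j)); split=> //.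
    apply: reg_add => //; first by apply: reg_restr r1 => //; move=> y [].
    apply: reg_mul => //; first by apply: reg_restr r2 => //; move=> y [].
    by apply: reg_restr (coord_reg vS' j E1S) => //; move=> y [].
  move=> p [Np pE]; rewrite hg // !(subm_coord _ ES ij pE) (negPf ij) eqxx; ring.
move=> [N [a [oN Nv ra gE]]].
have oI : open (N `&` uchart (top (subm E i j))) by exact: openI.
apply: (@ideal_of_coord _ _ _ vS _ blowdown E i j (N `&` uchart (top (subm E i j))) v a
  g ES oI) => //.
- by apply: reg_restr ra => //; move=> y [].
- by move=> y [_ yE]; apply: blowdown_top => //; apply: subset_trans (subm_top ES ij).
- by move=> p [Np pE]; rewrite gE // (subm_coord _ ES ij pE) (negPf ij).
Qed.

Variables (E0 : 'M[int]_n) (i0 j0 : 'I_n).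
Hypotheses (E0S : E0 \in S) (ei0 : row i0 E0 = rho) (ej0 : row j0 E0 = sigma).
Local Notation Z := (@oclosure R n S rho sigma).

Lemma Z_disjoint E (p : X) : E \in S ->
  (forall i j, row i E = rho -> row j E = sigma -> False) -> kcone p `<=` top E -> ~ Z p.
Proof.
move=> ES h pE [/pE]; rewrite -ei0 => /(ray_in vS E0S ES)[i _ ei] /pE.
rewrite -ej0 => /(ray_in vS E0S ES)[j _ ej].
by apply: (h i j); rewrite ?ei ?ej.
Qed.

Lemma blowdown_invertible : inverse_image_invertible blowdown Z.
Proof.
move=> q; have [E' ES' qE] := kcone_in_top q.
have := ES' => /(starP rho sigma E' vS.1)[[ES h]|[E [i [j [ES ei ej h]]]]]; last first.
  have ij := star_neq ei ej rs; have ji : j != i by rewrite eq_sym.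
  have -> : Z = oclosure (row i E) (row j E) by rewrite ei ej.
  by case: h => e; rewrite e in ES' qE; last rewrite oclosureC;
    exact: blowdown_invertible_subm.
have oU := uchart_top_open vS' ES'.
exists (uchart (top E')), (fun=> 1); split=> //.
- exact: reg_cst.
- by move=> V' a oV' _ _ h' v V'v; rewrite -[a v]mulr1 h'.
move=> v vE V' g oV' V'v rg; split=> _.
  by exists V', g; split=> // y _; rewrite mulr1.
have oX := uchart_top_open vS ES.
have oI : open (V' `&` uchart (top E')) by exact: openI.
(* This chart does not meet [Z], so the constant 1 belongs to its ideal. *)
exists (V' `&` uchart (top E')), (uchart (top E')), 1%N, (fun=> g), (fun=> fun=> 1);
  split=> //.
- by split=> // y [_ yE]; apply: blowdown_top.
- by move=> _; apply: reg_restr rg => //; move=> y [].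
- move=> _; split; first exact: reg_cst.
  by move=> x xE /(Z_disjoint ES h xE).
- by move=> y _; rewrite big_ord_recl big_ord0 addr0 mulr1.
Qed.

Section Universal.
Variables (W : fspace C) (f : W -> X).
Hypotheses (mf : fmorphism f) (fi : inverse_image_invertible f Z).

Definition lift_at (g : W -> X') v := blowdown (g v) = f v /\ mor_at g v.

Lemma lift_subm w E i j (N : set W) (h a1 a2 : W -> C) : E \in S -> i != j ->
  subm E i j \in S' -> open N -> N w -> N `<=` f @^-1` (uchart (top E)) ->
  reg N a1 -> reg N a2 ->
  (forall v, N v -> kval (f v) (dualv E i) = a1 v * h v /\ kval (f v) (dualv E j) = a2
    v * h v) ->
  a1 w != 0 -> exists (N' : set W) g, [/\ open N', N' w & forall v, N' v -> lift_at g v].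
Proof.
move=> ES ij E1S oN Nw NE r1 r2 hE a1w; have uE := vS.1 _ ES.
have oN' := reg_open oN r1; set N' := [set x | _] in oN'.
have r1' : reg N' a1 by apply: reg_restr r1 => //; move=> y [].
have r2' : reg N' a2 by apply: reg_restr r2 => //; move=> y [].
(* Coordinate [j] stands for z_j / z_i with [h] cancelled, which remains meaningful at the zeros of
   [h]. *)
pose g v : X' := pt vS' E1S (fun k => if k == j then a2 v / a1 v else kval (f v) (dualv
  E k)).
have gE v : kcone (g v) `<=` top (subm E i j) by exact: pt_top.
exists N', g; split=> // v N'v; split.
  have [Nv a1v] := N'v.
  apply: (kpoint_chart_eq vS ES); first by apply: blowdown_top => //;
    exact: subset_trans (subm_top ES ij).
    exact: NE.
  move=> k; rewrite (subm_coord _ ES ij (gE v)) !pt_coord eqxx (negPf ij).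
  case: eqP => [->|//]; have [-> ->] := hE v Nv; by rewrite mulrA mulfVK.
apply: (@mor_at_top _ _ _ vS' W g N' _ E1S) => // [y _|k]; first exact: gE.
apply: (@reg_ext _ _ _ (fun v => if k == j then a2 v / a1 v else kval (f v) (dualv E
  k))); last first.
  by move=> y _; rewrite pt_coord.
case: eqP => _; first by apply: reg_div => //; move=> y [].
by apply: reg_restr (pull_coord vS mf k ES) => //;
  [exact: (pull_top vS)|by move=> y [/NE]].
Qed.

Lemma lift_exists w : exists (N : set W) g, [/\ open N, N w & forall v,
  N v -> lift_at g v].
Proof.
have [E ES wE] := kcone_in_top (f w).
have oE := pull_top vS mf ES.
have [[i [j [ei ej]]]|nij] := pselect (exists i j, row i E = rho /\ row j E = sigma).
  have ij := star_neq ei ej rs; have ji : j != i by rewrite eq_sym.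
  have [E1S E2S] := star_subm vS ES ei ej.
  have fi' : inverse_image_invertible f (oclosure (row i E) (row j E)) by rewrite ei ej.
  have [N [h [a1 [a2 [b1 [b2 [[oN Nw NE] [ra1 ra2 _ _] _ hE ab]]]]]]] :=
    ideal_split vS mf ES wE fi'.
  have [a1w|a1w] := eqVneq (a1 w) 0;
    last exact: (lift_subm ES ij E1S oN Nw NE ra1 ra2 hE a1w).
  apply: (lift_subm ES ji E2S oN Nw NE ra2 ra1 (h := h)).
    by move=> v /hE[].
  have [_] := ab w Nw; rewrite a1w mulr0 add0r => e; apply/eqP => a2w.
  by move/eqP: e; rewrite a2w mulr0 eq_sym oner_eq0.
have ES' : E \in S' by apply: (star_kept vS ES) => i j ei ej; apply: nij; exists i, j.
pose g v : X' := pt vS' ES' (fun k => kval (f v) (dualv E k)).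
have gE v : kcone (g v) `<=` top E by exact: pt_top.
exists (f @^-1` (uchart (top E))), g; split=> // v vE; split.
  apply: (kpoint_chart_eq vS ES) => //; first exact: blowdown_top.
  by move=> k; rewrite blowdown_coord // pt_coord.
apply: (@mor_at_top _ _ _ vS' W g _ _ ES') vE => // [y _|k]; first exact: gE.
by apply: (reg_ext (pull_coord vS mf k ES)) => y _; rewrite pt_coord.
Qed.

Section Unique.
Variables (N : set W) (g g' : W -> X') (v : W) (E : 'M[int]_n) (i j : 'I_n).
Hypotheses (oN : open N) (Nv : N v)
  (lg : forall u, N u -> lift_at g u) (lg' : forall u, N u -> lift_at g' u).
Hypotheses (ES : E \in S) (vE : kcone (f v) `<=` top E) (ij : i != j)
  (fi' : inverse_image_invertible f (oclosure (row i E) (row j E))).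

Lemma lift_uniq_same : subm E i j \in S' -> kcone (g v) `<=` top (subm E i j) ->
  kcone (g' v) `<=` top (subm E i j) -> g v = g' v.
Proof.
move=> E1S gE gE'; have uE := vS.1 _ ES.
have oU := uchart_top_open vS' E1S; have rU := coord_reg vS' j E1S.
have [N1 [oN1 N1v N1E rN1]] := (lg Nv).2 _ _ oU gE rU.
have [N2 [oN2 N2v N2E rN2]] := (lg' Nv).2 _ _ oU gE' rU.
have [N3 [h [a1 [a2 [b1 [b2 [[oN3 N3v _] _ nz _ ab]]]]]]] := ideal_split vS mf ES vE fi'.
pose P := N `&` (N1 `&` (N2 `&` N3)).
have oP : open P by do 3?apply: openI.
(* For the two values y and y', y z_i = z_j = y' z_i. Thus y - y' annihilates z_i, then z_j = y z_i,
   then their combination [h]. *)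
have d0 : forall u, P u -> kval (g u) (dualv (subm E i j) j) - kval (g' u) (dualv (subm
  E i j) j) = 0.
  apply: nz => //; first by move=> u [_ [_ []]].
    apply: reg_sub => //; first by apply: reg_restr rN1 => //; move=> u [_ []].
    by apply: reg_restr rN2 => //; move=> u [_ [_ []]].
  move=> u [Nu [N1u [N2u N3u]]].
  have [-> _] := ab u N3u.
  have := subm_coord j ES ij (N1E _ N1u); have := subm_coord j ES ij (N2E _ N2u).
  have := subm_coord i ES ij (N1E _ N1u); have := subm_coord i ES ij (N2E _ N2u).
  rewrite (lg Nu).1 (lg' Nu).1 eqxx (negPf ij) => <- <-.
  set y := kval (g u) _; set y' := kval (g' u) _; set b := kval _ _; set a := kval _ _.
  move=> e1 e2; have -> : (y - y') * (b1 u * a + b2 u * b) =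
    b1 u * (y * a - y' * a) + b2 u * b * (y - y') by ring.
  rewrite -e1 -e2 subrr mulr0 add0r {1}e2.
  have -> : b2 u * (y * a) * (y - y') = b2 u * y * (y * a - y' * a) by ring.
  by rewrite -e1 -e2 subrr mulr0.
apply: (kpoint_chart_eq vS' E1S) => // k; have [->|kj] := eqVneq k j.
  by apply/eqP; rewrite -subr_eq0; apply/eqP/d0.
have := subm_coord k ES ij gE; have := subm_coord k ES ij gE'.
by rewrite (lg Nv).1 (lg' Nv).1 (negPf kj) => <- <-.
Qed.

(** One lift records z_j / z_i and the other z_i / z_j. Their product is 1, since it is so after
    multiplication by [h]; the first is thus nonzero at [v], and this puts [g v] in the overlap of
    the two charts. *)
Lemma lift_uniq_mixed : subm E i j \in S' -> subm E j i \in S' ->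
  kcone (g v) `<=` top (subm E i j) -> kcone (g' v) `<=` top (subm E j i) ->
  kcone (g v) `<=` top (subm E j i).
Proof.
move=> E1S E2S gE gE'; have uE := vS.1 _ ES; have ji : j != i by rewrite eq_sym.
have oU := uchart_top_open vS' E1S; have rU := coord_reg vS' j E1S.
have oU2 := uchart_top_open vS' E2S; have rU2 := coord_reg vS' i E2S.
have [N1 [oN1 N1v N1E rN1]] := (lg Nv).2 _ _ oU gE rU.
have [N2 [oN2 N2v N2E rN2]] := (lg' Nv).2 _ _ oU2 gE' rU2.
have [N3 [h [a1 [a2 [b1 [b2 [[oN3 N3v _] _ nz _ ab]]]]]]] := ideal_split vS mf ES vE fi'.
pose P := N `&` (N1 `&` (N2 `&` N3)).
have oP : open P by do 3?apply: openI.
have d0 : forall u, P u -> kval (g u) (dualv (subm E i j) j) * kval (g' u) (dualv (subm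
  E j i) i) - 1 = 0.
  apply: nz => //; first by move=> u [_ [_ []]].
    apply: reg_sub => //; last exact: reg_cst.
    apply: reg_mul => //; first by apply: reg_restr rN1 => //; move=> u [_ []].
    by apply: reg_restr rN2 => //; move=> u [_ [_ []]].
  move=> u [Nu [N1u [N2u N3u]]].
  have [-> _] := ab u N3u.
  have := subm_coord j ES ij (N1E _ N1u); have := subm_coord i ES ji (N2E _ N2u).
  have := subm_coord i ES ij (N1E _ N1u); have := subm_coord j ES ji (N2E _ N2u).
  rewrite (lg Nu).1 (lg' Nu).1 !eqxx (negPf ij) (negPf ji) => <- <-.
  set y := kval (g u) _; set y' := kval (g' u) _; set b := kval _ _; set a := kval _ _.
  move=> e1 e2; have -> : (y * y' - 1) * (b1 u * b + b2 u * a) =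
    b1 u * (y' * (y * b) - b) + b2 u * (y * (y' * a) - a) by ring.
  by rewrite -e1 -e2 -e1 !subrr !mulr0 addr0.
have /kval_neq0 o : kval (g v) (dualv (subm E i j) j) != 0.
  apply/eqP => y0; have /eqP := d0 v (conj Nv (conj N1v (conj N2v N3v))).
  by rewrite y0 mul0r sub0r oppr_eq0 oner_eq0.
move=> u gu; have /(top_subm _ uE ij)[uT _] := gE _ gu.
apply/top_subm => //; split=> //.
have := o _ gu; rewrite (subm_dual uE ij).2 eqxx real_ofB -scaleN1r pairingDl pairingZl
  mulN1r.
by move/eqP; rewrite subr_eq0 => /eqP e; rewrite /crd e.
Qed.

End Unique.

Lemma lift_uniq (N : set W) g g' v : open N -> N v ->
  (forall u, N u -> lift_at g u) -> (forall u, N u -> lift_at g' u) -> g v = g' v.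
Proof.
move=> oN Nv lg lg'; have [E ES vE] := kcone_in_top (f v).
have gE : kcone (g v) `<=` top E.
  by apply: subset_trans vE; rewrite -(lg _ Nv).1; exact: blowdown_kcone.
have gE' : kcone (g' v) `<=` top E.
  by apply: subset_trans vE; rewrite -(lg' _ Nv).1; exact: blowdown_kcone.
have [[i [j [ei ej]]]|nij] := pselect (exists i j, row i E = rho /\ row j E = sigma).
  have ij := star_neq ei ej rs; have ji : j != i by rewrite eq_sym.
  have [E1S E2S] := star_subm vS ES ei ej.
  have fi' : inverse_image_invertible f (oclosure (row i E) (row j E)) by rewrite ei ej.
  have fi'' : inverse_image_invertible f (oclosure (row j E) (row i E)) by rewrite
    oclosureC.
  have := star_split vS rs (kcone_in (g v)) ES ei ej gE.
  have := star_split vS rs (kcone_in (g' v)) ES ei ej gE'.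
  case=> h' [] h.
  - exact: (lift_uniq_same oN Nv lg lg' ES vE ij fi').
  - apply: (lift_uniq_same oN Nv lg lg' ES vE ij fi') => //.
    exact: (lift_uniq_mixed oN Nv lg lg' ES vE ji fi'').
  - apply: (lift_uniq_same oN Nv lg lg' ES vE ji fi'') => //.
    exact: (lift_uniq_mixed oN Nv lg lg' ES vE ij fi').
  - exact: (lift_uniq_same oN Nv lg lg' ES vE ji fi'').
have ES' : E \in S' by apply: (star_kept vS ES) => i j ei ej; apply: nij; exists i, j.
apply: (kpoint_chart_eq vS' ES') => // k.
by rewrite -!(blowdown_coord _ ES) // (lg _ Nv).1 (lg' _ Nv).1.
Qed.

Lemma blowdown_universal : exists! g : W -> X', fmorphism g /\ forall w,
  blowdown (g w) = f w.
Proof.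
have hex w : exists q : set W * (W -> X'),
    [/\ open q.1, q.1 w & forall v, q.1 v -> lift_at q.2 v].
  by have [N [g h]] := lift_exists w; exists (N, g).
have [G hG] := choice hex.
(* Local lifts agree on common domains, so this diagonal choice coincides near each point with one
   of them. *)
pose g w := (G w).2 w.
have ge w v : (G w).1 v -> (G w).2 v = g v.
  move=> wv; have [p1 _ h1] := hG w; have [p2 vv h2] := hG v.
  apply: (@lift_uniq ((G w).1 `&` (G v).1) (G w).2 (G v).2).
  - exact: openI.
  - by [].
  - by move=> u [+ _] => /h1.
  - by move=> u [_] /h2.
exists g; split; first split.
- apply/fmorphismP => w; have [p1 ww h1] := hG w.
  by apply: (@mor_at_ext _ _ _ (G w).2 g (G w).1 w p1 ww (ge w)); exact: (h1 w ww).2.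
- by move=> w; have [p1 ww h1] := hG w; rewrite (h1 w ww).1.
move=> g' [/fmorphismP mg' hg']; apply/funext => w; have [p1 ww h1] := hG w.
rewrite -(ge w w ww).
by apply: (@lift_uniq (G w).1) => //.
Qed.

End Universal.

Lemma blowdown_is_blowup : is_blowup blowdown Z.
Proof.
split; [exact: blowdown_morphism|exact: blowdown_invertible|].
by move=> W f mf fi; exact: blowdown_universal.
Qed.

Lemma star_blowup (Y : tspace C n) : orbit_blowups Y X -> orbit_blowups Y X'.
Proof.
move=> bY; have ij := star_neq ei0 ej0 rs.
(* The distinguished point of the orbit attached to the cone on [rho] and [sigma]. *)
pose x : X := pt vS E0S (fun k => if k \in [set i0; j0]%SET then 0 else 1).
have xE : kcone x = fcone E0 [set i0; j0]%SET.
  congr fcone; apply/setP => k; rewrite [LHS]inE; case: ifP => _;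
    by rewrite ?eqxx ?oner_eq0.
apply: (@orbit_blowups_step _ _ Y X X' blowdown x bY (orbit_codim2 vS E0S ij xE)
  blowdown_equivariant).
by rewrite (orbit_closure vS E0S xE) ei0 ej0; exact: blowdown_is_blowup.
Qed.

End Blowup.

(** * The fan of (P^1)^n *)

Section P1Charts.
Variables (k : fieldType) (n : nat).
Local Notation P1 := (glued_space (p1n_atlas k n)).
Implicit Types (A : {set 'I_n}).

Definition p1dom A : set P1 := @dom _ (p1n_atlas k n) A.

Lemma p1_dom_coord A A' (z : P1) i : p1dom A z -> p1dom A' z ->
  (i \in A) != (i \in A') -> p1_coord (i \in A') (z i) != 0 /\
   p1_coord (i \in A) (z i) = (p1_coord (i \in A') (z i))^-1.
Proof.
move=> /(_ i) + /(_ i); case: (i \in A); case: (i \in A') => //;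
  case: (z i) => //= a h1 h2 _; split; rewrite ?invrK ?invr_neq0 //;
  by apply/eqP => a0; rewrite a0 in h1 h2.
Qed.

Lemma coord_ring_p1_coord A i : @coord_ring _ (p1n_atlas k n) A (fun z : P1 => p1_coord
  (i \in A) (z i)).
Proof. by apply: cr_gen; exists i. Qed.

Lemma p1dom_open A : open (p1dom A).
Proof.
rewrite /= glued_openE => A' z dA' dA.
(* Inside the chart [A'], the chart [A] is where the coordinates inverted in only one of the two are
   nonzero. *)
pose F i : P1 -> k := if (i \in A) == (i \in A') then fun=> 1 else fun z => p1_coord (i
  \in A') (z i).
exists (fun z => \prod_i F i z); split.
- apply: coord_ring_prod => i; rewrite /F.
  by case: ifP => _; [exact: cr_cst|exact: coord_ring_p1_coord].
- apply/prodf_neq0 => i _; rewrite /F; case: ifPn => [_|ne]; first exact: oner_neq0.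
  by have [] := p1_dom_coord dA dA' ne.
- move=> y dy /prodf_neq0 h i; have := h i isT; have := dy i; rewrite /F.
  case: (i \in A); case: (i \in A') => //=; case: (y i) => //=; rewrite ?eqxx //.
  by move=> a _ a0 [e]; rewrite e eqxx in a0.
Qed.

Lemma p1_coord_reg A i : reg (p1dom A) (fun z : P1 => p1_coord (i \in A) (z i)).
Proof.
move=> A' z dA' dA; have [e|ne] := eqVneq (i \in A) (i \in A').
  exists (fun z => p1_coord (i \in A') (z i)), (fun=> 1).
  split; [exact: coord_ring_p1_coord|exact: cr_cst|exact: oner_neq0|].
  by move=> y _ _ _; rewrite divr1 e.
exists (fun=> 1), (fun z => p1_coord (i \in A') (z i)).
split; [exact: cr_cst|exact: coord_ring_p1_coord|by have [] := p1_dom_coord dA dA' ne|].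
by move=> y dA'y dAy _; rewrite div1r; have [] := p1_dom_coord dAy dA'y ne.
Qed.

End P1Charts.

Section P1Fan.
Variables (R : realType) (n : nat) (B : 'M[int]_n) (uB : B \in unitmx).
Local Notation C := R[i].
Local Notation M := 'rV[int]_n.
Local Notation V := 'rV[R]_n.
Local Notation real_of := (real_of R).
Local Notation top E := (@top R n E).
Implicit Types (A : {set 'I_n}).

Definition sgnA A (i : 'I_n) : int := if i \in A then -1 else 1.

(** [A] marks the negative rays, so that it names the same chart as in [p1n_atlas], where exactly
    these coordinates are inverted. *)
Definition orthant A : 'M[int]_n := \matrix_(i, l) (sgnA A i * dualv B i 0 l).

Lemma row_orthant A i : row i (orthant A) = sgnA A i *: dualv B i.
Proof. by apply/rowP => l; rewrite !mxE. Qed.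

Lemma ipC (chi psi : M) : ip chi psi = ip psi chi.
Proof. by apply: eq_bigr => i _; rewrite mulrC. Qed.

Lemma sgnAK A i : sgnA A i * sgnA A i = 1.
Proof. by rewrite /sgnA; case: ifP; rewrite ?mulrNN mulr1. Qed.

Lemma orthant_dual A : orthant A \in unitmx /\
  forall j, dualv (orthant A) j = sgnA A j *: row j B.
Proof.
apply: unitmx_dual => i j; rewrite row_orthant ipZl ipZr ipC ip_dual //.
case: (eqVneq j i) => [->|ji]; first by rewrite mulr1 sgnAK.
by rewrite !mulr0.
Qed.

Lemma crd_orthant A v j : crd (orthant A) v j = (sgnA A j)%:~R * pairing (real_of (row
  j B)) v.
Proof. by rewrite /crd (orthant_dual A).2 real_ofZ pairingZl. Qed.

Definition orthants : seq 'M[int]_n := [seq orthant A | A <- enum {set 'I_n}].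

Lemma orthants_in A : orthant A \in orthants.
Proof. by apply: map_f; rewrite mem_enum. Qed.

Lemma orthants_valid : valid R orthants.
Proof.
split=> [_ /mapP[A _ ->]|]; first by have [] := orthant_dual A.
move=> _ _ /mapP[A _ ->] /mapP[A' _ ->] v /(fconeT _ _) h /(fconeT _ _) h'.
apply/funext => m; apply: eq_bigr => j _; have := h j; have := h' j.
rewrite !crd_orthant !row_orthant /sgnA; set x := pairing _ _.
(* A nonzero coordinate forces the same sign in both orthants, hence the same ray. *)
have [->|x0] := eqVneq x 0; first by rewrite !mulr0.
case: (j \in A); case: (j \in A') => //; rewrite mulrN1z !mulN1r mul1r !oppr_ge0 => h1 h2;
  by case/negP: x0; rewrite eq_le h1 h2.
Qed.

Let vO := orthants_valid.
Local Notation X := (toric_variety (@fan R n orthants)).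
Local Notation P1 := (P1n C B).

Definition to_p1 (p : X) : P1 :=
  fun i => if `[< dual_monoid (kcone p) (row i B) >]
    then Some (kval p (row i B)) else None.

Lemma to_p1_None (p : X) i : ~ dual_monoid (kcone p) (row i B) -> kval p (- row i B) = 0.
Proof.
move=> nd; apply/eqP; apply: contraT => /kval_neq0/orthN; rewrite opprK => h.
by case: nd; exact: orth_dual.
Qed.

Lemma dual_orthant A (p : X) i : kcone p `<=` top (orthant A) ->
  dual_monoid (kcone p) (sgnA A i *: row i B).
Proof.
by move=> pE v /pE/(fconeT _ _)/(_ i); rewrite crd_orthant real_ofZ pairingZl.
Qed.

Lemma to_p1_coord A (p : X) i : kcone p `<=` top (orthant A) ->
  p1_coord (i \in A) (to_p1 p i) = kval p (dualv (orthant A) i).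
Proof.
move=> /(@dual_orthant _ _ i); rewrite (orthant_dual A).2 /to_p1 /sgnA.
case: ifPn => iA; last by rewrite scale1r => d; rewrite asboolT.
rewrite scaleN1r => _; case: asboolP => [d|nd] /=; last by rewrite to_p1_None.
have [x0|/kval_neq0 h] := eqVneq (kval p (row i B)) 0; last by rewrite kval_orthN.
rewrite x0 invr0; apply/esym/eqP; apply: contraT => /kval_neq0/orthN.
by rewrite opprK => /kval_neq0; rewrite x0 eqxx.
Qed.

Lemma to_p1_dom A (p : X) : kcone p `<=` top (orthant A) <-> p1dom A (to_p1 p).
Proof.
split=> [pE i|h v pv].
  have := @dual_orthant _ _ i pE; rewrite /to_p1 /sgnA; case: ifP => iA.
    rewrite scaleN1r => d; case: asboolP => // d' [] /eqP; apply/negP/kval_neq0 => v pv.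
    apply/eqP; rewrite eq_le d' // andbT -oppr_ge0.
    by have := d v pv; rewrite real_ofN -scaleN1r pairingZl mulN1r.
  by rewrite scale1r => d; rewrite asboolT.
apply/(fconeT _ _) => i; rewrite crd_orthant /sgnA; have := h i; rewrite /to_p1.
case: ifP => iA; case: asboolP => // d.
- move=> x0; have /kval_neq0 o : kval p (row i B) != 0 by apply/eqP => e; apply: x0;
  rewrite e.
  by rewrite o // mulr0.
- move=> _; have [_ /mapP[A' _ ->] pE] := kcone_in_top p.
  have := @dual_orthant _ _ i pE; rewrite /sgnA; case: ifP => _; last by rewrite scale1r.
  by move=> /(_ v pv); rewrite scaleN1r real_ofN -scaleN1r pairingZl mulrN1z.
- by move=> _; rewrite mul1r; exact: d.
Qed.

Lemma p1_coord_inj A (z z' : P1) : p1dom A z -> p1dom A z' ->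
  (forall i, p1_coord (i \in A) (z i) = p1_coord (i \in A) (z' i)) -> z = z'.
Proof.
move=> dz dz' h; apply/funext => i; have := h i; have := dz i; have := dz' i.
case: (i \in A); case: (z i) => [a|]; case: (z' i) => [a'|] //=.
- by move=> _ _ /invr_inj ->.
- by move=> _ a0 /eqP; rewrite invr_eq0 => /eqP e; case: a0; rewrite e.
- by move=> a0 _ /esym/eqP; rewrite invr_eq0 => /eqP e; case: a0; rewrite e.
- by move=> _ _ ->.
Qed.

Lemma to_p1_inj : injective to_p1.
Proof.
move=> p p' e; have [_ /mapP[A _ ->] pE] := kcone_in_top p.
have pE' : kcone p' `<=` top (orthant A) by apply/to_p1_dom; rewrite -e; apply/to_p1_dom.
apply: (kpoint_chart_eq vO (orthants_in A) pE pE') => j.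
by rewrite -!to_p1_coord // e.
Qed.

Definition of_p1 (z : P1) : X :=
  let A := [set i | ~~ isSome (z i)]%SET in
  pt vO (orthants_in A) (fun i => p1_coord (i \in A) (z i)).

Lemma of_p1K : cancel of_p1 to_p1.
Proof.
move=> z; set A := [set i | ~~ isSome (z i)]%SET.
have dz : p1dom A z by move=> i /=; rewrite inE; case: (z i).
have pE : kcone (of_p1 z) `<=` top (orthant A) by exact: pt_top.
apply: (p1_coord_inj _ dz) => [|i]; first exact/to_p1_dom.
by rewrite to_p1_coord // pt_coord.
Qed.

Lemma to_p1K : cancel to_p1 of_p1.
Proof. by move=> p; apply: to_p1_inj; rewrite of_p1K. Qed.

Lemma to_p1_morphism : fmorphism to_p1.
Proof.
apply/fmorphismP => p; have [_ /mapP[A _ ->] pE] := kcone_in_top p.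
have ES := orthants_in A; have oU := uchart_top_open vO ES.
apply: (@mor_at_chart _ (p1n_atlas C n) X to_p1 (uchart (top (orthant A))) A) => //.
  by move=> q qE; exact/to_p1_dom.
move=> _ [i _ <-]; apply: (reg_ext (coord_reg vO i ES)) => q qE /=.
by rewrite to_p1_coord.
Qed.

Lemma of_p1_morphism : fmorphism of_p1.
Proof.
apply/fmorphismP => z; have [_ /mapP[A _ ->] pE] := kcone_in_top (of_p1 z).
have dE y : p1dom A y -> kcone (of_p1 y) `<=` top (orthant A).
  by move=> dy; apply/to_p1_dom; rewrite of_p1K.
apply: (@mor_at_top _ _ _ vO P1 of_p1 (p1dom A) _ (orthants_in A)).
- exact: p1dom_open.
- exact: dE.
- move=> j; apply: (reg_ext (@p1_coord_reg _ _ A j)) => y dy.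
  by rewrite -to_p1_coord ?of_p1K //; exact: dE.
- by have /to_p1_dom := pE; rewrite of_p1K.
Qed.

Lemma toric_p1_iso : tspace_iso X P1.
Proof.
exists to_p1, of_p1; split.
- exact: to_p1_morphism.
- exact: of_p1_morphism.
- exact: to_p1K.
- exact: of_p1K.
move=> t p; apply/funext => i; rewrite /= /p1n_act /to_p1 /=.
by case: asboolP.
Qed.

End P1Fan.

(** * Characters of constant sign *)

Section EqualSign.
Variable n : nat.
Local Notation M := 'rV[int]_n.
Implicit Types (S : seq 'M[int]_n) (E : 'M[int]_n) (chi : M).

(** The combinatorial counterpart of [orbit_blowups], which lets the sign argument proceed on
    integer matrices alone. *)
Inductive reach S : seq 'M[int]_n -> Prop :=
| reach_refl : reach S S
| reach_step S' E i j : reach S S' -> E \in S' -> i != j ->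
    reach S (star S' (row i E) (row j E)).

Lemma reach_trans S1 S2 S3 : reach S1 S2 -> reach S2 S3 -> reach S1 S3.
Proof. by move=> h; elim=> // S' E i j _ IH ES ij; exact: reach_step. Qed.

Definition units S := forall E, E \in S -> E \in unitmx.

Lemma star_child S rho sigma E' : units S -> rho != sigma -> E' \in star S rho sigma ->
  (E' \in S /\ forall i j, row i E' = rho -> row j E' = sigma -> False) \/
  exists E i j l, [/\ E \in S, row i E = rho, row j E = sigma & l = i \/ l = j] /\
    forall k, row k E' = if k == l then rho + sigma else row k E.
Proof.
move=> uS rs /(starP _ _ _ uS)[h|[E [i [j [ES ei ej h]]]]]; [by left|right].
case: h => ->.
  exists E, i, j, i; split; first by split=> //; left.
  by move=> k; rewrite row_subm ei ej.
exists E, i, j, j; split; first by split=> //; right.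
by move=> k; rewrite row_subm ei ej addrC.
Qed.

Lemma star_units S rho sigma : units S -> rho != sigma -> units (star S rho sigma).
Proof.
move=> uS rs E' /(starP _ _ _ uS)[[/uS//]|[E [i [j [/uS uE ei ej h]]]]].
have ij := star_neq ei ej rs; have ji : j != i by rewrite eq_sym.
by case: h => ->; [have [] := subm_dual uE ij|have [] := subm_dual uE ji].
Qed.

Lemma rows_neq S E i j : units S -> E \in S -> i != j -> row i E != row j E.
Proof. by move=> /[apply] uE; apply: contraNneq => /(row_inj uE) ->. Qed.

Lemma reach_units S S' : units S -> reach S S' -> units S'.
Proof.
move=> uS; elim=> // T E i j _ uT ET ij; apply: star_units => //; exact: rows_neq ET ij.
Qed.

Definition same_sign chi E :=
  (forall j, 0 <= ip chi (row j E)) \/ (forall j, ip chi (row j E) <= 0).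

Lemma reach_same_sign S S' chi : units S -> reach S S' ->
  (forall E, E \in S -> same_sign chi E) -> forall E, E \in S' -> same_sign chi E.
Proof.
move=> uS rS h; have := reach_units uS; elim: rS => // T E i j rT IH ET ij uS' E'.
have uT := uS' _ rT.
move=> /(star_child uT (rows_neq uT ET ij))[[E'T _]|[E1 [i1 [j1 [l [[E1T ei ej _]
  er]]]]]]; first exact: IH.
have [s|s] := IH uS' E1 E1T; [left|right] => k; rewrite er; case: eqP => _ //.
  by rewrite ipDr -ei -ej addr_ge0.
by rewrite ipDr -ei -ej; have := s i1; have := s j1; lia.
Qed.

Section OneCharacter.
Variable chi : M.
Local Notation a := (ip chi).

Definition bad_bound S (N : int) := forall E k l, E \in S ->
  0 < a (row k E) -> a (row l E) < 0 -> a (row k E) - a (row l E) <= N.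

Lemma star_bad S E i j N : units S -> bad_bound S N -> E \in S ->
  0 < a (row i E) -> a (row j E) < 0 ->
  forall E' k l, E' \in star S (row i E) (row j E) ->
  0 < a (row k E') -> a (row l E') < 0 ->
  a (row k E') - a (row l E') < N \/
  (row k E', row l E') <> (row i E, row j E) /\
  exists E1 k1 l1, [/\ E1 \in S, row k E' = row k1 E1 & row l E' = row l1 E1].
Proof.
move=> uS bS ES ai aj E' k l.
have rs : row i E != row j E by apply/eqP => e; rewrite e in ai; lia.
move=> /(star_child uS rs)[[ES' nn]|[E1 [i1 [j1 [m [[E1S ei ej mij] er]]]]]] ak al.
  right; split; last by exists E', k, l.
  by case=> ek el; exact: (nn k l).
rewrite -ei -ej in rs ai aj er *.
move: ak al; rewrite !er; case: (eqVneq k m) => km; case: (eqVneq l m) => lm;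
  rewrite ?ipDr => ak al.
- lia.
(* A negative ray [l] facing a positive rho + sigma was already bad with rho; passing to the sum
   lowers the size by the absolute value of chi at sigma. The next case is symmetric. *)
- by left; have := bS _ i1 l E1S ai al; lia.
- by left; have := bS _ k j1 E1S ak aj; lia.
- right; split; last by exists E1, k, l.
  have uE := uS _ E1S; case=> /(row_inj uE) ek /(row_inj uE) el.
  by case: mij => e; [case/eqP: km; rewrite ek|case/eqP: lm; rewrite el].
Qed.

Lemma same_sign_bound0 S : bad_bound S 0 -> forall E, E \in S -> same_sign chi E.
Proof.
move=> b E ES; have [[i ai]|ni] := pselect (exists i, 0 < a (row i E)); last first.
  by right=> j; rewrite leNgt; apply/negP => h; apply: ni; exists j.
by left=> j; rewrite leNgt; apply/negP => h; have := b E i j ES ai h; lia.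
Qed.

(** Lexicographic induction on the bound and on a list [s] containing all bad pairs of extremal
    size: a subdivision strikes its pair off the list and adds no other, and once no extremal pair
    is left the bound drops. *)
Lemma reach_bound (N : nat) S : units S -> bad_bound S N%:Z ->
  exists S', reach S S' /\ forall E, E \in S' -> same_sign chi E.
Proof.
elim: N S => [|N IHN] S uS bS.
  by exists S; split; [exact: reach_refl|exact: same_sign_bound0].
have [s hs] : exists s : seq (M * M), forall E k l, E \in S -> (row k E, row l E) \in s.
  exists (flatten [seq [seq (row k E, row l E) | k <- enum 'I_n,
    l <- enum 'I_n] | E <- S]).
  move=> E k l ES; apply/flatten_mapP; exists E => //.
  by apply/allpairsP; exists (k, l); rewrite !mem_enum.
have {hs} : forall E k l, E \in S -> 0 < a (row k E) -> a (row l E) < 0 ->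
    a (row k E) - a (row l E) = N.+1%:Z -> (row k E, row l E) \in s.
  by move=> E k l ES _ _ _; exact: hs.
have [m] := ubnP (size s); elim: m s S uS bS => // m IHm s S uS bS sm hs.
have [[E [i [j [ES ai aj aij]]]]|nb] := pselect (exists E i j,
    [/\ E \in S, 0 < a (row i E), a (row j E) < 0 & a (row i E) - a (row j E) =
      N.+1%:Z]); last first.
  apply: IHN => // E k l ES ak al; have := bS E k l ES ak al.
  have : a (row k E) - a (row l E) <> N.+1%:Z by move=> e; apply: nb; exists E, k, l.
  lia.
have rs : row i E != row j E by apply/eqP => e; rewrite e in ai; lia.
have ij : i != j by apply: contraNneq rs => ->.
have key := star_bad uS bS ES ai aj.
have [||||S' [r h]] := IHm [seq q <- s | q != (row i E,
  row j E)] (star S (row i E) (row j E)).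
- exact: star_units.
- move=> E' k l E'S ak al; have [/ltW//|[_ [E1 [k1 [l1 [E1S ek el]]]]]] :=
  key E' k l E'S ak al.
  by rewrite ek el in ak al *; exact: bS.
- rewrite ltnS in sm; apply: leq_trans sm.
  rewrite size_filter -(count_predC (pred1 (row i E, row j E)) s).
  by rewrite -add1n leq_add2r -has_count; apply/hasP; exists (row i E, row j E) => //=;
    apply: hs.
- move=> E' k l E'S ak al akl; have [|[ne [E1 [k1 [l1 [E1S ek el]]]]]] :=
  key E' k l E'S ak al.
    by rewrite akl ltxx.
  rewrite mem_filter; apply/andP; split; first exact/eqP.
  by rewrite ek el in ak al akl *; exact: hs.
exists S'; split=> //; apply: reach_trans r; apply: reach_step => //; exact: reach_refl.
Qed.

Lemma reach_one S : units S ->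
  exists S', reach S S' /\ forall E, E \in S' -> same_sign chi E.
Proof.
(* A difference of two values is at most twice the larger absolute value, which is one term of this
   sum. *)
move=> uS; pose N := (\sum_(E <- S) \sum_k `|a (row k E)|.*2)%N.
apply: (@reach_bound N) => // E k l ES _ _.
have le1 k' : (`|a (row k' E)|.*2 <= N)%N.
  apply: (@leq_trans (\sum_k `|a (row k E)|.*2)%N);
    first by rewrite (bigD1 k') //= leq_addr.
  by rewrite /N (big_rem E) //= leq_addr.
have := le1 k; have := le1 l; lia.
Qed.

End OneCharacter.

Lemma reach_all (s : seq M) S : units S -> exists S', reach S S' /\
  forall chi, chi \in s -> forall E, E \in S' -> same_sign chi E.
Proof.
elim: s S => [|chi s IH] S uS; first by exists S; split=> //; exact: reach_refl.
have [S1 [r1 h1]] := reach_one chi uS; have uS1 := reach_units uS r1.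
have [S2 [r2 h2]] := IH S1 uS1; exists S2; split; first exact: reach_trans r2.
move=> psi; rewrite inE => /orP[/eqP ->|]; last exact: h2.
exact: reach_same_sign r2 h1.
Qed.

End EqualSign.

Lemma reach_blowups (R : realType) (n : nat) (B : 'M[int]_n) (S : seq 'M[int]_n) :
  B \in unitmx -> reach (orthants B) S ->
  [/\ valid R S, S != [::] & orbit_blowups (P1n _ B) (toric_variety (@fan R n S))].
Proof.
move=> uB; elim=> [|T E i j rT [vT _ bT] ET ij].
  have vO := orthants_valid R uB; split=> //; last exact/orbit_blowups_nil/toric_p1_iso.
  by apply/eqP => e; have := orthants_in B finset.set0; rewrite e.
have rs := rows_neq vT.1 ET ij; split.
- exact: star_valid.
- have [h _] := star_subm vT ET (erefl (row i E)) (erefl (row j E)).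
  by apply/eqP => e; rewrite e in h.
- exact: (star_blowup vT rs ET (erefl _) (erefl _) bT).
Qed.

(** * Components of intersections of layers *)

Section Adapted.
Variable n : nat.
Local Notation M := 'rV[int]_n.
Variable G : set M.
Hypothesis sG : subgroup G.

Lemma subgroupN chi : G chi -> G (- chi).
Proof. by move=> h; rewrite -sub0r; apply: sG.2 => //; exact: sG.1. Qed.

Lemma subgroupD chi psi : G chi -> G psi -> G (chi + psi).
Proof. by move=> h h'; rewrite -[psi]opprK; apply: sG.2 => //; exact: subgroupN. Qed.

Lemma subgroupMn chi k : G chi -> G (chi *+ k).
Proof.
by move=> h; elim: k => [|k IH]; [exact: sG.1|rewrite mulrS; exact: subgroupD].
Qed.

Lemma subgroupZ (a : int) chi : G chi -> G (a *: chi).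
Proof.
have nZ m : m%:Z *: chi = chi *+ m by rewrite -natz scaler_nat.
move=> h; case: a => m; first by rewrite nZ; exact: subgroupMn.
by rewrite NegzE scaleNr nZ; apply/subgroupN/subgroupMn.
Qed.

Lemma subgroup_sum (I : finType) (F : I -> M) : (forall i, G (F i)) -> G (\sum_i F i).
Proof. by move=> h; elim/big_ind: _ => //; [exact: sG.1|exact: subgroupD]. Qed.

(** The dual vectors in [J] span the saturation of [G]. They come from the Smith normal form of a
    matrix with rows in [G] of maximal rational rank. *)
Lemma adapted_basis : exists E (J : {set 'I_n}), [/\ E \in unitmx,
  G `<=` supp_lattice E J &
  forall j, j \in J -> exists2 k : nat, k != 0%N & G (dualv E j *+ k)].
Proof.
pose rk r := exists k (A : 'M[int]_(k, n)), (forall i, G (row i A)) /\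
  \rank (map_mx intr A : 'M[rat]_(k, n)) = r.
have ex0 : exists r, `[< rk r >].
  exists (\rank (map_mx intr (0 : 'M[int]_(0, n)) : 'M[rat]_(0, n))).
  by apply/asboolP; exists 0%N, 0; split=> // -[].
have ub r : `[< rk r >] -> (r <= n)%N by move=> /asboolP[k [A [_ <-]]];
  exact: rank_leq_col.
case: (ex_maxnP ex0 ub) => r /asboolP[k [A [GA rA]]] maxr.
have [L uL [Q uQ [d _ AE]]] := int_Smith_normal_form A.
set Dm := \matrix_(i, j) _ in AE.
have dE j : dualv (invmx Q)^T j = row j Q.
  by rewrite /dualv -trmx_inv invmxK tr_col trmxK.
exists (invmx Q)^T, [set j : 'I_n | (j < k)%N && (d`_j != 0)]%SET; split.
- by rewrite unitmx_tr unitmx_inv.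
- move=> chi Gchi j jJ.
  (* Appending [chi] cannot raise the rank, so [chi] is a rational combination of the rows of [A],
     all of which have zero coordinates outside [J] in the basis [Q]. *)
  pose A' := col_mx A chi.
  have GA' i : G (row i A').
    by case: (split_ordP i) => i' ->; rewrite ?rowKu ?rowKd // row_id.
  have leA : (map_mx intr A <= (map_mx intr A' : 'M[rat]_(k + 1, n)))%MS.
    by rewrite map_col_mx -addsmxE addsmxSl.
  have : (map_mx intr A' <= (map_mx intr A : 'M[rat]_(k, n)))%MS.
    rewrite -(mxrank_leqif_sup leA) eqn_leq (mxrank_leqif_sup leA).1 rA andTb.
    by apply: maxr; apply/asboolP; exists (k + 1)%N, A'.
  rewrite map_col_mx -addsmxE addsmx_sub => /andP[_ /submxP[w cw]].
  have -> : ip chi (row j (invmx Q)^T) = (chi *m invmx Q) 0 j.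
    by rewrite mxE; apply: eq_bigr => l _; rewrite !mxE.
  apply: (@intr_inj rat); rewrite rmorph0.
  have -> : ((chi *m invmx Q) 0 j)%:~R = (map_mx intr (chi *m invmx Q) : 'rV[rat]_n) 0
    j by rewrite [RHS]mxE.
  rewrite map_mxM cw AE !map_mxM -!mulmxA -map_mxM mulmxV // map_mx1 mulmx1 mulmxA mxE.
  apply: big1 => i _; rewrite !mxE; case: eqP => [ij|_];
    last by rewrite mulr0n rmorph0 mulr0.
  move: jJ; rewrite inE -ij ltn_ord /= negbK => /eqP ->.
  by rewrite mul0rn rmorph0 mulr0.
- move=> j; rewrite inE => /andP[jk dj]; exists (absz d`_j); first by rewrite absz_eq0.
  rewrite dE.
  (* Row [j] of this product is the invariant factor d_j times row [j] of [Q], which exhibits the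
     required multiple up to sign. *)
  have GL i : G (row i (invmx L *m A)).
    rewrite row_mul mulmx_sum_row; apply: subgroup_sum => l; exact: subgroupZ.
  have := GL (Ordinal jk); rewrite AE -mulmxA mulKmx // row_mul mulmx_sum_row (bigD1 j)
    //= big1 => [|l lj].
    rewrite addr0 !mxE eqxx mulr1n => h.
    have nZ m : row j Q *+ m = m%:Z *: row j Q by rewrite -natz scaler_nat.
    rewrite nZ; case: (ger0P d`_j) => [d0|/ltW d0]; first by rewrite gez0_abs.
    by rewrite lez0_abs // scaleNr; exact: subgroupN.
  by rewrite !mxE /=; case: eqP => [e|_]; [case/eqP: lj;
    exact/val_inj|rewrite mulr0n scale0r].
Qed.

End Adapted.

Section Layers.
Variables (R : realType) (n : nat).
Local Notation C := R[i].
Local Notation M := 'rV[int]_n.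
Local Notation T := (torus_space C n).
Local Notation cr := (@coord_ring C (torus_atlas C n) tt).
Implicit Types (E : 'M[int]_n) (chi psi : M) (J : {set 'I_n}) (s t : T).

Lemma tcharZ (a : int) chi t : tchar (a *: chi) t = tchar chi t ^ a.
Proof.
rewrite /tchar; elim/big_rec2: _ => [|i x y _ ->]; first by rewrite exp1rz.
by rewrite mxE expfzMl exprz_exp [chi 0 i * a]mulrC.
Qed.

Lemma tcharN chi t : tchar (- chi) t = (tchar chi t)^-1.
Proof. by rewrite -scaleN1r tcharZ. Qed.

Lemma tcharX chi t m : tchar (chi *+ m) t = tchar chi t ^+ m.
Proof. by rewrite -scaler_nat natz tcharZ. Qed.

Lemma tchar_mon E chi t : E \in unitmx ->
  tchar chi t = mon E (fun j => tchar (dualv E j) t) chi.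
Proof.
move=> uE; rewrite {1}(chi_decomp chi uE) /mon.
elim/big_rec2: _ => [|j x y _ <-]; first exact: tchar0.
by rewrite tcharD tcharZ.
Qed.

Lemma coord_ring_tchar chi : cr (tchar chi).
Proof. by apply: cr_gen; exists chi. Qed.

Lemma torus_open (f : T -> C) : cr f -> open [set s : T | f s != 0].
Proof. by move=> cf; rewrite /= glued_openE => -[] s _ /= fs; exists f. Qed.

(** A coset of the common kernel of some dual vectors; for unimodular [E] they are part of a lattice
    basis, so this kernel is a subtorus. *)
Definition subtorus E J t : set T :=
  [set s | forall j, j \in J -> tchar (dualv E j) s = tchar (dualv E j) t].

Lemma subtorusE E J t s : E \in unitmx -> subtorus E J t s <->
  forall chi, supp_lattice E J chi -> tchar chi s = tchar chi t.
Proof.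
move=> uE; split=> [h chi sc|h j jJ]; last first.
  by apply: h => k kJ; rewrite ip_dual //; case: eqP => // e; rewrite e jJ in kJ.
rewrite !(tchar_mon _ _ uE); apply: eq_bigr => j _.
by have [/h ->|/sc ->] := boolP (j \in J); rewrite ?expr0z.
Qed.

Section Curve.
Variables (E : 'M[int]_n) (c : 'I_n -> {poly C}).

(** A character may have negative exponents in the [c j]; a power of their product clears the
    denominators. *)
Lemma torus_curve f : cr f -> exists (P : {poly C}) m, forall e s,
  (forall j, (c j).[e] != 0) ->
  (forall chi, tchar chi s = mon E (fun j => (c j).[e]) chi) ->
  f s * (\prod_j c j).[e] ^+ m = P.[e].
Proof.
elim=> {f} [_ [chi _ <-]|a|f g _ [P [m hP]] _ [Q [l hQ]]|f g _ [P [m hP]] _ [Q [l hQ]]].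
- pose m := (\sum_j `|ip chi (row j E)|)%N.
  have m0 j : 0 <= ip chi (row j E) + m%:Z.
    have : (`|ip chi (row j E)| <= m)%N by rewrite /m (bigD1 j) //= leq_addr.
    lia.
  exists (\prod_j c j ^+ absz (ip chi (row j E) + m%:Z)), m => e s c0 ->.
  rewrite /mon !horner_prod -prodrXl -big_split; apply: eq_bigr => j _ /=.
  by rewrite horner_exp [in RHS]exprnP gez0_abs // expfzDr // -exprnP.
- by exists a%:P, 0%N => e s _ _; rewrite expr0 mulr1 hornerC.
- exists (P * (\prod_j c j) ^+ l + Q * (\prod_j c j) ^+ m), (m + l)%N => e s c0 h.
  rewrite hornerD !hornerM !horner_exp -(hP e s) // -(hQ e s) // exprD; ring.
- exists (P * Q), (m + l)%N => e s c0 h.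
  rewrite hornerM -(hP e s) // -(hQ e s) // exprD; ring.
Qed.

End Curve.

Lemma subtorus_irreducible E J t s0 s1 (f g : T -> C) : E \in unitmx ->
  subtorus E J t s0 -> subtorus E J t s1 -> cr f -> cr g -> f s0 != 0 -> g s1 != 0 ->
  exists s, [/\ subtorus E J t s, f s != 0 & g s != 0].
Proof.
move=> uE h0 h1 cf cg f0 g1; pose q j s := tchar (dualv E j) s.
(* Coordinates in [J] agree at both ends, so the line stays in the coset as long as no [c j]
   vanishes. One end shows [P] nonzero, the other [Q], and a common nonroot is the desired
   parameter. *)
pose c j : {poly C} := (q j s0)%:P + 'X * (q j s1 - q j s0)%:P.
have cE j e : (c j).[e] = q j s0 + e * (q j s1 - q j s0) by rewrite !hornerE.
have c0 j : (c j).[0] = q j s0 by rewrite cE mul0r addr0.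
have c1 j : (c j).[1] = q j s1 by rewrite cE mul1r addrC subrK.
have [P [m hP]] := torus_curve E c cf; have [Q [l hQ]] := torus_curve E c cg.
have P0 : P != 0.
  have hs0 : forall chi, tchar chi s0 = mon E (fun j => (c j).[0]) chi.
    by move=> chi; rewrite (tchar_mon _ _ uE); apply: eq_bigr => j _; rewrite c0.
  have cn j : (c j).[0] != 0 by rewrite c0 tchar_neq0.
  have Wn : (\prod_j c j).[0] != 0 by rewrite horner_prod; apply/prodf_neq0.
  apply/eqP => e; have := hP 0 s0 cn hs0; rewrite e horner0 => /eqP.
  by rewrite mulf_eq0 (negPf f0) expf_eq0 (negPf Wn) andbF.
have Q0 : Q != 0.
  have hs1 : forall chi, tchar chi s1 = mon E (fun j => (c j).[1]) chi.
    by move=> chi; rewrite (tchar_mon _ _ uE); apply: eq_bigr => j _; rewrite c1.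
  have cn j : (c j).[1] != 0 by rewrite c1 tchar_neq0.
  have Wn : (\prod_j c j).[1] != 0 by rewrite horner_prod; apply/prodf_neq0.
  apply/eqP => e; have := hQ 1 s1 cn hs1; rewrite e horner0 => /eqP.
  by rewrite mulf_eq0 (negPf g1) expf_eq0 (negPf Wn) andbF.
have W0 : \prod_j c j != 0.
  apply/prodf_neq0 => j _; apply/eqP => e; have := c0 j; rewrite e horner0 => /esym/eqP.
  by rewrite (negPf (tchar_neq0 _ _)).
have [e] := poly_nonroot (mulf_neq0 (mulf_neq0 P0 Q0) W0).
rewrite !hornerM !mulf_eq0 !negb_or => /andP[/andP[Pe Qe]].
rewrite horner_prod => /prodf_neq0 We.
have cn j : (c j).[e] != 0 by exact: We.
have [s sE] := torus_point E cn; exists s; split.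
- move=> j jJ; rewrite sE /mon (bigD1 j) //= ip_dual // eqxx expr1z big1 ?mulr1 => [|k
  kj].
    by rewrite cE /q (h0 j jJ) (h1 j jJ) subrr mulr0 addr0.
  by rewrite ip_dual // (negPf kj) expr0z.
- by apply: contraNneq Pe => fs; rewrite -(hP e s) // fs mul0r.
- by apply: contraNneq Qe => gs; rewrite -(hQ e s) // gs mul0r.
Qed.

Lemma subtorus_connected E J t : E \in unitmx -> connected (subtorus E J t).
Proof.
move=> uE B [s0 Bs0] [U oU BU] [F cF BF]; apply/seteqP; split;
  first by rewrite BU => s [].
move=> s1 h1; apply: contrapT => nB.
have [h0 U0] : (subtorus E J t `&` U) s0 by rewrite -BU.
have nF : (~` F) s1 by move=> Fs1; apply: nB; rewrite BF.
have oF : open (~` F) by rewrite openC.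
rewrite /= glued_openE in oU; have [f [cf f0 fU]] := oU tt s0 I U0.
rewrite /= glued_openE in oF; have [g [cg g1 gF]] := oF tt s1 I nF.
have [s [hs fs gs]] := subtorus_irreducible uE h0 h1 cf cg f0 g1.
apply: (gF s I gs).
have : B s by rewrite BU; split=> //; exact: fU.
by rewrite BF => -[].
Qed.

Section Component.
Variables (Z : set T) (t : T).
Hypothesis Zt : Z t.
(** Defined from [Z] without a base point; when [Z] is an intersection of layers it contains all
    their lattices. *)
Let G : set M := [set chi | forall s s', Z s -> Z s' -> tchar chi s = tchar chi s'].
Hypothesis ZG : forall s, (forall chi, G chi -> tchar chi s = tchar chi t) -> Z s.

Lemma component_subtorus E J : E \in unitmx -> G `<=` supp_lattice E J ->
  (forall j, j \in J -> exists2 k : nat, k != 0%N & G (dualv E j *+ k)) ->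
  connected_component Z t = subtorus E J t.
Proof.
move=> uE GJ Gk; apply/seteqP; split; last first.
  apply: connected_component_max; [by []| |exact: subtorus_connected].
  by move=> s /(subtorusE _ _ _ uE) h; apply: ZG => chi /GJ/h.
have CZ := @connected_component_sub T Z t; set CC := connected_component Z t in CZ *.
have CCc : connected CC by exact: component_connected.
have hk j : exists k : nat, j \in J -> k != 0%N /\ G (dualv E j *+ k).
  have [/Gk[k k0 Gj]|nJ] := boolP (j \in J); first by exists k.
  by exists 0%N.
have [kk hkk] := choice hk.
pose q j s := tchar (dualv E j) s.
pose F j s := \sum_(i < kk j) q j s ^+ ((kk j).-1 - i) * q j t ^+ i.
(* The two factors of q^k - q(t)^k have no common zero, since the second equals k q(t)^(k-1)
   wherever q = q(t). Hence the coset is open as well as closed in the component. *)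
have FE j s : j \in J -> Z s -> (q j s = q j t) <-> F j s != 0.
  move=> jJ Zs; have [k0 Gj] := hkk j jJ.
  have : (q j s - q j t) * F j s = 0.
    by rewrite -subrXX /q -!tcharX (Gj s t Zs Zt) subrr.
  move=> /eqP; rewrite mulf_eq0 subr_eq0 => h; split=> [e|F0]; last first.
    by move: h; rewrite (negPf F0) orbF => /eqP.
  rewrite /F e (eq_bigr (fun=> q j t ^+ (kk j).-1)) => [|i _].
    rewrite sumr_const card_ord -mulr_natr mulf_neq0 ?expf_neq0 ?tchar_neq0 //.
    by rewrite pnatr_eq0.
  by rewrite -exprD subnK // -ltnS prednK ?lt0n.
suff <- : CC `&` subtorus E J t = CC by exact: subIsetr.
apply: CCc.
- by exists t; split=> //; exact: connected_component_refl.
- exists [set s | \prod_(j in J) F j s != 0].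
    apply: torus_open; rewrite (_ : (fun s => _) = (fun s => \prod_(j <- index_enum
      'I_n | j \in J) F j s)) //.
    apply: coord_ring_prod => j; apply: coord_ring_sum => i.
    by apply: cr_mul; [apply: coord_ring_exp; exact: coord_ring_tchar|exact: cr_cst].
  apply/seteqP; split=> s [Cs h]; split=> //.
    by apply/prodf_neq0 => j jJ; apply/(FE j s jJ (CZ _ Cs))/h.
  by move=> j jJ; apply/(FE j s jJ (CZ _ Cs)); have /prodf_neq0 := h; apply.
- exists (subtorus E J t) => //; rewrite -openC /= glued_openE => -[] s _ ns.
  have [j [jJ nj]] : exists j, j \in J /\ q j s != q j t.
    apply: contrapT => nn; apply: ns => j jJ; apply/eqP; apply: contraT => nj;
      case: nn; by exists j.
  exists (fun s => q j s + - q j t); split; [|by rewrite subr_eq0|].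
    by apply: cr_add; [exact: coord_ring_tchar|exact: cr_cst].
  by move=> y _; rewrite subr_eq0 => nyj hy; case/eqP: nyj; exact: hy.
Qed.

Lemma const_subgroup : subgroup G.
Proof.
split=> [s s' _ _|chi psi h h' s s' Zs Zs']; first by rewrite !tchar0.
by rewrite !tcharD !tcharN (h s s') // (h' s s').
Qed.

End Component.

Lemma supp_subgroup E J : subgroup (supp_lattice E J).
Proof.
split=> [j _|chi psi h h' j jJ]; first exact: ip0l.
by rewrite ipBl h // h' // subrr.
Qed.

Lemma supp_split E J : E \in unitmx -> split_summand (supp_lattice E J).
Proof.
move=> uE; split; first exact: supp_subgroup.
exists (supp_lattice E (~: J)); split; first exact: supp_subgroup.
  move=> chi; exists (\sum_(j in J) ip chi (row j E) *: dualv E j),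
    (\sum_(j | j \notin J) ip chi (row j E) *: dualv E j); split.
  - move=> k kJ; rewrite ip_suml big1 // => j jJ; rewrite ipZl ip_dual //.
    by case: eqP => [e|_]; [rewrite e jJ in kJ|rewrite mulr0].
  - move=> k; rewrite inE negbK => kJ; rewrite ip_suml big1 // => j jJ;
    rewrite ipZl ip_dual //.
    by case: eqP => [e|_]; [rewrite -e kJ in jJ|rewrite mulr0].
  - rewrite {1}(chi_decomp chi uE) (bigID (mem J)) //=.
move=> chi h h'; rewrite (chi_decomp chi uE) big1 // => j _.
have [jJ|/h ->] := boolP (j \in J); last by rewrite scale0r.
by rewrite h' ?scale0r // inE negbK.
Qed.

Definition subtorus_layer E J (uE : E \in unitmx) t : layer R n :=
  Layer (supp_split J uE) (fun chi _ => tchar_neq0 chi t) (fun chi psi _ _ => tcharD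
    chi psi t).

Lemma subtorus_layerE E J (uE : E \in unitmx) t :
  layer_set (subtorus_layer J uE t) = subtorus E J t.
Proof. by apply/seteqP; split=> s; rewrite /layer_set /= subtorusE. Qed.

Lemma same_sign_propertyE S E J (uE : E \in unitmx) t : valid R S ->
  (forall j E', E' \in S -> same_sign (dualv E j) E') ->
  layer_propertyE (subtorus E J t) (fan S).
Proof.
move=> vS h; exists (subtorus_layer J uE t); first by rewrite subtorus_layerE.
move=> s [E' ES' [J' ->]]; have uE' := vS.1 _ ES'.
exists #|J'|, [tuple Defs.real_of R (row (enum_val i) E') | i < #|J'|]; split.
- exact: rows_free.
- by rewrite fcone_cone //; congr cone; apply/funext => i; rewrite tnth_mktuple.
(* The sign depends on the cone [E'], as property (E) permits a different basis for each cone. *)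
pose c j : R := if `[< forall i, 0 <= ip (dualv E j) (row i E') >] then 1 else -1.
have c0 j : c j != 0 by rewrite /c; case: ifP => _; rewrite ?oppr_eq0 oner_eq0.
exists #|J|, [tuple c (enum_val i) *: Defs.real_of R (dualv E (enum_val i)) | i < #|J|].
split; first exact: supp_lattice_basis.
move=> i k; rewrite !tnth_mktuple pairingZl pairing_real /c; case: asboolP => [ge|nge].
  by rewrite mul1r ler0z.
have [//|le] := h (enum_val i) E' ES'.
by rewrite mulN1r oppr_ge0 lerz0.
Qed.

End Layers.

Section Arrangement.
Variables (R : realType) (n m : nat) (A : 'I_m -> layer R n).

(** [E] and [J] precede [t]: all components of one intersection are cosets of the same subtorus, so
    one lattice basis serves them all. *)
Lemma arrangement_subtorus (I : set 'I_m) : exists E (J : {set 'I_n}), E \in unitmx /\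
  forall t, (\bigcap_(i in I) layer_set (A i)) t ->
    connected_component (\bigcap_(i in I) layer_set (A i)) t = subtorus E J t.
Proof.
set Z := \bigcap_(i in I) layer_set (A i).
have [E [J [uE GJ Gk]]] := adapted_basis (const_subgroup Z).
exists E, J; split=> // t Zt; apply: component_subtorus => // s h i Ii chi Gchi.
rewrite h; first exact: Zt.
by move=> s1 s2 Zs1 Zs2; rewrite (Zs1 i Ii chi Gchi) (Zs2 i Ii chi Gchi).
Qed.

End Arrangement.

Theorem proposition6p1 (R : realType) (n m : nat)
    (B : 'M[int]_n) (hB : B \in unitmx) (A : 'I_m -> layer R n) :
  exists D : set (set 'rV[R]_n),
    [/\ is_fan D,
        smooth n (toric_variety D),
        orbit_blowups (P1n _ B) (toric_variety D) &
        forall L, arrangement_layer A L -> layer_propertyE L D].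
Proof.
have [E hE] := choice (arrangement_subtorus A).
have [J hJ] := choice hE.
(* One lattice basis for each of the finitely many sets of layers. *)
pose chars := [seq dualv (E [set` K : {set 'I_m}]) j | K <- enum {set 'I_m},
  j <- enum 'I_n].
have uO : units (orthants B) by have [] := orthants_valid R hB.
have [S [rS sS]] := reach_all chars uO.
have [vS S0 bS] := reach_blowups R hB rS.
exists (fan S); split=> //; first exact: fan_is_fan.
  exact: toric_smooth.
move=> _ [I [t [Zt ->]]]; have [uE ->//] := hJ I.
apply: same_sign_propertyE => // j E' ES'; apply: (sS _ _ E' ES').
(* A classical subset of a finite type is rewritten as a finite set, so that it occurs in the
   enumeration defining [chars]. *)
have -> : I = [set` [set i | `[< I i >]]%SET].
  by apply/seteqP; split=> i /=; rewrite inE => /asboolP.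
by apply/allpairsP; exists ([set i | `[< I i >]]%SET, j); rewrite !mem_enum.
Qed.
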